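(* Let $M \subset \mathbb{R}^3$ be a smooth convex closed surface with everywhere positive Gauss curvature. Then $M$ is Gauss infinitesimally rigid; that is, every isogauss infinitesimal deformation $\eta \colon M \to \mathbb{R}^3$ of $M$ is trivial, i.e. there is $a \in \mathbb{R}^3$ with $\eta(x) = a$ for all $x \in M$.
   Context: An infinitesimal deformation of a smooth surface $M \subset \mathbb{R}^3$ is a smooth map $\eta \colon M \to \mathbb{R}^3$ (a vector field along $M$). Put $\phi_t(x) = x + t\eta(x)$ for $t \in (-\epsilon,\epsilon)$ with $\epsilon>0$ small enough that all $\phi_t$ are embeddings, and $M_t = \phi_t(M)$. Let $K_t \colon M_t \to \mathbb{R}$ be the Gauss curvature of $M_t$, $K = K_0$, and $\dot K := \lim_{t\to 0}\frac{K_t\circ\phi_t - K}{t} \colon M \to \mathbb{R}$. The deformation $\eta$ is called isogauss if (1) $T_xM$ is parallel to $T_{\phi_t(x)}M_t$ for all $x \in M$ and all $t \in (-\epsilon,\epsilon)$, and (2) $\dot K(x) = 0$ for all $x \in M$. *)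

(* Defs.v *)
From HB Require Import structures.
From mathcomp Require Import all_boot all_order all_algebra.
From mathcomp Require Import all_classical all_reals all_analysis.

Set Implicit Arguments.
Unset Strict Implicit.
Unset Printing Implicit Defensive.

Import Order.TTheory GRing.Theory Num.Theory.
Import numFieldNormedType.Exports.

Local Open Scope classical_set_scope.
Local Open Scope ring_scope.

Definition dot (R : realType) (n : nat) (u v : 'rV[R]_n) : R :=
  \sum_(i < n) u 0 i * v 0 i.

Definition cross (R : realType) (u v : 'rV[R]_3) : 'rV[R]_3 :=
  \row_(i < 3) (u 0 (i + 1) * v 0 (i + 2%:R) - u 0 (i + 2%:R) * v 0 (i + 1)).

(** [U] is always an open set below. *)
Fixpoint Ck_on (R : realType) (V W : normedModType R) (k : nat)
    (U : set V) (f : V -> W) : Prop :=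
  match k with
  | 0%N => forall x, U x -> {for x, continuous f}
  | k'.+1 => (forall x, U x -> differentiable f x) /\
             (forall v : V, Ck_on k' U (fun x => 'D_v f x))
  end.

Definition smooth_on (R : realType) (V W : normedModType R)
    (U : set V) (f : V -> W) : Prop := forall k, Ck_on k U f.

Definition homeo_onto_image (V W : topologicalType)
    (A : set V) (f : V -> W) : Prop :=
  {within A, continuous f} /\
  exists g : W -> V,
    {within f @` A, continuous g} /\ forall x, A x -> g (f x) = x.

(** [X], restricted to the open set [U], is a regular local parametrization
    of an open part of [S].  The values of [X] outside [U] are irrelevant. *)
Definition local_param (R : realType) (S : set 'rV[R]_3)
    (U : set 'rV[R]_2) (X : 'rV[R]_2 -> 'rV[R]_3) : Prop :=
  [/\ open U,
      smooth_on U X,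
      forall u, U u -> injective ('d X u : 'rV[R]_2 -> 'rV[R]_3),
      homeo_onto_image U X &
      exists V : set 'rV[R]_3, open V /\ X @` U = S `&` V].

Definition smooth_surface (R : realType) (S : set 'rV[R]_3) : Prop :=
  forall p, S p -> exists U X, local_param S U X /\ (X @` U) p.

(** The tangent plane as a linear subspace (of vectors, not translated to
    [p]); two tangent planes are parallel when these subspaces are equal. *)
Definition tangent_space (R : realType) (S : set 'rV[R]_3) (p : 'rV[R]_3) :
    set 'rV[R]_3 :=
  [set v | exists U X u w,
     [/\ local_param S U X, U u, X u = p & v = 'd X u w]].

Section GaussCurvature.
Variable R : realType.
Implicit Types (X : 'rV[R]_2 -> 'rV[R]_3) (u : 'rV[R]_2).

Definition partial (i : 'I_2) X : 'rV[R]_2 -> 'rV[R]_3 :=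
  fun u => 'D_(delta_mx 0 i) X u.

Definition unit_normal X u : 'rV[R]_3 :=
  let n := cross (partial 0 X u) (partial 1 X u) in
  (Num.sqrt (dot n n))^-1 *: n.

Definition first_form X u : 'M[R]_2 :=
  \matrix_(i, j) dot (partial i X u) (partial j X u).

Definition second_form X u : 'M[R]_2 :=
  \matrix_(i, j) dot (partial i (partial j X) u) (unit_normal X u).

Definition param_curvature X u : R :=
  \det (second_form X u) / \det (first_form X u).

(** The curvature does not depend on the parametrization, so for a smooth
    surface [S] and [p] in [S] the set below is a singleton. *)
Definition gauss_curvature (S : set 'rV[R]_3) (p : 'rV[R]_3) : R :=
  get [set k | exists U X u,
     [/\ local_param S U X, U u, X u = p & k = param_curvature X u]].

End GaussCurvature.

(** Boundary of a compact convex set with nonempty interior. *)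
Definition closed_convex_surface (R : realType) (M : set 'rV[R]_3) : Prop :=
  smooth_surface M /\
  exists C : set 'rV[R]_3,
    [/\ convex_set C, compact C, C° !=set0 & M = closure C `\` C°].

(** Maps on [M] are represented by total functions on the ambient space, of
    which only the values on [M] matter. *)
Definition smooth_along (R : realType) (M : set 'rV[R]_3)
    (f : 'rV[R]_3 -> 'rV[R]_3) : Prop :=
  forall U X, local_param M U X -> smooth_on U (f \o X).

Definition embedding (R : realType) (M : set 'rV[R]_3)
    (f : 'rV[R]_3 -> 'rV[R]_3) : Prop :=
  [/\ smooth_along M f,
      forall U X u, local_param M U X -> U u ->
        injective ('d (f \o X) u : 'rV[R]_2 -> 'rV[R]_3) &
      homeo_onto_image M f].

Definition flow (R : realType) (eta : 'rV[R]_3 -> 'rV[R]_3) (t : R) :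
    'rV[R]_3 -> 'rV[R]_3 :=
  fun x => x + t *: eta x.

Definition isogauss (R : realType) (M : set 'rV[R]_3)
    (eta : 'rV[R]_3 -> 'rV[R]_3) : Prop :=
  exists eps : R,
    [/\ 0 < eps,
        forall t : R, - eps < t < eps -> embedding M (flow eta t),
        forall (x : 'rV[R]_3) (t : R), M x -> - eps < t < eps ->
          tangent_space M x =
          tangent_space (flow eta t @` M) (flow eta t x) &
        forall x, M x ->
          (gauss_curvature (flow eta t @` M) (flow eta t x)
             - gauss_curvature M x) / t @[t --> 0^'] --> (0 : R)].

Definition gauss_infinitesimally_rigid (R : realType) (M : set 'rV[R]_3) :
    Prop :=
  forall eta : 'rV[R]_3 -> 'rV[R]_3,
    smooth_along M eta -> isogauss M eta ->
    exists a : 'rV[R]_3, forall x, M x -> eta x = a.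

(* Main.v *)
(** An isogauss deformation [eta] has a tangential differential, since tangent
    planes are preserved.  That differential [A] is symmetric for the second
    fundamental form, and the curvature of the deformed surface is
    [K / det (1 + t A)], so [A] is trace-free.  Only pointwise maximum principles
    are used from there on; [nu] is the outer normal scaled by
    [<x - b0, nu> = 1] for a fixed interior point [b0].

    If [<eta - p, nu>] attains its minimum [m] at [x], then [m <= 0] and
    [eta x - p = m (x - b0)].  Applied to the midpoint of two candidates, this
    shows that at most one [p] satisfies [<eta - p, nu> >= 0] on the surface.

    For a unit vector [e], the function [<eta, e>] satisfies an elliptic equation
    without zero-order term away from the two poles, the points with normal
    direction [e] and [- e].  The barrier [expR (k <x, e>)] then shows that its
    maximum is attained at a pole [x], and for the pole of direction [e] the same
    touching argument gives [<eta - eta x, nu> >= 0] everywhere; the other case is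
    symmetric.  Hence [eta x], or else [eta] at the antipode of [x], is the unique
    one-sided support point of its sign, for every [x], and [eta] is constant. *)

From HB Require Import structures.
Require Import Defs.
From mathcomp Require Import all_boot all_order all_algebra.
From mathcomp Require Import all_classical all_reals all_analysis.
From mathcomp Require Import ring lra.

Set Implicit Arguments.
Unset Strict Implicit.
Unset Printing Implicit Defensive.

Import Order.TTheory GRing.Theory Num.Theory.
Import numFieldNormedType.Exports.

Local Open Scope classical_set_scope.
Local Open Scope ring_scope.

(** * Smooth functions on open sets *)

(** Where the equation for [<eta, e>] comes from: the trace-free maps that are symmetric for the
    second fundamental form make up a plane, and away from the poles such a map is determined by the
    gradient of [<eta, e>], which is its transpose applied to the gradient of [<x, e>]. The
    differential can thus be eliminated from the contracted Hessian, leaving first-order terms only.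
    The elimination divides by a quantity that vanishes at the poles, so the maximum principle stops
    there, and a maximum at a pole has to be exploited in another way. For that, [<eta - p, nu>] is
    treated as a support function, homogeneous of degree one in [nu]. The perturbations added to it
    are support functions too: [|nu| - <nu, e>] belongs to a unit ball centred at [- e], the
    distance of [nu] to the axis belongs to a unit disc orthogonal to [e]. At a touching point the
    disc contributes nothing along [e] and the ball forces [<eta - p, e> > 0], which contradicts
    maximality at the pole. *)

Lemma near_eq_differentiable (R : realType) (V W : normedModType R)
    (f g : V -> W) x :
  (\forall y \near x, f y = g y) -> differentiable f x -> differentiable g x.
Proof.
move=> fg df; have fgx := nbhs_singleton fg.
have [cd H] := (diff_locallyP _ _).1 df.
have Hg : g \o shift x = cst (g x) + 'd f x +o_ 0 id.
  apply/eqaddoP => e e0.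
  move/eqaddoP : H => /(_ e e0) H.
  have fg0 : \forall h \near 0, f (h + x) = g (h + x).
    by move: fg; rewrite (near_shift 0) subr0.
  near=> h.
  have <- : `|f (h + x) - (f x + 'd f x h)| = `|(g \o shift x - (cst (g x) + 'd f x)) h|.
    by rewrite (near fg0 h) // fgx.
  by near: h.
have E := diff_unique cd Hg.
apply/diff_locallyP; split; first by rewrite E.
by rewrite E.
Unshelve. all: by end_near. Qed.

Section CkOn.
Variables (R : realType) (V : normedModType R) (U : set V).

Lemma Ck_on_continuous (W : normedModType R) k (f : V -> W) u :
  Ck_on k U f -> U u -> {for u, continuous f}.
Proof.
case: k => [|k] /= => [H Uu|[H _] Uu]; first exact: H.
exact/differentiable_continuous/H.
Qed.

Lemma Ck_onS (W : normedModType R) k (f : V -> W) :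
  Ck_on k.+1 U f -> Ck_on k U f.
Proof.
elim: k f => [|k IH] f /= [df Df]; first by move=> x /df /differentiable_continuous.
by split=> // v; apply: IH; exact: Df.
Qed.

Hypothesis oU : open U.

Let nearU (P : V -> Prop) u : U u -> (forall y, U y -> P y) -> \forall y \near u, P y.
Proof. by move=> Uu H; have := open_nbhs_nbhs (conj oU Uu); apply: filterS. Qed.

Lemma eq_in_derive (W : normedModType R) (f g : V -> W) u v :
  (forall y, U y -> f y = g y) -> U u -> 'D_v f u = 'D_v g u.
Proof. by move=> fg Uu; apply: near_eq_derive; exact: nearU. Qed.

Lemma Ck_on_eq (W : normedModType R) k (f g : V -> W) :
  (forall y, U y -> f y = g y) -> Ck_on k U f -> Ck_on k U g.
Proof.
elim: k f g => [|k IH] f g fg /=.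
  move=> cf u Uu; have fgu := nearU Uu fg.
  rewrite /prop_for /continuous_at -fg //.
  by apply: cvg_trans (cf u Uu); apply: near_eq_cvg.
move=> [df Df]; split.
  by move=> u Uu; apply: near_eq_differentiable (df u Uu); exact: nearU.
move=> v; apply: IH (Df v) => y Uy; exact: eq_in_derive.
Qed.

Lemma Ck_on_cst (W : normedModType R) k (a : W) : Ck_on k U (cst a : V -> W).
Proof.
elim: k a => [|k IH] a /=; first by move=> u _; exact: cst_continuous.
split=> [u _|v]; first exact: differentiable_cst.
have -> : (fun x => 'D_v (cst a) x) = cst (0 : W) by apply/funext => x; rewrite derive_cst.
exact: IH.
Qed.

Implicit Types f g : V -> R.

Lemma Ck_onD k f g : Ck_on k U f -> Ck_on k U g -> Ck_on k U (f + g).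
Proof.
elim: k f g => [|k IH] f g /=.
  by move=> cf cg u Uu; apply: continuousD; [exact: cf|exact: cg].
move=> [df Df] [dg Dg]; split=> [u Uu|v].
  by apply: differentiableD; [exact: df|exact: dg].
apply: Ck_on_eq (IH _ _ (Df v) (Dg v)) => u Uu.
by rewrite deriveD //; apply: diff_derivable; [exact: df|exact: dg].
Qed.

Lemma Ck_onN k f : Ck_on k U f -> Ck_on k U (- f).
Proof.
elim: k f => [|k IH] f /=.
  by move=> cf u Uu; apply: continuousN; exact: cf.
move=> [df Df]; split=> [u Uu|v].
  by apply: differentiableN; exact: df.
apply: Ck_on_eq (IH _ (Df v)) => u Uu.
by rewrite deriveN //; apply: diff_derivable; exact: df.
Qed.

Lemma Ck_onM k f g : Ck_on k U f -> Ck_on k U g -> Ck_on k U (f * g).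
Proof.
elim: k f g => [|k IH] f g.
  by move=> /= cf cg u Uu; apply: continuousM; [exact: cf|exact: cg].
move=> Cf Cg; have [df Df] := Cf; have [dg Dg] := Cg; split=> [u Uu|v].
  by apply: differentiableM; [exact: df|exact: dg].
apply: Ck_on_eq (Ck_onD (IH _ _ (Ck_onS Cf) (Dg v)) (IH _ _ (Ck_onS Cg) (Df v))) => u Uu.
by rewrite deriveM //; apply: diff_derivable; [exact: df|exact: dg].
Qed.

Lemma Ck_onV k f : (forall u, U u -> f u != 0) ->
  Ck_on k U f -> Ck_on k U (fun x => (f x)^-1).
Proof.
move=> f0; elim: k => [|k IH].
  by move=> /= cf u Uu; apply: continuousV; [exact: f0|exact: cf].
move=> Cf; have [df Df] := Cf; split=> [u Uu|v].
  by apply: differentiableV; [exact: df|exact: f0].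
have C := IH (Ck_onS Cf).
apply: Ck_on_eq (Ck_onM (Ck_onN (Ck_onM C C)) (Df v)) => u Uu.
rewrite deriveV ?f0 //; last by apply: diff_derivable; exact: df.
by rewrite !fctE expr2 invfM.
Qed.

Lemma derive_expR_comp f u v : differentiable f u ->
  differentiable (fun x => expR (f x)) u /\
  'D_v (fun x => expR (f x)) u = expR (f u) * 'D_v f u.
Proof.
move=> df; have de : differentiable (expR : R -> R) (f u).
  by apply/derivable1_diffP; exact: derivable_expR.
have dc := differentiable_comp df de.
split; first exact: dc.
rewrite deriveE // (_ : (fun x => _) = expR \o f) // diff_comp // /=.
have -> : 'd expR (f u) = *:%R^~ (expR^`()%classic (f u)) :> (R -> R).
  by apply: deriv1E; exact: derivable_expR.
by rewrite derive1E derive_val -deriveE // [LHS]mulrC.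
Qed.

Lemma Ck_on_expR k f : Ck_on k U f -> Ck_on k U (fun x => expR (f x)).
Proof.
elim: k => [|k IH].
  move=> /= cf u Uu; apply: (@continuous_comp _ _ _ f expR); first exact: cf.
  exact: continuous_expR.
move=> Cf; have [df Df] := Cf; split=> [u Uu|v].
  by have [] := derive_expR_comp 0 (df u Uu).
apply: Ck_on_eq (Ck_onM (IH (Ck_onS Cf)) (Df v)) => u Uu.
by have [_ ->] := derive_expR_comp v (df u Uu).
Qed.

Lemma derive_lin (W : normedModType R) (f : V -> W) u a b v w :
  differentiable f u -> 'D_(a *: v + b *: w) f u = a *: 'D_v f u + b *: 'D_w f u.
Proof. by move=> df; rewrite !deriveE // linearD !linearZ. Qed.

Lemma Ck_on_coord n k (X : V -> 'rV[R]_n.+1) j :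
  Ck_on k U X -> Ck_on k U (fun u => X u 0 j).
Proof.
elim: k X => [|k IH] X.
  move=> /= cX u Uu; apply: (@continuous_comp _ _ _ X (fun M => M 0 j)); first exact: cX.
  exact: coord_continuous.
move=> [dX DX]; split=> [u Uu|v].
  apply: (@differentiable_comp _ _ _ _ X (fun M : 'rV_n.+1 => M 0 j)); first exact: dX.
  exact: differentiable_coord.
apply: Ck_on_eq (IH _ (DX v)) => u Uu.
by rewrite derive_mx ?mxE //; apply: diff_derivable; exact: dX.
Qed.

End CkOn.

Section SmoothOn.
Variables (R : realType) (V : normedModType R) (U : set V).
Hypothesis oU : open U.
Implicit Types f g : V -> R.

Lemma smooth_onD f g : smooth_on U f -> smooth_on U g -> smooth_on U (f + g).
Proof. by move=> Cf Cg k; apply: Ck_onD. Qed.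

Lemma smooth_onN f : smooth_on U f -> smooth_on U (- f).
Proof. by move=> Cf k; apply: Ck_onN. Qed.

Lemma smooth_onB f g : smooth_on U f -> smooth_on U g -> smooth_on U (f - g).
Proof. by move=> Cf Cg; apply: smooth_onD => //; exact: smooth_onN. Qed.

Lemma smooth_onM f g : smooth_on U f -> smooth_on U g -> smooth_on U (f * g).
Proof. by move=> Cf Cg k; apply: Ck_onM. Qed.

Lemma smooth_on_cst (a : R) : smooth_on U (cst a : V -> R).
Proof. by move=> k; apply: Ck_on_cst. Qed.

Lemma smooth_onV f : (forall u, U u -> f u != 0) ->
  smooth_on U f -> smooth_on U (fun x => (f x)^-1).
Proof. by move=> f0 Cf k; apply: Ck_onV. Qed.

Lemma smooth_on_expR f : smooth_on U f -> smooth_on U (fun x => expR (f x)).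
Proof. by move=> Cf k; apply: Ck_on_expR. Qed.

Lemma smooth_on_coord n (X : V -> 'rV[R]_n.+1) j :
  smooth_on U X -> smooth_on U (fun u => X u 0 j).
Proof. by move=> CX k; apply: Ck_on_coord. Qed.

Lemma smooth_on_derive (W : normedModType R) (f : V -> W) v :
  smooth_on U f -> smooth_on U (fun u => 'D_v f u).
Proof. by move=> Cf k; have [_] := Cf k.+1; apply. Qed.

Lemma smooth_on_differentiable (W : normedModType R) (f : V -> W) u :
  smooth_on U f -> U u -> differentiable f u.
Proof. by move=> Cf Uu; have [+ _] := Cf 1%N; apply. Qed.

Lemma smooth_on_continuous (W : normedModType R) (f : V -> W) u :
  smooth_on U f -> U u -> {for u, continuous f}.
Proof. by move=> Cf; exact: Ck_on_continuous (Cf 0%N). Qed.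

Lemma smooth_on_eq (W : normedModType R) (f g : V -> W) :
  (forall y, U y -> f y = g y) -> smooth_on U f -> smooth_on U g.
Proof. by move=> fg Cf k; apply: Ck_on_eq (Cf k). Qed.

Lemma derive_coord n (X : V -> 'rV[R]_n.+1) u v j :
  smooth_on U X -> U u -> ('D_v X u) 0 j = 'D_v (fun u => X u 0 j) u.
Proof.
move=> CX Uu; rewrite derive_mx ?mxE //; apply: diff_derivable.
exact: smooth_on_differentiable CX Uu.
Qed.

Lemma is_derive_line f u v r : differentiable f (u + r *: v) ->
  is_derive r 1 (fun r => f (u + r *: v)) ('D_v f (u + r *: v)).
Proof.
move=> dfu; have df : derivable f (u + r *: v) v by exact: diff_derivable.
have E : (fun h : R => h^-1 *: (((fun r => f (u + r *: v)) \o shift r) (h *: 1) - f (u + r *: v)))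
   = (fun h => h^-1 *: ((f \o shift (u + r *: v)) (h *: v) - f (u + r *: v))).
  apply/funext => h /=; congr (_ *: (f _ - _)).
  by rewrite [h *: 1]mulr1 scalerDl addrCA.
by split; rewrite /derivable /derive E.
Qed.

End SmoothOn.

(** * Second-order conditions at local maxima *)

Section SecondOrder.
Variables (R : realType) (V : normedModType R) (U : set V).
Hypothesis oU : open U.
Implicit Types f g : V -> R.

Lemma MVT01 (g dg : R -> R) :
  (forall r : R, 0 <= r <= 1 -> is_derive r 1 g (dg r)) ->
  exists2 r, 0 < r < 1 & g 1 - g 0 = dg r.
Proof.
move=> H; have [|||r rI ->] := @MVT R g dg 0 1.
- by [].
- by move=> r; rewrite in_itv /= => /andP[r0 r1]; apply: H; rewrite !ltW.
- apply: derivable_within_continuous => r; rewrite in_itv /= => /H [].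
  by [].
- by exists r; [move: rI; rewrite in_itv | rewrite subr0 mulr1].
Qed.

Lemma near_segment (P : V -> Prop) u : (\forall y \near u, P y) ->
  exists2 d : R, 0 < d & forall v, `|v| < d -> P (u + v).
Proof.
move=> /nbhs_ballP [d d0 H]; exists d => // v vd; apply: H.
by rewrite -ball_normE /= opprD addrA subrr add0r normrN.
Qed.

Lemma MVT_segment01 f u v : (forall r : R, 0 <= r <= 1 -> differentiable f (u + r *: v)) ->
  exists2 r, 0 < r < 1 & f (u + v) - f u = 'D_v f (u + r *: v).
Proof.
move=> H; have [r rI E] := MVT01 (fun r rI => is_derive_line (H r rI)).
by exists r => //; rewrite -E /= scale1r scale0r addr0.
Qed.

Lemma scaler_norm_lt (d r : R) (v : V) : 0 <= r <= 1 -> `|v| < d -> `|r *: v| < d.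
Proof.
move=> /andP[r0 r1] vd; apply: le_lt_trans vd.
by rewrite normrZ ger0_norm // ler_piMl.
Qed.

Lemma small_scale (d : R) (v : V) : 0 < d -> exists2 s : R, 0 < s & `|s *: v| < d.
Proof.
move=> d0; exists (d / (`|v| + 1)); first by rewrite divr_gt0 // ltr_wpDl.
have p : 0 < `|v| + 1 by rewrite ltr_wpDl.
rewrite normrZ ger0_norm; last by rewrite divr_ge0 // ltW.
by rewrite -mulrA gtr_pMr // mulrC ltr_pdivrMr // mul1r ltrDl.
Qed.

Lemma openP_near u : U u -> \forall y \near u, U y.
Proof. by move=> Uu; exact: open_nbhs_nbhs. Qed.

Lemma local_max_derive f u v : smooth_on U f -> U u ->
  (\forall y \near u, f y <= f u) -> 'D_v f u = 0.
Proof.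
move=> Cf Uu mx.
have [d d0 H] := near_segment (filterI mx (openP_near Uu)).
have [s s0 sv] := small_scale v d0.
have Hr r : - s < r < s -> f (u + r *: v) <= f u /\ U (u + r *: v).
  move=> rs; apply: H; apply: le_lt_trans sv.
  rewrite !normrZ ler_wpM2r // (ger0_norm (ltW s0)) ltW //.
  by rewrite ltr_norml.
pose g r := f (u + r *: v).
have dg r : - s < r < s -> is_derive r 1 g ('D_v f (u + r *: v)).
  move=> /Hr [_ Ur]; apply: is_derive_line.
  exact: smooth_on_differentiable Cf Ur.
have I0 : - s < 0 < s by rewrite oppr_lt0 s0.
have [] := @derive1_at_max R g (- s) s 0.
- by rewrite ltW // gtrN.
- by move=> t; rewrite in_itv /= => /dg [].
- by rewrite in_itv.
- by move=> t; rewrite in_itv /= /g scale0r addr0 => /Hr [].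
- by move=> _; have [_ ->] := dg 0 I0; rewrite scale0r addr0.
Qed.

Lemma near_continuous f u (e : R) : smooth_on U f -> U u -> 0 < e ->
  \forall y \near u, `|f u - f y| < e.
Proof.
move=> Cf Uu e0; have := smooth_on_continuous Cf Uu.
by move=> /cvgrPdist_lt /(_ e e0).
Qed.

Lemma near_gt0 f u : smooth_on U f -> U u -> 0 < f u -> \forall y \near u, 0 < f y.
Proof.
move=> Cf Uu f0; apply: filterS (near_continuous Cf Uu f0) => y.
by rewrite ltr_norml => /andP[_]; rewrite gtrBl.
Qed.

Lemma derive_segment_diff f u w : smooth_on U f ->
  (forall r : R, 0 <= r <= 1 -> U (u + r *: w)) ->
  exists2 q, 0 < q < 1 & f (u + w) - f u = 'D_w f (u + q *: w).
Proof.
move=> Cf H; apply: MVT_segment01 => r rI.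
by apply: smooth_on_differentiable Cf _; exact: H.
Qed.

Lemma deriveZv f u (s : R) v : differentiable f u -> 'D_(s *: v) f u = s * 'D_v f u.
Proof. by move=> df; rewrite !deriveE // linearZ. Qed.

(** Two mean values, one for [f] and one for its derivative, which vanishes at [u], turn the
    increment of [f] along a short step into a positive multiple of a second derivative near [u].
    Were that positive, [f] would exceed its maximum. *)
Lemma local_max_derive2 f u v : smooth_on U f -> U u ->
  (\forall y \near u, f y <= f u) -> 'D_v (fun x => 'D_v f x) u <= 0.
Proof.
move=> Cf Uu mx; rewrite leNgt; apply/negP => p.
have D0 := local_max_derive v Cf Uu mx.
have C1 := smooth_on_derive v Cf; have C2 := smooth_on_derive v C1.
have nc := near_continuous C2 Uu p.
have [d d0 H] := near_segment (filterI nc (filterI mx (openP_near Uu))).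
have [s s0 sv] := small_scale v d0.
have Hs (r : R) : 0 <= r <= 1 -> U (u + r *: (s *: v)).
  by move=> rI; have [] := H (r *: (s *: v)) (scaler_norm_lt rI sv) => _ [].
have [q qI E] := derive_segment_diff Cf Hs.
have qI' : 0 <= q <= 1 by case/andP: qI => a b; rewrite !ltW.
have Hq (r : R) : 0 <= r <= 1 -> U (u + r *: (q *: (s *: v))).
  move=> /andP[r0 r1]; rewrite scalerA; apply: Hs.
  by case/andP: qI' => q0 q1; rewrite mulr_ge0 //= mulr_ile1.
have [t tI E2] := derive_segment_diff C1 Hq.
have tI' : 0 <= t <= 1 by case/andP: tI => a b; rewrite !ltW.
have [_ [fle _]] := H _ sv.
have : f (u + s *: v) - f u > 0; last by rewrite subr_gt0 ltNge fle.
rewrite E deriveZv; last by apply: smooth_on_differentiable Cf _; exact: Hs.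
move: E2; rewrite D0 subr0 => ->.
have dt := smooth_on_differentiable C1 (Hq t tI').
rewrite (deriveZv _ _ dt) (deriveZv _ _ dt).
apply: mulr_gt0; [exact: s0|apply: mulr_gt0; first by case/andP: qI].
apply: mulr_gt0; first exact: s0.
have [] := H (t *: (q *: (s *: v))); first by do 2 apply: scaler_norm_lt => //.
by rewrite ltr_distlC subrr => /andP[].
Qed.

(** The second difference of [f] over a small parallelogram is symmetric in the two directions, and
    mean values identify it with either mixed derivative at some point of the parallelogram.
    Distinct mixed derivatives at [u] would stay apart nearby. *)
Lemma schwarz_derive f u v w : smooth_on U f -> U u ->
  'D_v (fun x => 'D_w f x) u = 'D_w (fun x => 'D_v f x) u.
Proof.
have main (v' w' : V) d (s : R) : smooth_on U f -> U u -> 0 < s ->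
   (forall x, `|x| < d -> U (u + x)) -> `|s *: v'| < d / 2 -> `|s *: w'| < d / 2 ->
   exists2 x, `|x| < d & f (u + s *: v' + s *: w') - f (u + s *: v') - (f (u + s *: w') - f u) =
     s ^+ 2 * 'D_w' (fun x => 'D_v' f x) (u + x).
  move=> Cf Uu s0 Ud sv sw.
  have UU (q r : R) : 0 <= q <= 1 -> 0 <= r <= 1 -> `|q *: (s *: v') + r *: (s *: w')| < d.
    move=> qI rI; apply: le_lt_trans (ler_normD _ _) _.
    by rewrite [d]splitr ltrD // scaler_norm_lt.
  pose g r := f (u + s *: w' + r *: (s *: v')) - f (u + r *: (s *: v')).
  have C1 := smooth_on_derive v' Cf.
  have U1 (r : R) : 0 <= r <= 1 -> U (u + s *: w' + r *: (s *: v')).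
    move=> rI; rewrite -addrA [_ + r *: _]addrC -(scale1r (s *: w')).
    by apply/Ud/UU => //; rewrite ler01 lexx.
  have U0 (r : R) : 0 <= r <= 1 -> U (u + r *: (s *: v')).
    move=> rI; have := UU r 0 rI; rewrite lexx ler01 scale0r addr0 => /(_ isT).
    exact: Ud.
  have dg (r : R) : 0 <= r <= 1 -> is_derive r 1 g
     ('D_(s *: v') f (u + s *: w' + r *: (s *: v')) - 'D_(s *: v') f (u + r *: (s *: v'))).
    move=> rI; apply: is_deriveB; apply: is_derive_line.
      exact: smooth_on_differentiable Cf (U1 r rI).
    exact: smooth_on_differentiable Cf (U0 r rI).
  have [r rI E] := MVT01 dg.
  have rI' : 0 <= r <= 1 by case/andP: rI => a b; rewrite !ltW.
  have d1 := smooth_on_differentiable Cf (U1 r rI').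
  have d2 := smooth_on_differentiable Cf (U0 r rI').
  have Hq (q : R) : 0 <= q <= 1 -> U (u + r *: (s *: v') + q *: (s *: w')).
    by move=> qI; rewrite -addrA; apply/Ud/UU.
  have [q qI E2] := derive_segment_diff C1 Hq.
  have qI' : 0 <= q <= 1 by case/andP: qI => a b; rewrite !ltW.
  have d3 := smooth_on_differentiable C1 (Hq q qI').
  exists (r *: (s *: v') + q *: (s *: w')); first exact: UU.
  move: E; rewrite /g !scale1r !scale0r !addr0 (deriveZv _ _ d1) (deriveZv _ _ d2) -mulrBr.
  rewrite ![u + s *: w' + _]addrAC E2 (deriveZv _ _ d3) addrA expr2 -mulrA => <-.
  by rewrite !opprB !addrA [RHS]addrAC; ring.
move=> Cf Uu; apply/eqP/negPn/negP => ne.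
set A := 'D_v _ u in ne; set B := 'D_w _ u in ne.
have e0 : 0 < `|A - B| / 2 by rewrite divr_gt0 // normr_gt0 subr_eq0.
have CA := smooth_on_derive v (smooth_on_derive w Cf).
have CB := smooth_on_derive w (smooth_on_derive v Cf).
have [d d0 H] := near_segment (filterI (near_continuous CA Uu e0)
   (filterI (near_continuous CB Uu e0) (openP_near Uu))).
have d20 : 0 < d / 2 by rewrite divr_gt0.
have [s1 s10 sv] := small_scale v d20.
have [s2 s20 sw] := small_scale w d20.
pose s := Num.min s1 s2.
have s0 : 0 < s by rewrite lt_min s10.
have ss1 : s <= s1 by rewrite ge_min lexx.
have ss2 : s <= s2 by rewrite ge_min lexx orbT.
have {}sv : `|s *: v| < d / 2.
  by apply: le_lt_trans sv; rewrite !normrZ !gtr0_norm // ler_wpM2r.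
have {}sw : `|s *: w| < d / 2.
  by apply: le_lt_trans sw; rewrite !normrZ !gtr0_norm // ler_wpM2r.
have Ud x : `|x| < d -> U (u + x) by move=> /H [_ []].
have [x xd Ex] := main v w d s Cf Uu s0 Ud sv sw.
have [y yd Ey] := main w v d s Cf Uu s0 Ud sw sv.
have Exy : 'D_w (fun x => 'D_v f x) (u + x) = 'D_v (fun x => 'D_w f x) (u + y).
  have s2n : s ^+ 2 != 0 by rewrite expf_neq0 // gt_eqF.
  apply: (mulfI s2n); move: Ex Ey; rewrite [u + s *: w + s *: v]addrAC.
  move: (f (u + s *: v + s *: w)) (f (u + s *: v)) (f (u + s *: w)) (f u).
  move: ('D_w _ _) ('D_v _ _) => P Q a b c e <- <-.
  by rewrite !opprB addrACA [RHS]addrACA [- b + _]addrC; congr (_ + _); rewrite addrC.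
have [_ [hB _]] := H x xd; have [hA _] := H y yd.
rewrite -Exy in hA.
have : `|A - B| < `|A - B| / 2 + `|A - B| / 2.
  rewrite -/A in hA; rewrite -/B in hB; move: hA hB; move: ('D_w _ (u + x)) => P; clearbody A B => hA hB.
  apply: le_lt_trans (ler_distD P A B) _.
  by apply: ltrD; [exact: hA|rewrite distrC; exact: hB].
by rewrite -splitr ltxx.
Qed.

End SecondOrder.

HB.lock Definition pd (R : realType) (i : 'I_2) (f : 'rV[R]_2 -> R) :
  'rV[R]_2 -> R := fun u => 'D_(delta_mx 0 i) f u.

Section Partial.
Variables (R : realType) (U : set 'rV[R]_2).
Hypothesis oU : open U.
Implicit Types (f g : 'rV[R]_2 -> R) (i j : 'I_2) (u v : 'rV[R]_2).

Lemma smooth_on_pd i f : smooth_on U f -> smooth_on U (pd i f).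
Proof. by rewrite pd.unlock; exact: smooth_on_derive. Qed.

Lemma eq_in_pd i f g u : (forall y, U y -> f y = g y) -> U u -> pd i f u = pd i g u.
Proof. by rewrite pd.unlock => fg Uu; exact: eq_in_derive fg Uu. Qed.

Let der i f u (Cf : smooth_on U f) (Uu : U u) : derivable f u (delta_mx 0 i) :=
  diff_derivable (smooth_on_differentiable Cf Uu).

Lemma pdD i f g u : smooth_on U f -> smooth_on U g -> U u ->
  pd i (f + g) u = pd i f u + pd i g u.
Proof. by move=> Cf Cg Uu; rewrite pd.unlock; rewrite deriveD; [done|exact: der|exact: der]. Qed.

Lemma pdN i f u : smooth_on U f -> U u -> pd i (- f) u = - pd i f u.
Proof. by move=> Cf Uu; rewrite pd.unlock; rewrite deriveN; [done|exact: der]. Qed.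

Lemma pdB i f g u : smooth_on U f -> smooth_on U g -> U u ->
  pd i (f - g) u = pd i f u - pd i g u.
Proof.
by move=> Cf Cg Uu; rewrite pdD //; [rewrite pdN|exact: smooth_onN].
Qed.

Lemma pdM i f g u : smooth_on U f -> smooth_on U g -> U u ->
  pd i (f * g) u = pd i f u * g u + f u * pd i g u.
Proof.
move=> Cf Cg Uu; rewrite pd.unlock deriveM; [|exact: der|exact: der].
move: ('D_(_) f u) ('D_(_) g u) => a b; rewrite [LHS]addrC [a * _]mulrC; reflexivity.
Qed.

Lemma pd_cst i (a : R) u : pd i (cst a) u = 0.
Proof. by rewrite pd.unlock derive_cst. Qed.

Lemma pd_expR i f u : smooth_on U f -> U u ->
  pd i (fun x => expR (f x)) u = expR (f u) * pd i f u.
Proof.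
move=> Cf Uu; rewrite pd.unlock.
by have [_] := derive_expR_comp (delta_mx 0 i) (smooth_on_differentiable Cf Uu).
Qed.

Lemma pdC i j f u : smooth_on U f -> U u -> pd i (pd j f) u = pd j (pd i f) u.
Proof. by move=> Cf Uu; rewrite pd.unlock; exact: schwarz_derive Cf Uu. Qed.

Lemma row2E v : v = v 0 0 *: delta_mx 0 0 + v 0 1 *: delta_mx 0 1.
Proof.
rewrite {1}[v]row_sum_delta big_ord_recl big_ord1.
by have -> : lift ord0 ord0 = 1 :> 'I_2 by exact/val_inj.
Qed.

Lemma derive_pd f u v : differentiable f u ->
  'D_v f u = v 0 0 * pd 0 f u + v 0 1 * pd 1 f u.
Proof. by move=> df; rewrite {1}[v]row2E derive_lin // pd.unlock. Qed.

Lemma derive2_pd f u v : smooth_on U f -> U u ->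
  'D_v (fun x => 'D_v f x) u =
  v 0 0 ^+ 2 * pd 0 (pd 0 f) u + 2 * v 0 0 * v 0 1 * pd 0 (pd 1 f) u
   + v 0 1 ^+ 2 * pd 1 (pd 1 f) u.
Proof.
move=> Cf Uu; have C1 := smooth_on_derive v Cf.
rewrite derive_pd; last exact: smooth_on_differentiable C1 Uu.
have E y : U y -> 'D_v f y = (cst (v 0 0) * pd 0 f + cst (v 0 1) * pd 1 f) y.
  by move=> Uy; rewrite derive_pd //; exact: smooth_on_differentiable Cf Uy.
have c0 a : smooth_on U (cst a : 'rV[R]_2 -> R) by exact: smooth_on_cst.
have p0 := smooth_on_pd 0 Cf; have p1 := smooth_on_pd 1 Cf.
rewrite !(eq_in_pd _ E Uu) !pdD ?pdM ?pd_cst //; try exact: smooth_onM.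
rewrite (pdC 1 0 Cf Uu) /cst; ring.
Qed.

Lemma local_max_pd f u i : smooth_on U f -> U u ->
  (\forall y \near u, f y <= f u) -> pd i f u = 0.
Proof. by move=> Cf Uu mx; rewrite pd.unlock; exact: local_max_derive Cf Uu mx. Qed.

Lemma local_max_pd2 f u (s t : R) : smooth_on U f -> U u ->
  (\forall y \near u, f y <= f u) ->
  s ^+ 2 * pd 0 (pd 0 f) u + 2 * s * t * pd 0 (pd 1 f) u + t ^+ 2 * pd 1 (pd 1 f) u <= 0.
Proof.
move=> Cf Uu mx.
have := local_max_derive2 oU (\row_i (if i == 0 then s else t)) Cf Uu mx.
by rewrite derive2_pd // !mxE.
Qed.

Lemma neg_def2 (a b c s t : R) : a < 0 -> 0 < a * c - b ^+ 2 -> (s != 0) || (t != 0) ->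
  s ^+ 2 * a + 2 * s * t * b + t ^+ 2 * c < 0.
Proof.
move=> a0 D st.
have E : a * (s ^+ 2 * a + 2 * s * t * b + t ^+ 2 * c) =
  (s * a + t * b) ^+ 2 + t ^+ 2 * (a * c - b ^+ 2) by ring.
suff : 0 < a * (s ^+ 2 * a + 2 * s * t * b + t ^+ 2 * c) by rewrite nmulr_rgt0.
rewrite E; have [t0|t0] := eqVneq t 0.
  move: st; rewrite t0 eqxx orbF => s0.
  by rewrite expr0n /= !mul0r !addr0 exprn_even_gt0 //= mulf_neq0 // lt_eqF.
by apply: ltr_wpDl; [exact: sqr_ge0|apply: mulr_gt0 => //; rewrite exprn_even_gt0].
Qed.

(** Definiteness of the Hessian persists on a ball around [u]; on each segment from [u], two mean
    values give the increment as a positive multiple of the Hessian in the direction of the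
    segment. *)
Lemma strict_local_max f u : smooth_on U f -> U u -> pd 0 f u = 0 -> pd 1 f u = 0 ->
  pd 0 (pd 0 f) u < 0 ->
  0 < pd 0 (pd 0 f) u * pd 1 (pd 1 f) u - pd 0 (pd 1 f) u ^+ 2 ->
  \forall y \near u, y != u -> f y < f u.
Proof.
move=> Cf Uu f0 f1 n0 d0.
have C00 := smooth_on_pd 0 (smooth_on_pd 0 Cf).
have C01 := smooth_on_pd 0 (smooth_on_pd 1 Cf).
have C11 := smooth_on_pd 1 (smooth_on_pd 1 Cf).
have Cd := smooth_onB oU (smooth_onM oU C00 C11) (smooth_onM oU C01 C01).
have N : \forall y \near u, [/\ U y, pd 0 (pd 0 f) y < 0 &
    0 < pd 0 (pd 0 f) y * pd 1 (pd 1 f) y - pd 0 (pd 1 f) y ^+ 2].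
  have Nd := near_gt0 Cd Uu d0.
  have n0' : 0 < (- pd 0 (pd 0 f)) u by rewrite -[X in _ < X]/(- (pd 0 (pd 0 f) u)) oppr_gt0.
  have Nn := near_gt0 (smooth_onN oU C00) Uu n0'.
  apply: filterS (filterI (openP_near oU Uu) (filterI Nn Nd)) => y [Uy [ny dy]].
  by split => //; rewrite -oppr_gt0.
have [d dpos H] := near_segment N.
apply/nbhs_ballP; exists d => // y /=; rewrite -ball_normE /= distrC => yu ne.
pose v := y - u; have -> : y = u + v by rewrite addrC subrK.
have Hs (r : R) : 0 <= r <= 1 -> [/\ U (u + r *: v), pd 0 (pd 0 f) (u + r *: v) < 0 &
    0 < pd 0 (pd 0 f) (u + r *: v) * pd 1 (pd 1 f) (u + r *: v) - pd 0 (pd 1 f) (u + r *: v) ^+ 2].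
  by move=> rI; apply: H; exact: scaler_norm_lt.
have [q qI E] := derive_segment_diff Cf (fun r rI => let: And3 a _ _ := Hs r rI in a).
have qI' : 0 <= q <= 1 by case/andP: qI => a b; rewrite !ltW.
have C1 := smooth_on_derive v Cf.
have Hq (r : R) : 0 <= r <= 1 -> U (u + r *: (q *: v)).
  move=> /andP[r0 r1]; rewrite scalerA; case/andP: qI' => q0 q1.
  by have [] := Hs (r * q); rewrite ?mulr_ge0 //= mulr_ile1.
have [t tI E2] := derive_segment_diff C1 Hq.
have tI' : 0 <= t <= 1 by case/andP: tI => a b; rewrite !ltW.
have dt := smooth_on_differentiable C1 (Hq t tI').
have tq : 0 <= t * q <= 1.
  by case/andP: qI' => q0 q1; case/andP: tI' => t0 t1; rewrite mulr_ge0 //= mulr_ile1.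
have [Utq n1 d1] := Hs _ tq.
rewrite -subr_lt0 E; move: E2; rewrite [X in _ - X]derive_pd; last exact: smooth_on_differentiable Cf Uu.
rewrite f0 f1 !mulr0 addr0 subr0 => ->.
rewrite (deriveZv _ _ dt) scalerA (derive2_pd _ Cf Utq).
case/andP: qI => q0 _; rewrite pmulr_rlt0 //; apply: neg_def2 n1 d1 _.
apply: contraR ne; rewrite negb_or !negbK => /andP[/eqP v0 /eqP v1].
by rewrite -subr_eq0 -/v [v]row2E v0 v1 !scale0r addr0.
Qed.

End Partial.

(** * Vectors and vector fields in space *)

Section Vector3.
Variable R : realType.
Implicit Types (u v w x y : 'rV[R]_3) (a b : R).

Lemma sum3E (F : 'I_3 -> R) : \sum_(i < 3) F i = F 0 + F 1 + F 2%:R.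
Proof.
rewrite !big_ord_recl big_ord0 addr0 addrA.
have -> : lift ord0 ord0 = 1 :> 'I_3 by exact/val_inj.
by have -> : lift ord0 (lift ord0 ord0) = 2%:R :> 'I_3 by exact/val_inj.
Qed.

Lemma dotE u v : dot u v = u 0 0 * v 0 0 + u 0 1 * v 0 1 + u 0 2%:R * v 0 2%:R.
Proof. exact: sum3E. Qed.

Lemma crossE u v : (cross u v 0 0 = u 0 1 * v 0 2%:R - u 0 2%:R * v 0 1) *
  (cross u v 0 1 = u 0 2%:R * v 0 0 - u 0 0 * v 0 2%:R) *
  (cross u v 0 2%:R = u 0 0 * v 0 1 - u 0 1 * v 0 0).
Proof.
rewrite /cross !mxE !add0r.
have -> : 1 + 1 = 2%:R :> 'I_3 by exact/val_inj.
have -> : 1 + 2%:R = 0 :> 'I_3 by exact/val_inj.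
have -> : 2%:R + 1 = 0 :> 'I_3 by exact/val_inj.
by have -> : 2%:R + 2%:R = 1 :> 'I_3 by exact/val_inj.
Qed.

Lemma row3P u v : u 0 0 = v 0 0 -> u 0 1 = v 0 1 -> u 0 2%:R = v 0 2%:R -> u = v.
Proof.
move=> e0 e1 e2; apply/rowP => -[[|[|[|//]]] Hi].
- by have -> : Ordinal Hi = 0 by exact/val_inj.
- by have -> : Ordinal Hi = 1 by exact/val_inj.
- by have -> : Ordinal Hi = 2%:R by exact/val_inj.
Qed.

Lemma dotC u v : dot u v = dot v u.
Proof. rewrite !dotE; ring. Qed.
Lemma dotDl u v w : dot (u + v) w = dot u w + dot v w.
Proof. rewrite !dotE !mxE; ring. Qed.
Lemma dotDr u v w : dot w (u + v) = dot w u + dot w v.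
Proof. rewrite !dotE !mxE; ring. Qed.
Lemma dotNl u w : dot (- u) w = - dot u w.
Proof. rewrite !dotE !mxE; ring. Qed.
Lemma dotNr u w : dot w (- u) = - dot w u.
Proof. rewrite !dotE !mxE; ring. Qed.
Lemma dotBl u v w : dot (u - v) w = dot u w - dot v w.
Proof. by rewrite dotDl dotNl. Qed.
Lemma dotBr u v w : dot w (u - v) = dot w u - dot w v.
Proof. by rewrite dotDr dotNr. Qed.
Lemma dotZl a u w : dot (a *: u) w = a * dot u w.
Proof. rewrite !dotE !mxE; ring. Qed.
Lemma dotZr a u w : dot w (a *: u) = a * dot w u.
Proof. rewrite !dotE !mxE; ring. Qed.
Lemma dot0l w : dot 0 w = 0.
Proof. by rewrite -(scale0r 0) dotZl mul0r. Qed.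
Lemma dot0r w : dot w 0 = 0.
Proof. by rewrite dotC dot0l. Qed.

Lemma dot_ge0 u : 0 <= dot u u.
Proof. by rewrite dotE -!expr2 !addr_ge0 ?sqr_ge0. Qed.

Lemma dot_eq0 u : (dot u u == 0) = (u == 0).
Proof.
apply/eqP/eqP => [|->]; last by rewrite dot0l.
rewrite dotE -!expr2 => /eqP.
rewrite paddr_eq0 ?addr_ge0 ?sqr_ge0 // paddr_eq0 ?sqr_ge0 //.
rewrite !sqrf_eq0 => /andP[/andP[/eqP a /eqP b] /eqP c].
by apply: row3P; rewrite ?mxE.
Qed.

Lemma dot_gt0 u : u != 0 -> 0 < dot u u.
Proof. by move=> u0; rewrite lt_def dot_ge0 dot_eq0 u0. Qed.

Lemma cross_orthol u v : dot u (cross u v) = 0.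
Proof. rewrite dotE !crossE; ring. Qed.
Lemma cross_orthor u v : dot v (cross u v) = 0.
Proof. rewrite dotE !crossE; ring. Qed.

Lemma dot_cross u v : dot (cross u v) (cross u v) = dot u u * dot v v - dot u v ^+ 2.
Proof. rewrite !dotE !crossE; ring. Qed.

(** Cramer's rule in the basis [u], [v], [cross u v], multiplied by the determinant so that no
    independence is assumed. *)
Lemma cross_decomp u v w :
  dot (cross u v) (cross u v) *: w =
  dot (cross w v) (cross u v) *: u + dot (cross u w) (cross u v) *: v
   + dot w (cross u v) *: cross u v.
Proof.
have [[] ] := crossE u v; have [[] ] := crossE w v; have [[] ] := crossE u w.
move: (cross u v) (cross w v) (cross u w) => n p q q0 q1 q2 p0 p1 p2 n0 n1 n2.
by apply: row3P; rewrite !mxE !dotE q0 q1 q2 p0 p1 p2 n0 n1 n2; ring.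
Qed.

Lemma cross_dot u v w x :
  dot (cross u v) (cross w x) = dot u w * dot v x - dot u x * dot v w.
Proof. by rewrite !dotE !crossE; ring. Qed.

Lemma orth_cross u v w : dot u w = 0 -> dot v w = 0 ->
  dot (cross u v) (cross u v) *: w = dot w (cross u v) *: cross u v.
Proof.
move=> uw vw; rewrite cross_decomp !cross_dot (dotC w u) (dotC w v) uw vw.
by rewrite !mul0r !mulr0 subrr !scale0r !add0r.
Qed.

Lemma cross_lin (a b c d : R) u v :
  cross (a *: u + b *: v) (c *: u + d *: v) = (a * d - b * c) *: cross u v.
Proof. by apply: row3P; rewrite [RHS]mxE !crossE !mxE; ring. Qed.

(** The basis of the plane spanned by [a] and [b] that is dual to [(a, b)]: pairing a vector of the
    plane with [dual1] and [dual2] yields its two coordinates. *)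
Definition dual1 (a b : 'rV[R]_3) := (dot (cross a b) (cross a b))^-1 *: cross b (cross a b).
Definition dual2 (a b : 'rV[R]_3) := (dot (cross a b) (cross a b))^-1 *: cross (cross a b) a.

Lemma tangent_decomp (a b w : 'rV[R]_3) : cross a b != 0 -> dot w (cross a b) = 0 ->
  w = dot w (dual1 a b) *: a + dot w (dual2 a b) *: b.
Proof.
move=> n0 wn; have NN0 : dot (cross a b) (cross a b) != 0 by rewrite dot_eq0.
have := cross_decomp a b w; rewrite wn scale0r addr0 => H.
apply: (scalerI NN0); rewrite H scalerDr !scalerA /dual1 /dual2 !dotZr !mulrA mulfV // !mul1r.
by congr (_ *: _ + _ *: _); rewrite !dotE !crossE; ring.
Qed.

Lemma dual_pairing (a b : 'rV[R]_3) : cross a b != 0 ->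
  [/\ dot a (dual1 a b) = 1, dot a (dual2 a b) = 0, dot b (dual1 a b) = 0 & dot b (dual2 a b) = 1].
Proof.
move=> n0; have NN0 : dot (cross a b) (cross a b) != 0 by rewrite dot_eq0.
rewrite /dual1 /dual2 !dotZr cross_orthol cross_orthor !mulr0.
have e1 : dot a (cross b (cross a b)) = dot (cross a b) (cross a b) by rewrite !dotE !crossE; ring.
have e2 : dot b (cross (cross a b) a) = dot (cross a b) (cross a b) by rewrite !dotE !crossE; ring.
by rewrite e1 e2 mulVf.
Qed.

End Vector3.

Section VectorFields.
Variables (R : realType) (U : set 'rV[R]_2).
Hypothesis oU : open U.
Implicit Types (f g : 'rV[R]_2 -> R) (i j : 'I_2) (u : 'rV[R]_2).
Implicit Types (F G : 'rV[R]_2 -> 'rV[R]_3).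

Definition coord (c : 'I_3) F : 'rV[R]_2 -> R := fun u => F u 0 c.
Definition smoothv F := forall c, smooth_on U (coord c F).
Definition pdv i F : 'rV[R]_2 -> 'rV[R]_3 := fun u => \row_c pd i (coord c F) u.
Definition dotf F G : 'rV[R]_2 -> R := fun u => dot (F u) (G u).
Definition scalef f F : 'rV[R]_2 -> 'rV[R]_3 := fun u => f u *: F u.

Lemma coord_pdv c i F : coord c (pdv i F) = pd i (coord c F).
Proof. by apply/funext => u; rewrite /coord mxE. Qed.

Lemma smoothv_pdv i F : smoothv F -> smoothv (pdv i F).
Proof. by move=> CF c; rewrite coord_pdv; exact: smooth_on_pd. Qed.

Lemma smooth_smoothv F : smooth_on U F -> smoothv F.
Proof. by move=> CF c; exact: smooth_on_coord. Qed.

Lemma partialE i F u : smooth_on U F -> U u -> partial i F u = pdv i F u.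
Proof.
move=> CF Uu; apply/rowP => c; rewrite mxE pd.unlock /partial.
exact: derive_coord.
Qed.

Lemma partial2E i j F u : smooth_on U F -> U u ->
  partial i (partial j F) u = pdv i (pdv j F) u.
Proof.
move=> CF Uu; rewrite partialE //; last exact: smooth_on_derive.
apply/rowP => c; rewrite !mxE; apply: (eq_in_pd oU _ _ Uu) => y Uy.
by rewrite /coord partialE.
Qed.

Lemma eq_in_pdv i F G u : (forall y, U y -> F y = G y) -> U u -> pdv i F u = pdv i G u.
Proof.
move=> FG Uu; apply/rowP => c; rewrite !mxE; apply: (eq_in_pd oU _ _ Uu) => y Uy.
by rewrite /coord FG.
Qed.

Lemma smoothv_cst (a : 'rV[R]_3) : smoothv (cst a).
Proof. by move=> c; exact: smooth_on_cst. Qed.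

Lemma pdv_cst i (a : 'rV[R]_3) u : pdv i (cst a) u = 0.
Proof. by apply/rowP => c; rewrite !mxE [coord _ _](_ : _ = cst (a 0 c)) // pd_cst. Qed.

Lemma coordD c F G : coord c (F + G) = coord c F + coord c G.
Proof. by apply/funext => u; rewrite /coord mxE. Qed.
Lemma coordN c F : coord c (- F) = - coord c F.
Proof. by apply/funext => u; rewrite /coord mxE. Qed.
Lemma coord_scalef c f F : coord c (scalef f F) = f * coord c F.
Proof. by apply/funext => u; rewrite /coord mxE. Qed.

Lemma smoothvD F G : smoothv F -> smoothv G -> smoothv (F + G).
Proof. by move=> CF CG c; rewrite coordD; exact: smooth_onD. Qed.
Lemma smoothvN F : smoothv F -> smoothv (- F).
Proof. by move=> CF c; rewrite coordN; exact: smooth_onN. Qed.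
Lemma smoothvB F G : smoothv F -> smoothv G -> smoothv (F - G).
Proof. by move=> CF CG; apply: smoothvD => //; exact: smoothvN. Qed.
Lemma smoothv_scale f F : smooth_on U f -> smoothv F -> smoothv (scalef f F).
Proof. by move=> Cf CF c; rewrite coord_scalef; exact: smooth_onM. Qed.

Lemma smooth_dotf F G : smoothv F -> smoothv G -> smooth_on U (dotf F G).
Proof.
move=> CF CG; rewrite (_ : dotf F G = coord 0 F * coord 0 G + coord 1 F * coord 1 G
   + coord 2%:R F * coord 2%:R G); last by apply/funext => u; rewrite /dotf dotE.
by apply: smooth_onD => //; [apply: smooth_onD => //|]; apply: smooth_onM.
Qed.

Lemma smoothv_cross F G : smoothv F -> smoothv G -> smoothv (fun u => cross (F u) (G u)).
Proof.
move=> CF CG c.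
rewrite (_ : coord c _ = coord (c + 1) F * coord (c + 2%:R) G - coord (c + 2%:R) F * coord (c + 1) G).
  by apply: smooth_onB => //; apply: smooth_onM.
by apply/funext => u; rewrite /coord /cross mxE.
Qed.

Lemma pdvD i F G u : smoothv F -> smoothv G -> U u ->
  pdv i (F + G) u = pdv i F u + pdv i G u.
Proof.
move=> CF CG Uu; apply/rowP => c; by rewrite !mxE coordD (pdD i (CF c) (CG c) Uu).
Qed.

Lemma pdvN i F u : smoothv F -> U u -> pdv i (- F) u = - pdv i F u.
Proof. by move=> CF Uu; apply/rowP => c; rewrite !mxE coordN (pdN _ (CF c) Uu). Qed.

Lemma pdvB i F G u : smoothv F -> smoothv G -> U u ->
  pdv i (F - G) u = pdv i F u - pdv i G u.
Proof. by move=> CF CG Uu; rewrite pdvD // ?pdvN //; exact: smoothvN. Qed.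

Lemma pdv_scale i f F u : smooth_on U f -> smoothv F -> U u ->
  pdv i (scalef f F) u = pd i f u *: F u + f u *: pdv i F u.
Proof.
by move=> Cf CF Uu; apply/rowP => c; rewrite !mxE coord_scalef (pdM i Cf (CF c) Uu).
Qed.

Lemma pd_dot i F G u : smoothv F -> smoothv G -> U u ->
  pd i (dotf F G) u = dot (pdv i F u) (G u) + dot (F u) (pdv i G u).
Proof.
move=> CF CG Uu; rewrite (_ : dotf F G = coord 0 F * coord 0 G + coord 1 F * coord 1 G
   + coord 2%:R F * coord 2%:R G); last by apply/funext => y; rewrite /dotf dotE.
have CM c : smooth_on U (coord c F * coord c G) by exact: smooth_onM.
rewrite (pdD i (smooth_onD oU (CM 0) (CM 1)) (CM 2%:R) Uu) (pdD i (CM 0) (CM 1) Uu).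
rewrite (pdM i (CF 0) (CG 0) Uu) (pdM i (CF 1) (CG 1) Uu) (pdM i (CF 2%:R) (CG 2%:R) Uu).
rewrite !dotE !mxE /coord; ring.
Qed.

Lemma pdvC i j F u : smoothv F -> U u -> pdv i (pdv j F) u = pdv j (pdv i F) u.
Proof.
move=> CF Uu; apply/rowP => c; rewrite !mxE !coord_pdv; exact: (pdC oU i j (CF c) Uu).
Qed.

End VectorFields.

(** * Charts and independence of the curvature from them *)

Section Charts.
Variable R : realType.
Implicit Types (S : set 'rV[R]_3) (U : set 'rV[R]_2) (X : 'rV[R]_2 -> 'rV[R]_3).

Lemma within_continuous_near (T W : topologicalType) (A : set T) (g : T -> W) x (B : set W) :
  {within A, continuous g} -> A x -> nbhs (g x) B -> \forall y \near x, A y -> B (g y).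
Proof.
move=> /subspace_continuousP cg Ax Bx; exact: (cg x Ax B Bx).
Qed.

Lemma local_param_open S U X : local_param S U X -> open U.
Proof. by case. Qed.
Lemma local_param_smooth S U X : local_param S U X -> smooth_on U X.
Proof. by case. Qed.
Lemma local_param_in S U X u : local_param S U X -> U u -> S (X u).
Proof.
move=> [_ _ _ _ [V [_ XV]]] Uu; have : (X @` U) (X u) by exact: imageP.
by rewrite XV => -[].
Qed.

(** A chart is an open map onto the surface, because its inverse is continuous and its image is
    relatively open. *)
Lemma local_param_near S U X u (B : set 'rV[R]_2) : local_param S U X -> U u -> nbhs u B ->
  \forall y \near X u, S y -> exists2 v, U v /\ B v & y = X v.
Proof.
move=> [oU _ _ [_ [g [cg gX]]] [V [oV XV]]] Uu Bu.
have Xu : (X @` U) (X u) by exists u.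
have gXu : g (X u) = u by exact: gX.
have Vu : V (X u) by move: Xu; rewrite XV => -[].
have Bg : nbhs (g (X u)) B by rewrite gXu.
have cgB := within_continuous_near cg Xu Bg.
apply: filterS (filterI cgB (open_nbhs_nbhs (conj oV Vu))) => y [yB Vy] Sy.
have [v Uv Xv] : (X @` U) y by rewrite XV.
exists v; last by rewrite Xv.
by split => //; rewrite -(gX v Uv) Xv; apply: yB; exists v.
Qed.

(** Local maxima of an ambient function on the surface can be compared between charts without any
    smoothness of the transition map. *)
Lemma local_max_transfer S U X U' X' u u' (q : 'rV[R]_3 -> R) :
  local_param S U X -> local_param S U' X' -> U u -> U' u' -> X u = X' u' ->
  (\forall y \near u, q (X y) <= q (X u)) -> \forall y \near u', q (X' y) <= q (X' u').
Proof.
move=> LX LX' Uu Uu' E mx.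
have H := local_param_near LX Uu mx.
have cX' := smooth_on_continuous (local_param_smooth LX') Uu'.
rewrite E in H.
have H' : \forall y \near u', S (X' y) -> exists2 v, U v /\ q (X v) <= q (X u) & X' y = X v.
  by rewrite E; exact: cX' _ H.
apply: filterS (filterI H' (openP_near (local_param_open LX') Uu')) => y [yH Uy].
by have [v [_ qv] ->] := yH (local_param_in LX' Uy); rewrite -E.
Qed.

Definition chart_normal X u := cross (pdv 0 X u) (pdv 1 X u).

(** When the Gram determinant of the partial derivatives [a] and [b] vanishes, so does
    [dot b b *: a - dot a b *: b]. Injectivity then forces [b = 0], which it excludes. *)
Lemma injective_normal U X u : open U -> smooth_on U X -> U u ->
  injective ('d X u : 'rV[R]_2 -> 'rV[R]_3) -> chart_normal X u != 0.
Proof.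
move=> oU sX Uu iX; apply/negP; rewrite -dot_eq0 dot_cross => /eqP D.
set a := pdv 0 X u in D; set b := pdv 1 X u in D.
have dX i : 'd X u (delta_mx 0 i) = pdv i X u.
  rewrite -(partialE i sX Uu) /partial deriveE //.
  exact: smooth_on_differentiable sX Uu.
have dXl s t : 'd X u (s *: delta_mx 0 0 + t *: delta_mx 0 1) = s *: a + t *: b.
  by rewrite linearD !linearZ /= !dX.
have k0 s t : s *: a + t *: b = 0 -> s = 0 /\ t = 0.
  rewrite -dXl -(linear0 ('d X u)) => /iX /rowP E.
  have := E 0; have := E 1; rewrite !mxE /= !mulr1 !mulr0 addr0 add0r => -> ->.
  by [].
have E : dot b b *: a + (- dot a b) *: b = 0.
  apply/eqP; rewrite -dot_eq0 !dotDl !dotDr !dotZl !dotZr [dot b a]dotC.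
  by apply/eqP; move: D; set p := dot a a; set q := dot b b; set r := dot a b;
    move=> D; transitivity (q * (p * q - r ^+ 2)); [ring|rewrite D mulr0].
have [/eqP b0 _] := k0 _ _ E; rewrite dot_eq0 in b0.
have : 0 *: a + 1 *: b = 0 by rewrite (eqP b0) scale0r scaler0 addr0.
by move=> /k0 [_ /eqP]; rewrite oner_eq0.
Qed.

Lemma chart_normal_neq0 S U X u : local_param S U X -> U u -> chart_normal X u != 0.
Proof. by move=> [oU sX iX _ _] Uu; exact: (injective_normal oU sX Uu (iX u Uu)). Qed.

Lemma det2E (A : 'M[R]_2) : \det A = A 0 0 * A 1 1 - A 0 1 * A 1 0.
Proof.
rewrite (expand_det_row _ 0) !big_ord_recl big_ord0 /cofactor !det_mx11 !mxE /=.
have l01 : lift ord0 ord0 = 1 :> 'I_2 by exact/val_inj.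
have l10 : lift 1 ord0 = 0 :> 'I_2 by exact/val_inj.
rewrite !l01 !l10 /bump /= addr0 add0n addn0 expr0 expr1 mul1r mulN1r mulrN.
by congr (_ - _).
Qed.

(** The second fundamental form with an arbitrary vector [m] in place of the unit normal: being
    linear in [m], it can be used with normals of any length. *)
Definition hess X (m : 'rV[R]_3) i j u := dot (pdv i (pdv j X) u) m.

Lemma param_curvatureE U X u : open U -> smooth_on U X -> U u -> chart_normal X u != 0 ->
  let N := chart_normal X u in
  param_curvature X u =
   (hess X N 0 0 u * hess X N 1 1 u - hess X N 0 1 u ^+ 2) / dot N N ^+ 2.
Proof.
move=> oU sX Uu N0 N.
have sv := smooth_smoothv oU sX.
rewrite /param_curvature !det2E !mxE /unit_normal !(partialE _ sX Uu) !(partial2E oU _ _ sX Uu).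
rewrite -/(chart_normal X u) -/N !dotZr.
rewrite [dot (pdv 1 X u) (pdv 0 X u)]dotC -expr2 -dot_cross -/(chart_normal X u) -/N.
rewrite -/(hess X N 0 0 u) -/(hess X N 0 1 u) -/(hess X N 1 1 u).
rewrite (_ : dot (pdv 1 (pdv 0 X) u) N = hess X N 0 1 u); last by rewrite /hess (pdvC oU 1 0 sv).
have NN := dot_gt0 N0; rewrite -/N in NN.
set s := Num.sqrt _; have s2 : s ^+ 2 = dot N N by rewrite sqr_sqrtr // ltW.
have s0 : s != 0 by rewrite sqrtr_eq0 -ltNge.
rewrite -s2; field; exact: s0.
Qed.

End Charts.

Section Transition.
Variable R : realType.
Implicit Types (S : set 'rV[R]_3) (U : set 'rV[R]_2) (X : 'rV[R]_2 -> 'rV[R]_3).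

Section Quadratic.
Variables (U : set 'rV[R]_2) (a b1 b2 : 'rV[R]_2 -> R) (c1 c2 c3 : R) (u : 'rV[R]_2).
Hypotheses (oU : open U) (sa : smooth_on U a) (sb1 : smooth_on U b1) (sb2 : smooth_on U b2).
Hypothesis Uu : U u.
Hypotheses (b1u : b1 u = 0) (b2u : b2 u = 0).

(** The diagonal coefficients are halved so that, where [b1] and [b2] vanish, the second derivatives
    have weights exactly [c1], [c2] and [c3]. *)
Definition quad := a - (cst (c1 / 2) * (b1 * b1) + cst c2 * (b1 * b2) + cst (c3 / 2) * (b2 * b2)).

Let cc (x : R) : smooth_on U (cst x : 'rV[R]_2 -> R) := @smooth_on_cst R _ U x.
Let sM := smooth_onM oU.
Let sD := smooth_onD oU.

Lemma smooth_quad : smooth_on U quad.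
Proof.
exact: (smooth_onB oU sa (sD (sD (sM (cc _) (sM sb1 sb1)) (sM (cc _) (sM sb1 sb2))) (sM (cc _) (sM sb2 sb2)))).
Qed.

Lemma pd_quad i y : U y -> pd i quad y =
  (pd i a - (cst c1 * (b1 * pd i b1) + cst c2 * (b1 * pd i b2 + b2 * pd i b1)
     + cst c3 * (b2 * pd i b2))) y.
Proof.
move=> Uy; have [s11 s12 s22] := And3 (sM sb1 sb1) (sM sb1 sb2) (sM sb2 sb2).
have t1 := sM (cc (c1 / 2)) s11; have t2 := sM (cc c2) s12; have t3 := sM (cc (c3 / 2)) s22.
rewrite /quad (pdB oU i sa (sD (sD t1 t2) t3) Uy) (pdD i (sD t1 t2) t3 Uy) (pdD i t1 t2 Uy).
rewrite (pdM i (cc _) s11 Uy) (pdM i (cc _) s12 Uy) (pdM i (cc _) s22 Uy) !pd_cst.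
rewrite (pdM i sb1 sb1 Uy) (pdM i sb1 sb2 Uy) (pdM i sb2 sb2 Uy).
rewrite -[RHS]/(pd i a y - (c1 * (b1 y * pd i b1 y) + c2 * (b1 y * pd i b2 y + b2 y * pd i b1 y)
     + c3 * (b2 y * pd i b2 y))) /cst; by field.
Qed.

Lemma pd_quad0 i : pd i quad u = pd i a u.
Proof.
rewrite pd_quad // -[LHS]/(pd i a u - (c1 * (b1 u * pd i b1 u) + c2 * (b1 u * pd i b2 u + b2 u * pd i b1 u)
     + c3 * (b2 u * pd i b2 u))) b1u b2u; ring.
Qed.

Lemma pd2_quad0 i j : pd i (pd j quad) u = pd i (pd j a) u -
  (c1 * (pd i b1 u * pd j b1 u) + c2 * (pd i b1 u * pd j b2 u + pd i b2 u * pd j b1 u)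
   + c3 * (pd i b2 u * pd j b2 u)).
Proof.
rewrite (eq_in_pd oU i (pd_quad j) Uu).
have [p1 p2 pa] := And3 (smooth_on_pd j sb1) (smooth_on_pd j sb2) (smooth_on_pd j sa).
have [s11 s12 s21] := And3 (sM sb1 p1) (sM sb1 p2) (sM sb2 p1); have s22 := sM sb2 p2.
have t1 := sM (cc c1) s11; have t2 := sM (cc c2) (sD s12 s21); have t3 := sM (cc c3) s22.
rewrite (pdB oU i pa (sD (sD t1 t2) t3) Uu) (pdD i (sD t1 t2) t3 Uu) (pdD i t1 t2 Uu).
rewrite (pdM i (cc _) s11 Uu) (pdM i (cc _) (sD s12 s21) Uu) (pdM i (cc _) s22 Uu) !pd_cst.
rewrite (pdD i s12 s21 Uu).
rewrite (pdM i sb1 p1 Uu) (pdM i sb1 p2 Uu) (pdM i sb2 p1 Uu) (pdM i sb2 p2 Uu).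
rewrite b1u b2u /cst; ring.
Qed.

End Quadratic.

Lemma pd_dot_cst U F (m : 'rV[R]_3) i u : open U -> smoothv U F -> U u ->
  pd i (dotf F (cst m)) u = dotf (pdv i F) (cst m) u.
Proof.
by move=> oU sF Uu; rewrite (pd_dot oU i sF (smoothv_cst U m) Uu) pdv_cst dot0r addr0.
Qed.

Lemma pd2_dot_cst U F (m : 'rV[R]_3) i j u : open U -> smoothv U F -> U u ->
  pd i (pd j (dotf F (cst m))) u = dot (pdv i (pdv j F) u) m.
Proof.
move=> oU sF Uu; rewrite (eq_in_pd oU i (fun y Uy => pd_dot_cst m j oU sF Uy) Uu).
exact: (pd_dot_cst m i oU (smoothv_pdv j sF) Uu).
Qed.

Lemma pdvBc U F (p : 'rV[R]_3) i u : open U -> smoothv U F -> U u ->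
  pdv i (F - cst p) u = pdv i F u.
Proof. by move=> oU sF Uu; rewrite (pdvB oU _ sF (smoothv_cst U p) Uu) pdv_cst subr0. Qed.

Definition quad_form (c1 c2 c3 : R) (m w1 w2 z : 'rV[R]_3) : R :=
  dot z m - (c1 / 2 * (dot z w1 * dot z w1) + c2 * (dot z w1 * dot z w2)
    + c3 / 2 * (dot z w2 * dot z w2)).

Section AtPoint.
Variables (U : set 'rV[R]_2) (X : 'rV[R]_2 -> 'rV[R]_3) (u : 'rV[R]_2).
Hypotheses (oU : open U) (sX : smoothv U X) (Uu : U u).
Variables (c1 c2 c3 : R) (m w1 w2 : 'rV[R]_3).

Let h y := quad_form c1 c2 c3 m w1 w2 (X y - X u).
Let F := X - cst (X u).
Let sF : smoothv U F := smoothvB oU sX (smoothv_cst U _).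
Let sd w : smooth_on U (dotf F (cst w)) := smooth_dotf oU sF (smoothv_cst U _).
Let hE : h = quad (dotf F (cst m)) (dotf F (cst w1)) (dotf F (cst w2)) c1 c2 c3.
Proof. by []. Qed.
Let F0 w : dotf F (cst w) u = 0.
Proof. by rewrite /dotf /F -[dot _ _]/(dot (X u - X u) w) subrr dot0l. Qed.

Lemma smooth_quad_form : smooth_on U h.
Proof. by rewrite hE; exact: smooth_quad. Qed.

Lemma pd_quad_form i : pd i h u = dot (pdv i X u) m.
Proof. by rewrite hE (pd_quad0 _ _ _ oU) // (pd_dot_cst m i oU sF Uu) /dotf (pdvBc _ _ oU sX Uu). Qed.

Lemma pd2_quad_form i j : pd i (pd j h) u = hess X m i j u -
  (c1 * (dot (pdv i X u) w1 * dot (pdv j X u) w1)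
   + c2 * (dot (pdv i X u) w1 * dot (pdv j X u) w2 + dot (pdv i X u) w2 * dot (pdv j X u) w1)
   + c3 * (dot (pdv i X u) w2 * dot (pdv j X u) w2)).
Proof.
rewrite hE (pd2_quad0 _ _ _ oU) // (pd2_dot_cst m i j oU sF Uu) !(pd_dot_cst _ _ oU sF Uu).
rewrite /dotf !(pdvBc _ _ oU sX Uu) /hess.
rewrite (eq_in_pdv oU i (fun y Uy => pdvBc (X u) j oU sX Uy) Uu).
by [].
Qed.

End AtPoint.

Section TwoCharts.
Variables (S : set 'rV[R]_3) (U U' : set 'rV[R]_2) (X X' : 'rV[R]_2 -> 'rV[R]_3) (u u' : 'rV[R]_2).
Hypotheses (LX : local_param S U X) (LX' : local_param S U' X').
Hypotheses (Uu : U u) (Uu' : U' u') (E : X u = X' u').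
Let oU := local_param_open LX.
Let oU' := local_param_open LX'.
Let sX := smooth_smoothv oU (local_param_smooth LX).
Let sX' := smooth_smoothv oU' (local_param_smooth LX').
Let X0 := pdv 0 X u.
Let X1 := pdv 1 X u.
Let N := chart_normal X u.
Let NN : 0 < dot N N := dot_gt0 (chart_normal_neq0 LX Uu).
Let w1 := dual1 X0 X1.
Let w2 := dual2 X0 X1.

(* [q e] is a quadratic function on the ambient space whose restriction to the
   surface has, in the chart [X], second derivatives [- e] times the identity;
   its local maximum is seen in the chart [X'] too, which compares second
   derivatives without differentiating the transition map. *)
Lemma two_charts (m : 'rV[R]_3) : dot X0 m = 0 -> dot X1 m = 0 ->
  (forall i, dot (pdv i X' u') m = 0) /\
  forall s t a b, a = dot (s *: pdv 0 X' u' + t *: pdv 1 X' u') w1 ->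
   b = dot (s *: pdv 0 X' u' + t *: pdv 1 X' u') w2 ->
   s ^+ 2 * hess X' m 0 0 u' + 2 * s * t * hess X' m 0 1 u' + t ^+ 2 * hess X' m 1 1 u' <=
   a ^+ 2 * hess X m 0 0 u + 2 * a * b * hess X m 0 1 u + b ^+ 2 * hess X m 1 1 u.
Proof.
move=> m0 m1; have [d01 d02 d11 d12] := dual_pairing (chart_normal_neq0 LX Uu).
pose q (e : R) (z : 'rV[R]_3) := quad_form (hess X m 0 0 u + e) (hess X m 0 1 u)
  (hess X m 1 1 u + e) m w1 w2 (z - X' u').
have main (e : R) : 0 < e -> \forall y \near u', q e (X' y) <= q e (X' u').
  move=> e0; apply: (local_max_transfer LX LX' Uu Uu' E).
  have H := strict_local_max oU (smooth_quad_form u oU sX (hess X m 0 0 u + e) (hess X m 0 1 u)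
     (hess X m 1 1 u + e) m w1 w2) Uu.
  have {}H : \forall y \near u, y != u -> q e (X y) < q e (X u).
    rewrite /q -E; apply: H; rewrite ?(pd_quad_form oU sX Uu) ?(pd2_quad_form oU sX Uu) -/X0 -/X1
      ?m0 ?m1 ?d01 ?d02 ?d11 ?d12 //.
      by rewrite !mulr0 !mulr1 !addr0; lra.
    set h00 := hess _ _ _ _ _; set h01 := hess _ _ _ _ _; set h11 := hess _ _ _ _ _.
    by rewrite (_ : _ - _ = e ^+ 2) ?exprn_gt0 //; ring.
  apply: filterS H => y Hy; have [->|/Hy/ltW] := eqVneq y u; first exact: lexx.
  by [].
have s3 := smooth_quad_form u' oU' sX'.
split=> [i|s t a b ea eb].
  have := local_max_pd oU' i (s3 _ _ _ m w1 w2) Uu' (main 1 ltr01).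
  by rewrite (pd_quad_form oU' sX' Uu').
apply/ler_addgt0Pr => e e0.
(* The perturbation leaves an error [d * (a ^+ 2 + b ^+ 2)], which must not exceed [e]; the [1]
   keeps the denominator positive. *)
pose d := e / (a ^+ 2 + b ^+ 2 + 1).
have ab0 : 0 < a ^+ 2 + b ^+ 2 + 1 by rewrite ltr_wpDl // addr_ge0 ?sqr_ge0.
have d0 : 0 < d by rewrite divr_gt0.
have := local_max_pd2 oU' s t (s3 _ _ _ m w1 w2) Uu' (main d d0).
rewrite !(pd2_quad_form oU' sX' Uu') => H.
have {}H : s ^+ 2 * hess X' m 0 0 u' + 2 * s * t * hess X' m 0 1 u' + t ^+ 2 * hess X' m 1 1 u' <=
   a ^+ 2 * hess X m 0 0 u + 2 * a * b * hess X m 0 1 u + b ^+ 2 * hess X m 1 1 u + d * (a ^+ 2 + b ^+ 2).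
  rewrite -subr_le0; apply: le_trans H; rewrite ea eb !dotDl !dotZl.
  by rewrite le_eqVlt; apply/orP; left; apply/eqP; ring.
apply: le_trans H _; rewrite lerD2l.
have -> : e = d * (a ^+ 2 + b ^+ 2 + 1) by rewrite /d divfK // gt_eqF.
by rewrite [leRHS]mulrDr mulr1 lerDl ltW.
Qed.

(** [two_charts] gives one inequality for [m] and the opposite one for [- m]. *)
Lemma hess_transition (m : 'rV[R]_3) : dot X0 m = 0 -> dot X1 m = 0 ->
  forall s t a b, a = dot (s *: pdv 0 X' u' + t *: pdv 1 X' u') w1 ->
   b = dot (s *: pdv 0 X' u' + t *: pdv 1 X' u') w2 ->
   s ^+ 2 * hess X' m 0 0 u' + 2 * s * t * hess X' m 0 1 u' + t ^+ 2 * hess X' m 1 1 u' =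
   a ^+ 2 * hess X m 0 0 u + 2 * a * b * hess X m 0 1 u + b ^+ 2 * hess X m 1 1 u.
Proof.
move=> m0 m1 s t a b ea eb; apply/eqP; rewrite eq_le; apply/andP; split.
  exact: (two_charts m0 m1).2 ea eb.
have n0 : dot X0 (- m) = 0 by rewrite dotNr m0 oppr0.
have n1 : dot X1 (- m) = 0 by rewrite dotNr m1 oppr0.
have := (two_charts n0 n1).2 _ _ _ _ ea eb.
by rewrite /hess !dotNr !mulrN -!opprD lerN2.
Qed.

Lemma chart_normal_transition (D : R) : D = dot (pdv 0 X' u') w1 * dot (pdv 1 X' u') w2
    - dot (pdv 0 X' u') w2 * dot (pdv 1 X' u') w1 ->
  chart_normal X' u' = D *: N.
Proof.
move=> ->; have NN0 : dot N N != 0 by rewrite gt_eqF.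
have dec i : pdv i X' u' = dot (pdv i X' u') w1 *: X0 + dot (pdv i X' u') w2 *: X1.
  have [tN _] := two_charts (cross_orthol _ _ : dot X0 N = 0) (cross_orthor _ _ : dot X1 N = 0).
  exact: (tangent_decomp (chart_normal_neq0 LX Uu) (tN i)).
by rewrite /chart_normal {1}[pdv 0 X' u']dec {1}[pdv 1 X' u']dec cross_lin.
Qed.

(** With [D] the determinant of the change of tangent basis, the normal gains a factor [D], and the
    second form gains this factor and a congruence of determinant [D]. Numerator and denominator of
    the curvature both gain [D ^+ 4]. *)
Lemma param_curvature_transition : param_curvature X' u' = param_curvature X u.
Proof.
have N0 := chart_normal_neq0 LX Uu; have N0' := chart_normal_neq0 LX' Uu'.
rewrite (param_curvatureE oU' (local_param_smooth LX') Uu' N0').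
rewrite (param_curvatureE oU (local_param_smooth LX) Uu N0) -/N.
set p0 := dot (pdv 0 X' u') w1; set q0 := dot (pdv 0 X' u') w2.
set p1 := dot (pdv 1 X' u') w1; set q1 := dot (pdv 1 X' u') w2.
pose D := p0 * q1 - q0 * p1.
have EN := chart_normal_transition (erefl D).
have D0 : D != 0 by apply: contraNneq N0' => D0; rewrite EN D0 scale0r.
have H := hess_transition (cross_orthol _ _ : dot X0 N = 0) (cross_orthor _ _ : dot X1 N = 0).
have NN0 : dot N N != 0 by rewrite gt_eqF.
have h s t := H s t _ _ erefl erefl.
have := h 1 0; have := h 0 1; have := h 1 1; clear h H.
rewrite !dotDl !dotZl -/p0 -/q0 -/p1 -/q1.
rewrite EN /hess !(dotZr D) dotZl -!/(hess _ _ _ _ _).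
move: (hess X' N 0 0 u') (hess X' N 0 1 u') (hess X' N 1 1 u') => a' b' c'.
move: (hess X N 0 0 u) (hess X N 0 1 u) (hess X N 1 1 u) => a b c.
have : p0 * q1 - q0 * p1 != 0 := D0.
clear EN D0; rewrite /D; clear D; move: p0 p1 q0 q1 => p0 p1 q0 q1 D0 h11 hc ha.
have {}ha : a' = p0 ^+ 2 * a + 2 * p0 * q0 * b + q0 ^+ 2 * c.
  by transitivity (1 ^+ 2 * a' + 2 * 1 * 0 * b' + 0 ^+ 2 * c'); [ring|rewrite ha; ring].
have {}hc : c' = p1 ^+ 2 * a + 2 * p1 * q1 * b + q1 ^+ 2 * c.
  by transitivity (0 ^+ 2 * a' + 2 * 0 * 1 * b' + 1 ^+ 2 * c'); [ring|rewrite hc; ring].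
(* Polarization: the off-diagonal entry is recovered from the values of the quadratic form at
   [(1, 1)], [(1, 0)] and [(0, 1)]. *)
have hb : b' = p0 * p1 * a + (p0 * q1 + p1 * q0) * b + q0 * q1 * c.
  have two0 : 2 != 0 :> R by rewrite pnatr_eq0.
  apply: (mulfI two0).
  transitivity ((1 ^+ 2 * a' + 2 * 1 * 1 * b' + 1 ^+ 2 * c') - a' - c'); first by ring.
  by rewrite h11 ha hc; ring.
rewrite hb ha hc; move: D0 NN0; set nn := dot N N => D0 NN0.
by field; rewrite NN0 D0.
Qed.

End TwoCharts.

Lemma gauss_curvatureE S U X u : local_param S U X -> U u ->
  gauss_curvature S (X u) = param_curvature X u.
Proof.
move=> LX Uu; rewrite /gauss_curvature; set A := [set k | _].
have : A (get A) by apply: getPex; exists (param_curvature X u), U, X, u.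
by move=> [U' [X' [u' [LX' Uu' E ->]]]]; exact: param_curvature_transition LX LX' Uu Uu' (esym E).
Qed.

Lemma tangent_space_orth S U X u U' X' u' (m : 'rV[R]_3) : local_param S U X -> local_param S U' X' ->
  U u -> U' u' -> X u = X' u' -> (forall i, dot (pdv i X u) m = 0) ->
  forall i, dot (pdv i X' u') m = 0.
Proof. by move=> LX LX' Uu Uu' E H; have [] := two_charts LX LX' Uu Uu' E (H 0) (H 1). Qed.

End Transition.

(** * First-order consequences of the isogauss condition *)

Section FlowCharts.
Variable R : realType.
Implicit Types (M : set 'rV[R]_3) (U : set 'rV[R]_2) (X : 'rV[R]_2 -> 'rV[R]_3).

(** Charts are carried along by the embedding; the new inverse is the old one composed with the
    inverse of [f]. *)
Lemma local_param_embedding M U X f : local_param M U X -> embedding M f ->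
  local_param (f @` M) U (f \o X).
Proof.
move=> LX [smf injf [_ [g [cg gf]]]].
have oU := local_param_open LX.
have [_ sX _ [_ [h [_ hX]]] _] := LX.
have MX u : U u -> M (X u) by exact: local_param_in LX.
have nearf u B : U u -> nbhs u B -> \forall y \near f (X u), (f @` M) y ->
    exists2 v, U v /\ B v & y = f (X v).
  move=> Uu Bu; have Mu := MX u Uu.
  have := local_param_near LX Uu Bu; rewrite -{1}(gf _ Mu) => H.
  have := within_continuous_near cg (imageP f Mu) H.
  apply: filterS => y H' /[dup] fMy [z Mz zy]; have gy : g y = z by rewrite -zy gf.
  have := H' fMy; rewrite /= gy => /(_ Mz) [v UBv zv].
  by exists v => //; rewrite -zy zv.
split => //.
- exact: smf LX.
- by move=> u Uu; exact: injf LX Uu.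
- split.
    apply/subspace_continuousP => u Uu; apply: cvg_within_filter.
    exact: smooth_on_continuous (smf _ _ LX) Uu.
  exists (h \o g); split; last by move=> u Uu /=; rewrite gf ?hX //; exact: MX.
  have hgE v : U v -> (h \o g) ((f \o X) v) = v by move=> Uv /=; rewrite gf ?hX //; exact: MX.
  apply/subspace_continuousP => _ [u Uu <-] B HB.
  have {HB}Bu : nbhs u B by rewrite -(hgE u Uu); exact: HB.
  apply: filterS (nearf u B Uu Bu) => y Hy [v Uv vy].
  have [|w [Uw Bw] yw] := Hy; first by exists (X v) => //; exact: MX.
  suff : B ((h \o g) ((f \o X) w)) by rewrite yw.
  by rewrite hgE.
(* The points that lie in the image of the chart as soon as they lie on the deformed surface. By
   [nearf], the interior of this set contains that image. *)
- pose A := [set y | (f @` M) y -> ((f \o X) @` U) y].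
  exists A°; split; first exact: open_interior.
  apply/seteqP; split=> [_ [u Uu <-]|y [fMy Ay]].
    split; first by exists (X u) => //; exact: MX.
    apply: filterS (nearf u setT Uu filterT) => y Hy /Hy [v [Uv _] ->].
    by exists v.
  exact: (interior_subset Ay).
Qed.

(* [pdv i Y u = lcoef i X Y u *: pdv 0 X u + rcoef i X Y u *: pdv 1 X u] as soon
   as [pdv i Y u] is tangential. *)
Definition lcoef i X (Y : 'rV[R]_2 -> 'rV[R]_3) u := dot (pdv i Y u) (dual1 (pdv 0 X u) (pdv 1 X u)).
Definition rcoef i X (Y : 'rV[R]_2 -> 'rV[R]_3) u := dot (pdv i Y u) (dual2 (pdv 0 X u) (pdv 1 X u)).

Section Coefficients.
Variables (U : set 'rV[R]_2) (X Y : 'rV[R]_2 -> 'rV[R]_3).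
Hypotheses (oU : open U) (sX : smoothv U X) (sY : smoothv U Y).
Hypothesis N0 : forall u, U u -> chart_normal X u != 0.
Hypothesis tY : forall i u, U u -> dot (pdv i Y u) (chart_normal X u) = 0.

Lemma smooth_chart_normal : smoothv U (chart_normal X).
Proof. by apply: smoothv_cross => //; exact: smoothv_pdv. Qed.

Lemma smooth_dual1 : smoothv U (fun u => dual1 (pdv 0 X u) (pdv 1 X u)).
Proof.
have sN := smooth_chart_normal.
apply: (smoothv_scale oU); last by apply: smoothv_cross => //; exact: smoothv_pdv.
apply: smooth_onV => //; last exact: smooth_dotf.
by move=> u Uu; rewrite dot_eq0; exact: N0.
Qed.

Lemma smooth_dual2 : smoothv U (fun u => dual2 (pdv 0 X u) (pdv 1 X u)).
Proof.
have sN := smooth_chart_normal.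
apply: (smoothv_scale oU); last by apply: smoothv_cross => //; exact: smoothv_pdv.
apply: smooth_onV => //; last exact: smooth_dotf.
by move=> u Uu; rewrite dot_eq0; exact: N0.
Qed.

Lemma smooth_lcoef i : smooth_on U (lcoef i X Y).
Proof. by apply: smooth_dotf => //; [exact: smoothv_pdv|exact: smooth_dual1]. Qed.

Lemma smooth_rcoef i : smooth_on U (rcoef i X Y).
Proof. by apply: smooth_dotf => //; [exact: smoothv_pdv|exact: smooth_dual2]. Qed.

Lemma pdv_coef i u : U u -> pdv i Y u = (scalef (lcoef i X Y) (pdv 0 X) + scalef (rcoef i X Y) (pdv 1 X)) u.
Proof. by move=> Uu; rewrite {1}(tangent_decomp (N0 Uu) (tY i Uu)). Qed.

Lemma pdv2_coef i j u : U u -> pdv i (pdv j Y) u =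
  pd i (lcoef j X Y) u *: pdv 0 X u + lcoef j X Y u *: pdv i (pdv 0 X) u +
  (pd i (rcoef j X Y) u *: pdv 1 X u + rcoef j X Y u *: pdv i (pdv 1 X) u).
Proof.
move=> Uu; rewrite (eq_in_pdv oU i (pdv_coef j) Uu).
have sl := smooth_lcoef j; have sr := smooth_rcoef j.
have s0 := smoothv_pdv 0 sX; have s1 := smoothv_pdv 1 sX.
rewrite (pdvD i (smoothv_scale oU sl s0) (smoothv_scale oU sr s1) Uu).
by rewrite (pdv_scale i sl s0 Uu) (pdv_scale i sr s1 Uu).
Qed.

(** The derivatives of the coefficients only multiply tangent vectors, which [m] annihilates. *)
Lemma hess_coefE (m : 'rV[R]_3) i j u : U u -> (forall k, dot (pdv k X u) m = 0) ->
  hess Y m i j u = lcoef j X Y u * hess X m i 0 u + rcoef j X Y u * hess X m i 1 u.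
Proof.
by move=> Uu Xm; rewrite /hess pdv2_coef // !dotDl !dotZl !Xm !mulr0 !add0r.
Qed.

End Coefficients.

Section Isogauss.
Variables (M : set 'rV[R]_3) (eta : 'rV[R]_3 -> 'rV[R]_3).
Hypotheses (smeta : smooth_along M eta) (iso : isogauss M eta).
Variables (U : set 'rV[R]_2) (X : 'rV[R]_2 -> 'rV[R]_3).
Hypothesis LX : local_param M U X.
Let Y := eta \o X.
Let oU := local_param_open LX.
Let sX := smooth_smoothv oU (local_param_smooth LX).
Let sY := smooth_smoothv oU (smeta LX).

Let pdv_flow i (t : R) u : U u -> pdv i (flow eta t \o X) u = pdv i X u + t *: pdv i Y u.
Proof.
move=> Uu; have st : smooth_on U (cst t : 'rV[R]_2 -> R) by exact: smooth_on_cst.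
rewrite (_ : flow eta t \o X = X + scalef (cst t) Y) //.
rewrite (pdvD i sX (smoothv_scale oU st sY) Uu) (pdv_scale i st sY Uu).
by rewrite pd_cst scale0r add0r.
Qed.

(** A single nonzero time suffices: by parallelism the derivative [pdv i X u + t *: pdv i Y u] of
    the flowed chart is tangent to [M], and so is [pdv i X u]. *)
Lemma pdv_deformation_tangent i u : U u -> dot (pdv i Y u) (chart_normal X u) = 0.
Proof.
move=> Uu; have [e [e0 emb tan _]] := iso.
have t0 : - e < e / 2 < e by apply/andP; split; lra.
have Mx := local_param_in LX Uu.
have LXt := local_param_embedding LX (emb _ t0).
have : tangent_space (flow eta (e / 2) @` M) (flow eta (e / 2) (X u))
    ('d (flow eta (e / 2) \o X) u (delta_mx 0 i)).
  by exists U, (flow eta (e / 2) \o X), u, (delta_mx 0 i).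
rewrite -tan // => -[U' [X' [u' [w [LX' Uu' E Ew]]]]].
have XN k : dot (pdv k X u) (chart_normal X u) = 0.
  have [->|->] : k = 0 \/ k = 1.
  - by case: k => -[|[|//]] Hk; [left|right]; exact/val_inj.
  - exact: cross_orthol.
  - exact: cross_orthor.
have X'N := tangent_space_orth LX LX' Uu Uu' (esym E) XN.
have dE : 'd (flow eta (e / 2) \o X) u (delta_mx 0 i) = pdv i (flow eta (e / 2) \o X) u.
  rewrite -(partialE i (local_param_smooth LXt) Uu) /partial deriveE //.
  exact: smooth_on_differentiable (local_param_smooth LXt) Uu.
have dX' : 'd X' u' w = w 0 0 *: pdv 0 X' u' + w 0 1 *: pdv 1 X' u'.
  have df' := smooth_on_differentiable (local_param_smooth LX') Uu'.
  rewrite -(partialE 0 (local_param_smooth LX') Uu') -(partialE 1 (local_param_smooth LX') Uu').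
  by rewrite -deriveE // {1}[w]row2E derive_lin.
have := congr1 (fun v => dot v (chart_normal X u)) (etrans (esym dE) (etrans Ew dX')).
rewrite dotDl !dotZl !X'N !mulr0 addr0.
rewrite pdv_flow // dotDl dotZl XN add0r => /eqP.
by rewrite mulf_eq0 mulf_eq0 invr_eq0 pnatr_eq0 orbF gt_eqF //= => /eqP.
Qed.

Let N0 u : U u -> chart_normal X u != 0 := fun Uu => chart_normal_neq0 LX Uu.

Lemma pdv_coef_flow (t a b : R) u i : pdv i Y u = a *: pdv 0 X u + b *: pdv 1 X u ->
  U u -> pdv i (flow eta t \o X) u =
    ((i == 0)%:R + t * a) *: pdv 0 X u + ((i == 1)%:R + t * b) *: pdv 1 X u.
Proof.
move=> Yi Uu; rewrite pdv_flow // Yi scalerDr !scalerDl !scalerA.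
have [->|->] : i = 0 \/ i = 1.
  - by case: i {Yi} => -[|[|//]] Hi; [left|right]; exact/val_inj.
- by rewrite /= scale1r scale0r add0r addrA.
- by rewrite /= scale1r scale0r add0r addrCA.
Qed.

(** Let [A] be the differential of the deformation. The flow multiplies the tangent basis by
    [1 + t A], hence the normal by [D], which is nonzero since the flowed chart is regular. The
    second form, taken with the old normal, is multiplied by [1 + t A] once, so its determinant
    gains one factor [D]; passing to the new normal makes this [D ^+ 3], over [D ^+ 4] from the
    first form. *)
Lemma param_curvature_flow t u (a b c d : R) : U u ->
  local_param (flow eta t @` M) U (flow eta t \o X) ->
  a = lcoef 0 X Y u -> b = rcoef 0 X Y u -> c = lcoef 1 X Y u -> d = rcoef 1 X Y u ->
  let D := (1 + t * a) * (1 + t * d) - t * b * (t * c) in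
  D != 0 /\ param_curvature (flow eta t \o X) u = param_curvature X u / D.
Proof.
move=> Uu LXt ea eb ec ed D.
have tY i v (Uv : U v) := pdv_deformation_tangent i Uv.
have sXt := local_param_smooth LXt; have sN := smooth_smoothv oU sXt.
have Y0 : pdv 0 Y u = a *: pdv 0 X u + b *: pdv 1 X u by rewrite ea eb (pdv_coef N0 tY).
have Y1 : pdv 1 Y u = c *: pdv 0 X u + d *: pdv 1 X u by rewrite ec ed (pdv_coef N0 tY).
set N := chart_normal X u.
have EN : chart_normal (flow eta t \o X) u = D *: N.
  rewrite /chart_normal (pdv_coef_flow t Y0 Uu) (pdv_coef_flow t Y1 Uu) /= cross_lin !add0r.
  by rewrite -[t * b * _]/(t * b * (t * c)).
have NN0 : dot N N != 0 by rewrite dot_eq0 N0.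
have D0 : D != 0.
  by have := chart_normal_neq0 LXt Uu; apply: contraNneq => D0; rewrite EN D0 scale0r.
split=> //.
have XN k : dot (pdv k X u) N = 0.
  have [->|->] : k = 0 \/ k = 1.
  - by case: k => -[|[|//]] Hk; [left|right]; exact/val_inj.
  - exact: cross_orthol.
  - exact: cross_orthor.
have hE i j : hess (flow eta t \o X) N i j u = hess X N i j u + t * hess Y N i j u.
  rewrite /hess (eq_in_pdv oU i (fun y Uy => pdv_flow j t Uy) Uu).
  have st : smooth_on U (cst t : 'rV[R]_2 -> R) by exact: smooth_on_cst.
  have s1 := smoothv_pdv j sX; have s2 := smoothv_pdv j sY.
  rewrite (_ : (fun y => _) = pdv j X + scalef (cst t) (pdv j Y)) //.
  rewrite (pdvD i s1 (smoothv_scale oU st s2) Uu) (pdv_scale i st s2 Uu).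
  by rewrite pd_cst scale0r add0r dotDl dotZl.
have h10 Z : smoothv U Z -> hess Z N 1 0 u = hess Z N 0 1 u.
  by move=> sZ; rewrite /hess (pdvC oU 1 0 sZ Uu).
have hY i j := hess_coefE oU sX sY N0 tY i j Uu XN.
have H00 := hY 0 0; have H01 := hY 0 1; have H11 := hY 1 1; have H10 := hY 1 0.
rewrite h10 // in H10; rewrite (h10 X) // in H11 H10.
rewrite (param_curvatureE oU sXt Uu (chart_normal_neq0 LXt Uu)) EN.
rewrite (param_curvatureE oU (local_param_smooth LX) Uu (N0 Uu)) -/N.
have hD i j : hess (flow eta t \o X) (D *: N) i j u = D * hess (flow eta t \o X) N i j u.
  by rewrite /hess dotZr.
rewrite !hD !hE H00 H11 dotZl dotZr -ea -eb -ec -ed.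
rewrite -ea -eb in H10; rewrite -ec -ed in H01; move: H10; rewrite H01.
have NN1 := NN0; move: D0; rewrite /D.
move: (hess X N 0 0 u) (hess X N 0 1 u) (hess X N 1 1 u) (dot N N) NN1.
move=> h00 h01 h11 nn nn0 D0 S.
(* [S] is the symmetry of the differential for the second form. It puts one off-diagonal entry in
   the form that makes the left side the determinant of a product of two matrices. *)
have key : (h00 + t * (a * h00 + b * h01)) * (h11 + t * (c * h01 + d * h11)) -
    (h01 + t * (c * h00 + d * h01)) ^+ 2 = D * (h00 * h11 - h01 ^+ 2).
  by rewrite expr2 {2}S /D; ring.
transitivity (D ^+ 2 * (D * (h00 * h11 - h01 ^+ 2)) / (D * (D * nn)) ^+ 2).
  by rewrite -key; congr (_ / _); rewrite /D; ring.
by rewrite /D; field; rewrite nn0 D0.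
Qed.

(** Away from time zero the difference quotient of the curvature has the closed form [G], which is
    continuous at [0] with value [- K * (a + d)]. *)
Lemma trace_deformation u : U u -> gauss_curvature M (X u) != 0 ->
  lcoef 0 X Y u + rcoef 1 X Y u = 0.
Proof.
move=> Uu K0; have [e [e0 emb _ lim0]] := iso.
set a := lcoef 0 X Y u; set b := rcoef 0 X Y u; set c := lcoef 1 X Y u; set d := rcoef 1 X Y u.
pose D t : R := (1 + t * a) * (1 + t * d) - t * b * (t * c).
set K := gauss_curvature M (X u) in K0.
have KD t : - e < t < e -> D t != 0 /\ gauss_curvature (flow eta t @` M) (flow eta t (X u)) = K / D t.
  move=> te; have LXt := local_param_embedding LX (emb t te).
  have [D0 E] := param_curvature_flow Uu LXt (erefl a) (erefl b) (erefl c) (erefl d).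
  split; first exact: D0.
  by rewrite (gauss_curvatureE LXt Uu) E /K (gauss_curvatureE LX Uu).
pose G t := - K * (a + d + t * (a * d - b * c)) / D t.
have limG : G t @[t --> 0^'] --> G 0.
  have cD : {for 0, continuous D}.
    apply: continuousB; apply: continuousM.
    - by apply: continuousD; [exact: cst_continuous|apply: continuousM; [exact: cvg_id|exact: cst_continuous]].
    - by apply: continuousD; [exact: cst_continuous|apply: continuousM; [exact: cvg_id|exact: cst_continuous]].
    - by apply: continuousM; [exact: cvg_id|exact: cst_continuous].
    - by apply: continuousM; [exact: cvg_id|exact: cst_continuous].
  have cG : {for 0, continuous G}.
    apply: continuousM; last by apply: continuousV => //; rewrite /D !mul0r !addr0 mulr1 subr0 oner_eq0.
    apply: continuousM; first exact: cst_continuous.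
    apply: continuousD; first exact: cst_continuous.
    by apply: continuousM; [exact: cvg_id|exact: cst_continuous].
  exact: cvg_within_filter cG.
have : G t @[t --> 0^'] --> (0 : R).
  apply: cvg_trans (lim0 (X u) (local_param_in LX Uu)); apply: near_eq_cvg.
  near=> t.
  have t0 : t != 0 by near: t; exact: nbhs_dnbhs_neq.
  have te : - e < t < e.
    by rewrite -ltr_norml; near: t; exact: dnbhs0_lt.
  have [D0 ->] := KD t te.
  rewrite /G -/K; move: D0; rewrite /D => D0; field.
  by rewrite t0 D0.
move=> /(cvg_unique (@Rhausdorff R) limG) /eqP.
rewrite /G /D !mul0r !addr0 mulr1 subr0 invr1 mulr1 mulNr oppr_eq0 mulf_eq0 (negPf K0) /=.
by move/eqP.
Unshelve. all: by end_near. Qed.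

End Isogauss.

End FlowCharts.

(** * Support planes of convex bodies *)

Section DotTopology.
Variable R : realType.
Implicit Types (u v w x y : 'rV[R]_3).

Lemma continuous_dot (T : topologicalType) (f g : T -> 'rV[R]_3) (x : T) :
  {for x, continuous f} -> {for x, continuous g} ->
  {for x, continuous (fun z => dot (f z) (g z))}.
Proof.
move=> cf cg.
have c i : {for x, continuous (fun z => f z 0 i * g z 0 i)}.
  apply: continuousM; last first.
    by apply: (@continuous_comp _ _ _ g (fun M => M 0 i)) => //; exact: coord_continuous.
  by apply: (@continuous_comp _ _ _ f (fun M => M 0 i)) => //; exact: coord_continuous.
rewrite (_ : (fun z => _) = (fun z => f z 0 0 * g z 0 0 + f z 0 1 * g z 0 1 + f z 0 2%:R * g z 0 2%:R)).
  by apply: continuousD; [apply: continuousD|]; exact: c.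
by apply/funext => z; rewrite dotE.
Qed.

(** The norm of a row vector is the maximum norm, which is dominated by the Euclidean one. *)
Lemma ltr_norm_dot v (d : R) : 0 < d -> dot v v < d ^+ 2 -> `|v| < d.
Proof.
move=> d0 vd; rewrite [X in X < _]mx_normrE; apply: bigmax_lt => // -[i j] _ /=.
have H : v i j ^+ 2 < d ^+ 2.
  apply: le_lt_trans vd; rewrite /dot (bigD1 j) //= ord1 -expr2 lerDl.
  by apply: sumr_ge0 => k _; rewrite -expr2 sqr_ge0.
by rewrite ltr_norml; apply/andP; split; nra.
Qed.

Lemma dot_sum_le u v : dot (u + v) (u + v) <= 2 * dot u u + 2 * dot v v.
Proof.
have : 0 <= dot (u - v) (u - v) by exact: dot_ge0.
rewrite !(dotDl, dotDr, dotNl, dotNr) (dotC v u); lra.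
Qed.

Lemma continuous_row (T : topologicalType) n (F : T -> 'rV[R]_n.+1) (z : T) :
  (forall i, {for z, continuous (fun t => F t 0 i)}) -> {for z, continuous F}.
Proof.
move=> cF; apply/cvgrPdist_lt => e e0.
near=> y; rewrite [X in X < _]mx_normrE; apply: bigmax_lt => // -[i j] _ /=.
rewrite !mxE ord1; move: j; near: y; apply: filter_forall => j.
by move/cvgrPdist_lt : (cF j) => /(_ e e0).
Unshelve. all: by end_near. Qed.

Lemma smoothv_continuous (U : set 'rV[R]_2) (F : 'rV[R]_2 -> 'rV[R]_3) z :
  smoothv U F -> U z -> {for z, continuous F}.
Proof.
by move=> sF Uz; apply: continuous_row => i; exact: smooth_on_continuous (sF i) Uz.
Qed.

End DotTopology.

Section ConvexBody.
Variables (R : realType) (C : set 'rV[R]_3).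
Hypotheses (convC : convex_set C) (compC : compact C).

Lemma convex_segment x y (t : R) : C x -> C y -> 0 <= t <= 1 -> C (x + t *: (y - x)).
Proof.
move=> Cx Cy /andP[t0 t1].
have := convC (x := y) (y := x) (Itv01 t0 t1); rewrite !inE => /(_ Cy Cx).
rewrite /conv /= (_ : t *: y + _ = x + t *: (y - x)) //.
by rewrite /unstable.onem scalerBr scalerBl scale1r addrCA.
Qed.

Lemma nearest_point y : C !=set0 -> ~ C y -> exists p, [/\ C p, p != y,
  forall c, C c -> dot (p - y) (p - y) <= dot (c - y) (c - y) &
  forall c, C c -> dot (c - p) (y - p) <= 0].
Proof.
move=> C0 nCy; have cf : {within C, continuous (fun c => dot (c - y) (c - y))}.
  apply: continuous_subspaceT => c.
  have cs : {for c, continuous (fun c : 'rV[R]_3 => c - y)}.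
    by apply: continuousB; [exact: cvg_id|exact: cst_continuous].
  exact: (continuous_dot cs cs).
have [p] := compact_EVT_min C0 compC cf; rewrite inE => Cp mp.
have {}mp c : C c -> dot (p - y) (p - y) <= dot (c - y) (c - y).
  by move=> Cc; apply: mp; rewrite inE.
exists p; split=> //; first by apply: contra_notN nCy => /eqP <-.
move=> c Cc; rewrite leNgt; apply/negP => pos.
set a := dot (c - p) (y - p) in pos; pose q := dot (c - p) (c - p).
have q0 : 0 <= q by exact: dot_ge0.
(* Moving from [p] towards [c] by [t] changes the squared distance to [y] by
   [- 2 * t * a + t ^+ 2 * q]. Here [t * q] is at most [a], so the distance would drop. *)
pose t := Num.min 1 (a / (q + 1)).
have t0 : 0 < t by rewrite lt_min ltr01 divr_gt0 // ltr_wpDl.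
have t1 : t <= 1 by rewrite ge_min lexx.
have tq : t * (q + 1) <= a by rewrite -ler_pdivlMr ?ltr_wpDl // ge_min lexx orbT.
have t01 : 0 <= t <= 1 by rewrite t1 (ltW t0).
have := mp _ (convex_segment Cp Cc t01).
have -> : dot (p + t *: (c - p) - y) (p + t *: (c - p) - y) =
  dot (p - y) (p - y) - 2 * t * a + t ^+ 2 * q.
  by rewrite /a /q !dotE !mxE; ring.
rewrite -addrA lerDl => H.
have : 0 <= t * (t * q - 2 * a) by apply: le_trans H _; lra.
by rewrite pmulr_rge0 //; nra.
Qed.

(* Project points outside [C] converging to [x] onto [C]; compactness of the unit
   sphere replaces the extraction of a limit of the projection directions. *)
Lemma supporting_normal x : C !=set0 -> C x -> ~ C° x ->
  exists n, dot n n = 1 /\ forall c, C c -> dot (c - x) n <= 0.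
Proof.
move=> C0 Cx nx; apply: contrapT => H.
pose B : set 'rV[R]_3 := [set n | dot n n = 1].
have compB : compact B.
  apply: bounded_closed_compact.
    exists 2; split; first exact: num_real.
    move=> r r2 n Bn; apply: ltW; apply: ltr_norm_dot; first by lra.
    by rewrite Bn; nra.
  rewrite (_ : B = (fun n => dot n n) @^-1` [set 1]); last by apply/seteqP; split.
  apply: closed_comp; last exact: closed_eq.
  by move=> n _; exact: (@continuous_dot _ _ id id n cvg_id cvg_id).
have : \forall x' \near x, B `<=` (fun n => exists2 c, C c & 0 < dot (c - x') n).
  have nc := (compact_near_coveringP B).1 compB.
  apply: (nc _ (nbhs x) (fun x' n => exists2 c, C c & 0 < dot (c - x') n)).
  move=> n Bn.
  have [c Cc cn] : exists2 c, C c & 0 < dot (c - x) n.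
    apply: contrapT => K; apply: H; exists n; split=> // c Cc.
    by rewrite leNgt; apply/negP => cn; apply: K; exists c.
  have cd : {for (n, x), continuous (fun z : 'rV[R]_3 * 'rV[R]_3 => dot (c - z.2) z.1)}.
    have c1 : {for (n, x), continuous (fun z : 'rV[R]_3 * 'rV[R]_3 => c - z.2)}.
      by apply: continuousB; [exact: cst_continuous|exact: cvg_snd].
    have c2 : {for (n, x), continuous (fun z : 'rV[R]_3 * 'rV[R]_3 => z.1)} by exact: cvg_fst.
    exact: (continuous_dot c1 c2).
  have : \forall z \near (n, x), 0 < dot (c - z.2) z.1.
    exact: (cvgr_gt _ cd _ cn).
  by apply: filterS => -[n' x'] /= ?; exists c.
move=> /nbhs_ballP [d d0 Hd].
(* The projection [p] of [y] is no farther from [y] than [x] is, so its squared distance to [x] is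
   at most [4 * dot (y - x) (y - x)]; this accounts for [d / 2]. *)
have [y yx nCy] : exists2 y : 'rV[R]_3, dot (y - x) (y - x) < (d / 2) ^+ 2 & ~ C y.
  apply: contrapT => K; apply: nx.
  have cd : {for x, continuous (fun y : 'rV[R]_3 => dot (y - x) (y - x))}.
    have cs : {for x, continuous (fun y : 'rV[R]_3 => y - x)}.
      by apply: continuousB; [exact: cvg_id|exact: cst_continuous].
    exact: (continuous_dot cs cs).
  have : \forall y \near x, dot (y - x : 'rV[R]_3) (y - x) < (d / 2) ^+ 2.
    apply: (cvgr_lt _ cd); rewrite subrr dot0l exprn_gt0 // divr_gt0 //.
  apply: filterS => y Hy; apply: contrapT => nCy; apply: K; by exists y.
have [p [Cp py mp sp]] := nearest_point C0 nCy.
pose m := y - p.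
have m0 : 0 < dot m m by apply: dot_gt0; rewrite subr_eq0 eq_sym.
have Bp : B ((Num.sqrt (dot m m))^-1 *: m).
  rewrite /B /= dotZl dotZr mulrA -invfM -expr2 sqr_sqrtr ?ltW // mulVf //.
  by rewrite gt_eqF.
have px : ball x d p.
  rewrite -ball_normE /= -normrN opprB; apply: ltr_norm_dot => //.
  have := dot_sum_le (p - y) (y - x); rewrite subrKA => /le_lt_trans; apply.
  have := mp x Cx; rewrite -[x - y]opprB dotNl dotNr opprK => h1.
  by move: yx; rewrite expr_div_n; lra.
have [c Cc] := Hd p px _ Bp.
rewrite dotZr pmulr_rgt0 ?invr_gt0 ?sqrtr_gt0 //.
by rewrite ltNge sp.
Qed.

End ConvexBody.

(** * Algebra at a critical point *)

(** Up to the factor [a], the positive definite form is the square of [(a, b)] plus its determinant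
    times the square of [(0, 1)], so the contraction is a positive combination of two values of the
    other form. *)
Lemma psd_contraction (R : realType) (a b c p q r : R) : 0 < a -> 0 < a * c - b ^+ 2 ->
  (forall s t, s ^+ 2 * p + 2 * s * t * q + t ^+ 2 * r <= 0) -> a * p + 2 * b * q + c * r <= 0.
Proof.
move=> a0 d H; rewrite -(pmulr_rle0 _ a0).
have -> : a * (a * p + 2 * b * q + c * r) =
   (a ^+ 2 * p + 2 * a * b * q + b ^+ 2 * r) + (a * c - b ^+ 2) * (0 ^+ 2 * p + 2 * 0 * 1 * q + 1 ^+ 2 * r).
  by ring.
by rewrite -[0]addr0 lerD // pmulr_rle0.
Qed.

Section CriticalAlgebra.
Variable R : realType.

(** These three are the coefficients of [al], [be] and [ga] in the contracted Hessian of [f] after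
    all derivatives of the matrix have been eliminated. *)
Definition coef_al (z0 z1 z00 z01 z11 a b c b0 c1 b1 A2 B2 : R) : R :=
  z0 * (2 * b1 - 2 * c * B2) + z1 * (4 * b * B2 + 2 * a * A2 - 2 * b0)
   + c * z00 - 2 * b * z01 - a * z11.
Definition coef_be (z0 z1 z01 z11 a b c c0 c1 A3 B3 : R) : R :=
  z0 * (c1 - c * B3) + z1 * (2 * b * B3 + a * A3 - c0) + c * z01 - 2 * b * z11.
Definition coef_ga (z0 z1 z01 a b c a0 a1 A1 B1 : R) : R :=
  z0 * (c * B1 - a1) + z1 * (a0 - 2 * b * B1 - a * A1) + a * z01.

(* [(al, be; ga, - al)] is the matrix of the differential of the deformation in a
   chart, [(a, b, c)] its second fundamental form, the [A]s and [B]s are the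
   Christoffel symbols, and a final digit stands for a partial derivative.  Where
   the gradient of [f = <eta, e>] is [mu] times the one of [z = <x, e>], the
   algebraic constraints determine the matrix up to the factor [mu], so that the
   operator applied to [f] is [mu] times a quantity attached to the surface. *)
Lemma elliptic_combination (z0 z1 z00 z01 z11 a b c a0 b0 c0 a1 b1 c1 A1 A2 A3 B1 B2 B3
   al be ga al0 be0 ga0 al1 be1 ga1 f00 f01 f11 mu : R) :
  f00 = al0 * z0 + al * z00 + be0 * z1 + be * z01 ->
  f01 = al1 * z0 + al * z01 + be1 * z1 + be * z11 ->
  f11 = ga1 * z0 + ga * z01 - al1 * z1 - al * z11 ->
  2 * al * b + be * c - ga * a = 0 ->
  2 * (al0 * b + al * b0) + (be0 * c + be * c0) - (ga0 * a + ga * a0) = 0 ->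
  2 * (al1 * b + al * b1) + (be1 * c + be * c1) - (ga1 * a + ga * a1) = 0 ->
  al1 - ga0 = ga * A1 - 2 * al * A2 - be * A3 ->
  be1 + al0 = ga * B1 - 2 * al * B2 - be * B3 ->
  al * z0 + be * z1 = mu * z0 ->
  ga * z0 - al * z1 = mu * z1 ->
  (c * f00 - 2 * b * f01 + a * f11) * (c * z0 ^+ 2 - 2 * b * z0 * z1 + a * z1 ^+ 2) =
  mu * ((z0 ^+ 2 * c - z1 ^+ 2 * a) * coef_al z0 z1 z00 z01 z11 a b c b0 c1 b1 A2 B2
    + 2 * z0 * (a * z1 - b * z0) * coef_be z0 z1 z01 z11 a b c c0 c1 A3 B3
    + 2 * z1 * (c * z0 - b * z1) * coef_ga z0 z1 z01 a b c a0 a1 A1 B1).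
Proof.
move=> e00 e01 e11 s s0 s1 k1 k2 m0 m1.
(* The compatibility equations eliminate [ga0] and [be1], the differentiated symmetry eliminates
   [c * be0] and [a * ga1]; then [al0] and [al1] cancel. *)
have W : c * f00 - 2 * b * f01 + a * f11 =
   al * coef_al z0 z1 z00 z01 z11 a b c b0 c1 b1 A2 B2 + be * coef_be z0 z1 z01 z11 a b c c0 c1 A3 B3
   + ga * coef_ga z0 z1 z01 a b c a0 a1 A1 B1.
  have g0 : ga0 = al1 - (ga * A1 - 2 * al * A2 - be * A3) by rewrite -k1; ring.
  have e1 : be1 = (ga * B1 - 2 * al * B2 - be * B3) - al0 by rewrite -k2; ring.
  have h1 : c * be0 = - (2 * (al0 * b + al * b0) + be * c0 - (ga0 * a + ga * a0)).
    by apply/eqP; rewrite -subr_eq0; apply/eqP; rewrite -s0; ring.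
  have h2 : a * ga1 = 2 * (al1 * b + al * b1) + (be1 * c + be * c1) - ga * a1.
    by apply/eqP; rewrite eq_sym -subr_eq0; apply/eqP; rewrite -s1; ring.
  rewrite e00 e01 e11.
  transitivity (z0 * (c * al0 - 2 * b * al1 + a * ga1) + z1 * (c * be0 - 2 * b * be1 - a * al1)
     + c * (al * z00 + be * z01) - 2 * b * (al * z01 + be * z11) + a * (ga * z01 - al * z11)).
    by ring.
  by rewrite h1 h2 g0 e1 /coef_al /coef_be /coef_ga; ring.
set D := c * z0 ^+ 2 - 2 * b * z0 * z1 + a * z1 ^+ 2.
(* Symmetry and the two gradient equations are three linear equations for [al], [be], [ga] whose
   determinant is [D] up to sign; this step and the next two are Cramer's rule. *)
have alD : al * D = mu * (z0 ^+ 2 * c - z1 ^+ 2 * a).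
  transitivity (z0 * c * (al * z0 + be * z1) - z1 * a * (ga * z0 - al * z1)
     - z0 * z1 * (2 * al * b + be * c - ga * a)); first by rewrite /D; ring.
  by rewrite s m0 m1; ring.
have beD : be * D = mu * (2 * z0 * (a * z1 - b * z0)).
  transitivity (z0 ^+ 2 * (2 * al * b + be * c - ga * a) + a * z0 * (ga * z0 - al * z1)
     + (a * z1 - 2 * b * z0) * (al * z0 + be * z1)); first by rewrite /D; ring.
  by rewrite s m0 m1; ring.
have gaD : ga * D = mu * (2 * z1 * (c * z0 - b * z1)).
  transitivity (- z1 ^+ 2 * (2 * al * b + be * c - ga * a) + c * z1 * (al * z0 + be * z1)
     + (c * z0 - 2 * b * z1) * (ga * z0 - al * z1)); first by rewrite /D; ring.
  by rewrite s m0 m1; ring.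
rewrite W; move: alD beD gaD; clearbody D => alD beD gaD.
rewrite !mulrDl ![_ * _ * D]mulrAC alD beD gaD; ring.
Qed.

End CriticalAlgebra.

Section CriticalContinuity.
Variables (R : realType) (T : topologicalType) (x : T).
Variables (z0 z1 z00 z01 z11 a b c a0 b0 c0 a1 b1 c1 A1 A2 A3 B1 B2 B3 : T -> R).

(** The value of the quadratic form [(a, b, c)] on [(z1, - z0)], the tangent vector of the level
    line of [z]. *)
Definition char_form (z0 z1 a b c : R) := c * (z0 * z0) - 2 * b * z0 * z1 + a * (z1 * z1).

Definition kappa (z0 z1 z00 z01 z11 a b c a0 b0 c0 a1 b1 c1 A1 A2 A3 B1 B2 B3 : R) : R :=
  (z0 * z0 * c - z1 * z1 * a) * coef_al z0 z1 z00 z01 z11 a b c b0 c1 b1 A2 B2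
    + 2 * z0 * (a * z1 - b * z0) * coef_be z0 z1 z01 z11 a b c c0 c1 A3 B3
    + 2 * z1 * (c * z0 - b * z1) * coef_ga z0 z1 z01 a b c a0 a1 A1 B1.

(* Large for large [k] wherever [z] is not critical; its positivity forbids a
   maximum of [f + eps * expR (k * z)]. *)
Definition barrier_gap (k z0 z1 z00 z01 z11 a b c a0 b0 c0 a1 b1 c1 A1 A2 A3 B1 B2 B3 : R) : R :=
  k * (char_form z0 z1 a b c * char_form z0 z1 a b c)
   + (c * z00 - 2 * b * z01 + a * z11) * char_form z0 z1 a b c
   - kappa z0 z1 z00 z01 z11 a b c a0 b0 c0 a1 b1 c1 A1 A2 A3 B1 B2 B3.

Let C (f : T -> R) : Prop := {for x, continuous f}.

Let contD f g : C f -> C g -> C (fun u => f u + g u).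
Proof. exact: continuousD. Qed.
Let contM f g : C f -> C g -> C (fun u => f u * g u).
Proof. exact: continuousM. Qed.
Let contN f : C f -> C (fun u => - f u).
Proof. exact: continuousN. Qed.
Let cont_cst r : C (fun _ => r).
Proof. exact: cst_continuous. Qed.

Ltac cont := lazymatch goal with
  | |- C (fun _ => ?r) => exact (@cont_cst r)
  | |- C (fun u => (@?f u + @?g u)%R) => apply (@contD f g); cont
  | |- C (fun u => (@?f u * @?g u)%R) => apply (@contM f g); cont
  | |- C (fun u => (- @?f u)%R) => apply (@contN f); cont
  | H : C ?f |- C ?f => exact H
  | |- C (fun u => ?f u) => match goal with H : C f |- _ => exact H end
  end.

Let continuous_char_form : C z0 -> C z1 -> C a -> C b -> C c ->
  C (fun u => char_form (z0 u) (z1 u) (a u) (b u) (c u)).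
Proof. by move=> *; rewrite /char_form; cont. Qed.

Let continuous_coef_al : C z0 -> C z1 -> C z00 -> C z01 -> C z11 -> C a -> C b -> C c ->
  C b0 -> C c1 -> C b1 -> C A2 -> C B2 ->
  C (fun u => coef_al (z0 u) (z1 u) (z00 u) (z01 u) (z11 u) (a u) (b u) (c u) (b0 u) (c1 u) (b1 u) (A2 u) (B2 u)).
Proof. by move=> *; rewrite /coef_al; cont. Qed.

Let continuous_coef_be : C z0 -> C z1 -> C z01 -> C z11 -> C a -> C b -> C c ->
  C c0 -> C c1 -> C A3 -> C B3 ->
  C (fun u => coef_be (z0 u) (z1 u) (z01 u) (z11 u) (a u) (b u) (c u) (c0 u) (c1 u) (A3 u) (B3 u)).
Proof. by move=> *; rewrite /coef_be; cont. Qed.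

Let continuous_coef_ga : C z0 -> C z1 -> C z01 -> C a -> C b -> C c -> C a0 -> C a1 -> C A1 -> C B1 ->
  C (fun u => coef_ga (z0 u) (z1 u) (z01 u) (a u) (b u) (c u) (a0 u) (a1 u) (A1 u) (B1 u)).
Proof. by move=> *; rewrite /coef_ga; cont. Qed.

Lemma continuous_barrier_gap (k : R) :
  C z0 -> C z1 -> C z00 -> C z01 -> C z11 -> C a -> C b -> C c -> C a0 -> C b0 -> C c0 ->
  C a1 -> C b1 -> C c1 -> C A1 -> C A2 -> C A3 -> C B1 -> C B2 -> C B3 ->
  C (fun u => barrier_gap k (z0 u) (z1 u) (z00 u) (z01 u) (z11 u) (a u) (b u) (c u) (a0 u) (b0 u)
    (c0 u) (a1 u) (b1 u) (c1 u) (A1 u) (A2 u) (A3 u) (B1 u) (B2 u) (B3 u)).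
Proof.
move=> Hz0 Hz1 Hz00 Hz01 Hz11 Ha Hb Hc Ha0 Hb0 Hc0 Ha1 Hb1 Hc1 HA1 HA2 HA3 HB1 HB2 HB3.
have H1 := continuous_char_form Hz0 Hz1 Ha Hb Hc.
have H2 := continuous_coef_al Hz0 Hz1 Hz00 Hz01 Hz11 Ha Hb Hc Hb0 Hc1 Hb1 HA2 HB2.
have H3 := continuous_coef_be Hz0 Hz1 Hz01 Hz11 Ha Hb Hc Hc0 Hc1 HA3 HB3.
have H4 := continuous_coef_ga Hz0 Hz1 Hz01 Ha Hb Hc Ha0 Ha1 HA1 HB1.
by rewrite /barrier_gap /kappa; cont.
Qed.

End CriticalContinuity.

Section Axial.
Variable R : realType.
Implicit Types (e n : 'rV[R]_3).

Definition enorm (n : 'rV[R]_3) := Num.sqrt (dot n n).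
(** For a unit vector [e], the distance from [n] to the line spanned by [e]. *)
Definition axial_distance (e n : 'rV[R]_3) := Num.sqrt (dot n n - dot n e ^+ 2).

Lemma axial_ge0 e n : dot e e = 1 -> 0 <= dot n n - dot n e ^+ 2.
Proof.
move=> e1; have : 0 <= dot (n - dot n e *: e) (n - dot n e *: e) by exact: dot_ge0.
by rewrite !(dotBl, dotBr, dotZl, dotZr) e1 (dotC e n); lra.
Qed.

(* Equality holds for [r = Num.sqrt a]: a smooth majorant of the square root,
   touching it at a prescribed point. *)
Lemma mean_sqrt (a r : R) : 0 <= a -> 0 < r -> Num.sqrt a <= (a + r ^+ 2) / (2 * r).
Proof.
move=> a0 r0; rewrite ler_pdivlMr ?mulr_gt0 //.
have : 0 <= (Num.sqrt a - r) ^+ 2 by exact: sqr_ge0.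
by rewrite sqrrB sqr_sqrtr //; lra.
Qed.

Lemma enorm_ge n e : dot e e = 1 -> dot n e <= enorm n.
Proof.
move=> e1; have := axial_ge0 n e1; rewrite subr_ge0 => h.
by rewrite /enorm (le_trans (ler_norm _)) // -sqrtr_sqr ler_wsqrtr.
Qed.

End Axial.

Lemma large_multiple_posdef (R : realType) (g0 g1 g2 q0 q1 q2 : R) :
  0 < q0 -> 0 < q0 * q2 - q1 ^+ 2 ->
  exists2 k, 0 < k & 0 < g0 + k * q0 /\
    0 < (g0 + k * q0) * (g2 + k * q2) - (g1 + k * q1) ^+ 2.
Proof.
move=> q00 D0; set D := q0 * q2 - q1 ^+ 2 in D0.
pose B := g0 * q2 + g2 * q0 - 2 * g1 * q1; pose E := g0 * g2 - g1 ^+ 2.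
(* The determinant is [k ^+ 2 * D + k * B + E]; the two fractions make [k] large enough to absorb
   [g0] and the lower-order terms [B] and [E]. *)
pose k := 1 + `|g0| / q0 + (`|B| + `|E|) / D.
have h1 : 0 <= `|g0| / q0 by rewrite divr_ge0 // ltW.
have h2 : 0 <= (`|B| + `|E|) / D by apply: divr_ge0; [exact: addr_ge0|exact: ltW].
have k1 : 1 <= k by rewrite /k; lra.
have kq : `|g0| + q0 <= k * q0.
  have -> : `|g0| + q0 = (1 + `|g0| / q0) * q0 by field; rewrite gt_eqF.
  by apply: ler_wpM2r; [exact: ltW|rewrite /k lerDl].
have kD : `|B| + `|E| + D <= k * D.
  have -> : `|B| + `|E| + D = (1 + (`|B| + `|E|) / D) * D by field; rewrite gt_eqF.
  by apply: ler_wpM2r; [exact: ltW|rewrite /k addrAC lerDl].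
exists k; first by lra.
split; first by have := ler_norm (- g0); rewrite normrN; lra.
have -> : (g0 + k * q0) * (g2 + k * q2) - (g1 + k * q1) ^+ 2 = k * (k * D) + k * B + E.
  by rewrite /D /B /E; ring.
have b1 := ler_norm (- B); have b2 := ler_norm (- E); rewrite !normrN in b1 b2.
have k0 : 0 <= k by lra.
clear h1 h2 kq; clearbody k; clearbody B E D.
have : k * (`|B| + `|E| + D) <= k * (k * D) by rewrite ler_wpM2l.
have : k * - B <= k * `|B| by rewrite ler_wpM2l.
have : 1 * (`|E| + D) <= k * (`|E| + D) by rewrite ler_wpM2r // addr_ge0 // ltW.
move: (`|B|) (`|E|) b1 b2 kD => nB nE b1 b2 kD h1 h2 h3; nra.
Qed.

(** * Rigidity *)

Section ConvexSurface.
Variables (R : realType) (M C : set 'rV[R]_3) (b0 : 'rV[R]_3).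
Hypotheses (surfM : smooth_surface M) (convC : convex_set C) (compC : compact C).
Hypotheses (b0C : C° b0) (MC : M = closure C `\` C°).
Hypothesis K_pos : forall x, M x -> 0 < gauss_curvature M x.
Implicit Types (x y c n e p q : 'rV[R]_3) (U : set 'rV[R]_2) (X : 'rV[R]_2 -> 'rV[R]_3).
Implicit Types (u v : 'rV[R]_2).

Let clC : closed C.
Proof. by apply: compact_closed compC; exact: norm_hausdorff. Qed.
Let C0 : C !=set0.
Proof. by exists b0; exact: interior_subset. Qed.

Lemma boundary_in x : M x -> C x /\ ~ C° x.
Proof. by rewrite MC => -[]; rewrite -(closure_id C).1. Qed.

Lemma compact_boundary : compact M.
Proof.
rewrite MC -(closure_id C).1 // setDE; apply: compact_closedI => //.
by apply: open_closedC; exact: open_interior.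
Qed.

Lemma interior_dot x y n : n != 0 -> (forall c, C c -> dot (c - x) n <= 0) -> C° y ->
  dot (y - x) n < 0.
Proof.
move=> n0 sn Cy; have [d d0 H] := near_segment Cy.
have [s s0 sd] := small_scale n d0.
have Hs := sn _ (H _ sd).
have {}Hs : dot (y - x) n + s * dot n n <= 0 by rewrite -dotZl -dotDl addrAC.
by have := mulr_gt0 s0 (dot_gt0 n0); lra.
Qed.

(* The normal has height 1 over [b0] instead of unit length: this fixes its
   orientation, and makes it a smooth function of the chart without square
   roots, with [dot (x - b0) (pdv i nu)] identically 0. *)
Definition outer_normal x n := dot (x - b0) n = 1 /\ forall c, C c -> dot (c - x) n <= 0.

Lemma outer_normal_exists x : M x -> exists n, outer_normal x n.
Proof.
move=> /boundary_in [Cx nx]; have [n [nn sn]] := supporting_normal convC compC C0 Cx nx.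
have n0 : n != 0 by rewrite -dot_eq0 nn oner_eq0.
have h : 0 < dot (x - b0) n by rewrite -opprB dotNl oppr_gt0; exact: interior_dot.
exists ((dot (x - b0) n)^-1 *: n); split; first by rewrite dotZr mulVf // gt_eqF.
by move=> c Cc; rewrite dotZr pmulr_rle0 ?invr_gt0 // sn.
Qed.

(** On [M] an outer normal exists and is unique, so the default [0] is not taken there. *)
Definition nu x := xget 0 [set n | outer_normal x n].

Lemma nuP x : M x -> outer_normal x (nu x).
Proof. by move=> /outer_normal_exists [n Hn]; exact: (xgetPex 0 (ex_intro _ n Hn)). Qed.

Lemma nu_height x : M x -> dot (x - b0) (nu x) = 1.
Proof. by case/nuP. Qed.

Lemma nu_support x c : M x -> C c -> dot (c - x) (nu x) <= 0.
Proof. by move=> /nuP [_]; apply. Qed.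

Lemma nu_neq0 x : M x -> nu x != 0.
Proof.
by move=> /nu_height h; apply/eqP => n0; move: h; rewrite n0 dot0r => /eqP; rewrite eq_sym oner_eq0.
Qed.

Lemma dot_pdv_max U X u n : local_param M U X -> U u ->
  (forall c, C c -> dot (c - X u) n <= 0) -> forall i, dot (pdv i X u) n = 0.
Proof.
move=> LX Uu sn i; have oU := local_param_open LX.
have sX := smooth_smoothv oU (local_param_smooth LX).
have sZ := smoothvB oU sX (smoothv_cst U (X u)).
have := local_max_pd oU i (smooth_dotf oU sZ (smoothv_cst U n)) Uu.
rewrite (pd_dot_cst n i oU sZ Uu) /dotf (pdvBc _ i oU sX Uu); apply.
apply: filterS (openP_near oU Uu) => y Uy.
rewrite -[leRHS]/(dot (X u - X u) n) subrr dot0l.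
by apply: sn; have [] := boundary_in (local_param_in LX Uy).
Qed.

(** An outer normal is orthogonal to the tangent plane, and its height over [b0] fixes the factor.
    The formula yields both uniqueness and smoothness of [nu] in charts. *)
Lemma outer_normal_chart U X u n : local_param M U X -> U u -> outer_normal (X u) n ->
  dot (X u - b0) (chart_normal X u) != 0 /\
  n = (dot (X u - b0) (chart_normal X u))^-1 *: chart_normal X u.
Proof.
move=> LX Uu [hn sn]; have Xn := dot_pdv_max LX Uu sn.
have := orth_cross (Xn 0) (Xn 1); rewrite -/(chart_normal X u).
have := chart_normal_neq0 LX Uu; set N := chart_normal X u; rewrite -dot_eq0 => N0 E.
have En : n = (dot n N / dot N N) *: N.
  by apply: (scalerI N0); rewrite E scalerA mulrC divfK.
move: hn; rewrite {1}En dotZr => h.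
have b0n : dot (X u - b0) N != 0.
  by apply/eqP => z; move: h; rewrite z mulr0 => /eqP; rewrite eq_sym oner_eq0.
by split=> //; rewrite {1}En; congr (_ *: _); apply: (mulIf b0n); rewrite h mulVf.
Qed.

Lemma outer_normal_unique x n : M x -> outer_normal x n -> n = nu x.
Proof.
move=> Mx Hn; have [U [X [LX [u Uu Xu]]]] := surfM Mx.
rewrite -Xu in Hn *; rewrite -Xu in Mx.
by have [_ ->] := outer_normal_chart LX Uu Hn; have [_ <-] := outer_normal_chart LX Uu (nuP Mx).
Qed.

Lemma within_continuous_charts (W : topologicalType) (phi : 'rV[R]_3 -> W) :
  (forall U X u, local_param M U X -> U u -> {for u, continuous (phi \o X)}) ->
  {within M, continuous phi}.
Proof.
move=> H; apply/subspace_continuousP => x Mx.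
have [U [X [LX [u Uu Xu]]]] := surfM Mx; subst x.
move=> B HB; have := local_param_near LX Uu (H U X u LX Uu B HB).
by apply: filterS => y Hy /Hy [v [_ Bv] ->].
Qed.

(** A farthest point of [C] in the direction [e] lies on the boundary, and [e] supports [C]
    there. *)
Lemma exists_normal_direction e : e != 0 -> exists2 x, M x & exists2 l, 0 < l & nu x = l *: e.
Proof.
move=> e0; have cf : {within C, continuous (fun c => dot c e)}.
  apply: continuous_subspaceT => c.
  have c1 : {for c, continuous (fun c : 'rV[R]_3 => c)} by exact: cvg_id.
  have c2 : {for c, continuous (fun c : 'rV[R]_3 => e)} by exact: cst_continuous.
  exact: (continuous_dot c1 c2).
have [p] := compact_EVT_max C0 compC cf; rewrite inE => Cp mp.
have sp c : C c -> dot (c - p) e <= 0.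
  by move=> Cc; rewrite dotBl subr_le0; apply: mp; rewrite inE.
have np : ~ C° p.
  by move=> ip; have := interior_dot e0 sp ip; rewrite subrr dot0l ltxx.
have Mp : M p by rewrite MC; split => //; exact: subset_closure.
have h : 0 < dot (p - b0) e by rewrite -opprB dotNl oppr_gt0; exact: interior_dot.
exists p => //; exists (dot (p - b0) e)^-1; first by rewrite invr_gt0.
apply/esym/outer_normal_unique => //; split; first by rewrite dotZr mulVf // gt_eqF.
by move=> c Cc; rewrite dotZr pmulr_rle0 ?invr_gt0 // sp.
Qed.

Section Chart.
Variables (U : set 'rV[R]_2) (X : 'rV[R]_2 -> 'rV[R]_3).
Hypothesis LX : local_param M U X.
Let oU := local_param_open LX.
Let sX := smooth_smoothv oU (local_param_smooth LX).
Let MX u (Uu : U u) : M (X u) := local_param_in LX Uu.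
Definition nuX := nu \o X.

Lemma nuXE u : U u -> nuX u = (dot (X u - b0) (chart_normal X u))^-1 *: chart_normal X u.
Proof. by move=> Uu; have [_] := outer_normal_chart LX Uu (nuP (MX Uu)). Qed.

Lemma smooth_nuX : smoothv U nuX.
Proof.
have sN := smooth_chart_normal oU sX; have sB := smoothvB oU sX (smoothv_cst U b0).
have sd := smooth_dotf oU sB sN.
have d0 u : U u -> dotf (X - cst b0) (chart_normal X) u != 0.
  by move=> Uu; have [] := outer_normal_chart LX Uu (nuP (MX Uu)).
have ss := smoothv_scale oU (smooth_onV oU d0 sd) sN.
move=> c; apply: (smooth_on_eq oU _ (ss c)) => y Uy.
by rewrite -[RHS]/((nuX y) 0 c) nuXE.
Qed.

Lemma nuX_tangent i u : U u -> dotf (pdv i X) nuX u = 0.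
Proof. by move=> Uu; apply: (dot_pdv_max LX Uu); have [_] := nuP (MX Uu). Qed.

Lemma nuX_height u : U u -> dotf (X - cst b0) nuX u = 1.
Proof. by move=> Uu; exact: nu_height (MX Uu). Qed.

Lemma nuX_pdv_height i u : U u -> dot (X u - b0) (pdv i nuX u) = 0.
Proof.
move=> Uu; have sB := smoothvB oU sX (smoothv_cst U b0).
have := eq_in_pd oU i (nuX_height : forall v : 'rV[R]_2, U v -> dotf (X - cst b0) nuX v = cst 1 v) Uu.
rewrite pd_cst (pd_dot oU i sB smooth_nuX Uu) (pdvBc b0 i oU sX Uu).
by rewrite -[dot (pdv i X u) _]/(dotf (pdv i X) nuX u) nuX_tangent // add0r.
Qed.

Lemma nuX_weingarten i j u : U u -> dot (pdv i X u) (pdv j nuX u) = - hess X (nuX u) i j u.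
Proof.
move=> Uu; have si := smoothv_pdv i sX.
have := eq_in_pd oU j (nuX_tangent i : forall v : 'rV[R]_2, U v -> dotf (pdv i X) nuX v = cst 0 v) Uu.
rewrite pd_cst (pd_dot oU j si smooth_nuX Uu) addrC /hess (pdvC oU i j sX Uu) => /eqP.
by rewrite addr_eq0 => /eqP.
Qed.

(** The supporting plane makes the form negative semidefinite, and positive curvature makes its
    determinant positive. *)
Lemma hess_negdef u : U u -> hess X (nuX u) 0 0 u < 0 /\
  0 < hess X (nuX u) 0 0 u * hess X (nuX u) 1 1 u - hess X (nuX u) 0 1 u ^+ 2.
Proof.
move=> Uu; set n := nuX u.
have sZ := smoothvB oU sX (smoothv_cst U (X u)).
have mx : \forall v \near u, dotf (X - cst (X u)) (cst n) v <= dotf (X - cst (X u)) (cst n) u.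
  apply: filterS (openP_near oU Uu) => y Uy.
  rewrite -[leRHS]/(dot (X u - X u) n) subrr dot0l.
  by apply: nu_support; [exact: MX|have [] := boundary_in (MX Uy)].
have h i j : pd i (pd j (dotf (X - cst (X u)) (cst n))) u = hess X n i j u.
  rewrite (pd2_dot_cst n i j oU sZ Uu) /hess.
  by rewrite (eq_in_pdv oU i (fun (v : 'rV[R]_2) (Uv : U v) => pdvBc (X u) j oU sX Uv) Uu).
have sd (s t : R) := local_max_pd2 oU s t (smooth_dotf oU sZ (smoothv_cst U n)) Uu mx.
have := K_pos (MX Uu); rewrite (gauss_curvatureE LX Uu).
have N0 := chart_normal_neq0 LX Uu.
rewrite (param_curvatureE oU (local_param_smooth LX) Uu N0).
set N := chart_normal X u; rewrite pmulr_lgt0 ?invr_gt0 ?exprn_gt0 ?dot_gt0 //.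
have hn i j : hess X n i j u = (dot (X u - b0) N)^-1 * hess X N i j u.
  by rewrite /hess /n nuXE // dotZr.
have D : 0 < (dot (X u - b0) N)^-1 ^+ 2.
  by rewrite exprn_even_gt0 //= invr_eq0; have [] := outer_normal_chart LX Uu (nuP (MX Uu)).
move=> /(mulr_gt0 D); rewrite mulrBr -exprMn -hn.
rewrite (_ : _ ^+ 2 * _ = hess X n 0 0 u * hess X n 1 1 u); last by rewrite !hn; ring.
move: {sd} (sd 1 0) (sd 0 1) => s0 s1; move: s0 s1; rewrite !h.
move: (hess X n 0 0 u) (hess X n 0 1 u) (hess X n 1 1 u) => a b c h1 h2 h3.
split=> //.
have {}h1 : a <= 0 by apply: le_trans h1; rewrite le_eqVlt; apply/orP; left; apply/eqP; ring.
have {}h2 : c <= 0 by apply: le_trans h2; rewrite le_eqVlt; apply/orP; left; apply/eqP; ring.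
rewrite lt_neqAle h1 andbT; apply/eqP => a0; move: h3; rewrite a0 mul0r sub0r oppr_gt0.
by rewrite ltNge sqr_ge0.
Qed.

End Chart.

(** If [y] lies in the supporting plane at [x], so does the segment between them, which then
    consists of boundary points. Near [x] this contradicts the strict maximum given by the definite
    second fundamental form. *)
Lemma support_strict x y : M x -> M y -> dot (y - x) (nu x) = 0 -> y = x.
Proof.
move=> Mx My xy0; have [U [X [LX [u Uu Xu]]]] := surfM Mx.
have oU := local_param_open LX; have sX := smooth_smoothv oU (local_param_smooth LX).
have Mu : M (X u) by rewrite Xu.
have [h00 hD] := hess_negdef LX Uu.
have sZ := smoothvB oU sX (smoothv_cst U (X u)).
set n := nuX X u in h00 hD.
have h i j : pd i (pd j (dotf (X - cst (X u)) (cst n))) u = hess X n i j u.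
  rewrite (pd2_dot_cst n i j oU sZ Uu) /hess.
  by rewrite (eq_in_pdv oU i (fun v Uv => pdvBc (X u) j oU sX Uv) Uu).
have h1 i : pd i (dotf (X - cst (X u)) (cst n)) u = 0.
  rewrite (pd_dot_cst n i oU sZ Uu) /dotf (pdvBc _ i oU sX Uu).
  exact: (nuX_tangent LX).
have := strict_local_max oU (smooth_dotf oU sZ (smoothv_cst U n)) Uu (h1 0) (h1 1).
rewrite !h => /(_ h00 hD) mx.
have [d d0 Hd] := near_segment (local_param_near LX Uu mx).
have [s s0 sd] := small_scale (y - x) d0.
pose r := Num.min s 1.
have r0 : 0 < r by rewrite lt_min s0 ltr01.
have r01 : 0 <= r <= 1 by rewrite (ltW r0) ge_min lexx orbT.
have rd : `|r *: (y - x)| < d.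
  apply: le_lt_trans sd; rewrite !normrZ ler_wpM2r // !gtr0_norm //.
  by rewrite ge_min lexx.
have [Cx _] := boundary_in Mx; have [Cy _] := boundary_in My.
have Cz := convex_segment convC Cx Cy r01.
have z0 : dot (x + r *: (y - x) - x) (nu x) = 0.
  by rewrite addrAC subrr add0r dotZl xy0 mulr0.
have Mz : M (x + r *: (y - x)).
  rewrite MC; split; first exact: subset_closure.
  move=> iz; have n0 := nu_neq0 Mx.
  have := interior_dot n0 (fun c Cc => nu_support Mx Cc) iz.
  by rewrite z0 ltxx.
have Mz' : M (X u + r *: (y - x)) by rewrite Xu.
have [v [Uv Hv] zv] := Hd _ rd Mz'.
have [vu|vu] := eqVneq v u.
  move: zv; rewrite vu -[RHS]addr0 => /addrI /eqP.
  by rewrite scaler_eq0 gt_eqF //= subr_eq0 => /eqP.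
have nE : n = nu x by rewrite /n /nuX /= Xu.
have dv : dotf (X - cst (X u)) (cst n) v = 0.
  by rewrite -[LHS]/(dot (X v - X u) n) -zv Xu nE.
have du : dotf (X - cst (X u)) (cst n) u = 0.
  by rewrite -[LHS]/(dot (X u - X u) n) subrr dot0l.
by have := Hv vu; rewrite dv du ltxx.
Qed.

(** With parallel normals, the support inequalities at [x] and at [y] are opposite, so [y] lies in
    the supporting plane at [x]. *)
Lemma nu_parallel_inj x y (l : R) : M x -> M y -> 0 < l -> nu x = l *: nu y -> x = y.
Proof.
move=> Mx My l0 E; apply: support_strict => //.
have [Cx _] := boundary_in Mx; have [Cy _] := boundary_in My.
have := nu_support Mx Cy; rewrite E dotZr pmulr_rle0 // => h1.
have := nu_support My Cx => h2.
by apply/eqP; rewrite eq_le h2 -[0]oppr0 lerNl -dotNl opprB h1.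
Qed.

(* What an isogauss deformation retains to first order: its differential is
   tangential and trace-free. *)
Definition deformation eta := forall U X, local_param M U X ->
  [/\ smoothv U (eta \o X),
      forall i u, U u -> dot (pdv i (eta \o X) u) (chart_normal X u) = 0 &
      forall u, U u -> lcoef 0 X (eta \o X) u + rcoef 1 X (eta \o X) u = 0].

Lemma deformationN eta : deformation eta -> deformation (fun x => - eta x).
Proof.
move=> H U X LX; have [sY tY trY] := H U X LX.
have oU := local_param_open LX.
have E i u : U u -> pdv i ((fun x => - eta x) \o X) u = - pdv i (eta \o X) u.
  exact: (pdvN i sY).
split=> [|i u Uu|u Uu].
- exact: (smoothvN oU sY).
- by rewrite E // dotNl tY // oppr0.
- by rewrite /lcoef /rcoef !E // !dotNl -opprD -/(lcoef _ _ _ _) -/(rcoef _ _ _ _) trY // oppr0.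
Qed.

(** * Minima of the pairing of the deformation with the normal *)

Section Touch.
Variables (eta : 'rV[R]_3 -> 'rV[R]_3) (p : 'rV[R]_3).
Hypothesis deta : deformation eta.

Section Chart.
Variables (U : set 'rV[R]_2) (X : 'rV[R]_2 -> 'rV[R]_3) (u : 'rV[R]_2).
Hypotheses (LX : local_param M U X) (Uu : U u).
Let oU := local_param_open LX.
Let sX := smooth_smoothv oU (local_param_smooth LX).
Let n := nuX X.
Let sn : smoothv U n := smooth_nuX LX.
Let N0 v (Uv : U v) := chart_normal_neq0 LX Uv.

(* The second fundamental form being nondegenerate, the normal and its partial
   derivatives span the space. *)
Lemma nuX_basis w : dot w (n u) = 0 -> (forall i, dot w (pdv i n u) = 0) -> w = 0.
Proof.
move=> wn wni; have wN : dot w (chart_normal X u) = 0.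
  move: wn; rewrite /n (nuXE LX Uu) dotZr => /eqP.
  have [h _] := outer_normal_chart LX Uu (nuP (local_param_in LX Uu)).
  by rewrite mulf_eq0 invr_eq0 (negPf h) => /eqP.
have E := tangent_decomp (N0 Uu) wN; move: E.
set s := dot w _; set t := dot w _ => E.
have W i j := nuX_weingarten LX i j Uu.
have [h00 hD] := hess_negdef LX Uu.
have := wni 0; have := wni 1; rewrite E !dotDl !dotZl !W.
rewrite (_ : hess X _ 1 0 u = hess X (n u) 0 1 u); last by rewrite /hess (pdvC oU 1 0 sX Uu).
move: h00 hD; rewrite -/n; move: (hess X (n u) 0 0 u) (hess X (n u) 0 1 u) (hess X (n u) 1 1 u).
move=> a b c a0 D e1 e0.
have t0 : t * (a * c - b ^+ 2) = 0.
  by transitivity (b * (s * - a + t * - b) - a * (s * - b + t * - c)); [ring|rewrite e0 e1 !mulr0 subrr].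
have s0 : s * (a * c - b ^+ 2) = 0.
  by transitivity (b * (s * - b + t * - c) - c * (s * - a + t * - b)); [ring|rewrite e0 e1 !mulr0 subrr].
move/eqP: s0; move/eqP: t0; rewrite !mulf_eq0 (gt_eqF D) !orbF => /eqP -> /eqP ->.
by rewrite !scale0r addr0.
Qed.

(* At a minimum of [<eta - p, nu>], the derivatives of [eta] drop out of the
   gradient because they are tangential, and out of the Hessian contracted with
   the inverse second fundamental form because they are trace-free. *)
Lemma touch_chart (m : R) :
  (forall y, M y -> m <= dot (eta y - p) (nu y)) -> dot (eta (X u) - p) (nu (X u)) = m ->
  m <= 0 /\ eta (X u) - p = m *: (X u - b0).
Proof.
move=> mn E; have [sY tY trY] := deta LX; set Y := eta \o X in sY tY trY.
have sZ := smoothvB oU sY (smoothv_cst U p); pose Z := Y - cst p; rewrite -/Z in sZ.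
have nk v : U v -> exists k, n v = k *: chart_normal X v.
  by move=> Uv; exists (dot (X v - b0) (chart_normal X v))^-1; exact: (nuXE LX Uv).
have tYn i v : U v -> dot (pdv i Y v) (n v) = 0.
  by move=> Uv; have [k ->] := nk v Uv; rewrite dotZr tY // mulr0.
have sG := smooth_dotf oU sZ sn.
have dG i v : U v -> pd i (dotf Z n) v = dotf Z (pdv i n) v.
  by move=> Uv; rewrite (pd_dot oU i sZ sn Uv) (pdvBc p i oU sY Uv) tYn // add0r.
have mx : \forall v \near u, (- dotf Z n) v <= (- dotf Z n) u.
  apply: filterS (openP_near oU Uu) => v Uv.
  rewrite -[leLHS]/(- dot (eta (X v) - p) (nu (X v))) -[leRHS]/(- dot (eta (X u) - p) (nu (X u))).
  by rewrite lerN2 E; apply: mn; exact: local_param_in LX Uv.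
have sNG := smooth_onN oU sG.
have G0 i : dot (Z u) (pdv i n u) = 0.
  have := local_max_pd oU i sNG Uu mx; rewrite (pdN i sG Uu) dG // => /eqP.
  by rewrite oppr_eq0 => /eqP.
(* Both sides have the same pairing [m] with the normal, since [X u - b0] has height one, and
   pairing [0] with its derivatives. *)
have ZE : Z u = m *: (X u - b0).
  apply/eqP; rewrite -subr_eq0; apply/eqP; apply: nuX_basis.
    rewrite dotBl dotZl -[dot (X u - b0) _]/(dotf (X - cst b0) (nuX X) u).
    rewrite (nuX_height LX Uu) mulr1 -E.
    by rewrite -[X in X - _]/(dot (eta (X u) - p) (nu (X u))) subrr.
  move=> i; rewrite dotBl dotZl G0 (nuX_pdv_height LX i Uu).
  by rewrite mulr0 subrr.
split; last exact: ZE.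
have sni i := smoothv_pdv i sn.
have sB := smoothvB oU sX (smoothv_cst U b0).
have bn i j : dot (X u - b0) (pdv j (pdv i n) u) = - dot (pdv j X u) (pdv i n u).
  have := eq_in_pd oU j ((fun v Uv => nuX_pdv_height LX i Uv)
     : forall v, U v -> dotf (X - cst b0) (pdv i n) v = cst 0 v) Uu.
  rewrite pd_cst (pd_dot oU j sB (sni i) Uu) (pdvBc b0 j oU sX Uu) addrC => /eqP.
  by rewrite addr_eq0 => /eqP.
have W i j : dot (pdv i X u) (pdv j n u) = - hess X (n u) i j u
  := nuX_weingarten LX i j Uu.
have G2 i j : pd j (pd i (dotf Z n)) u =
   - (lcoef j X Y u * hess X (n u) 0 i u + rcoef j X Y u * hess X (n u) 1 i u) + m * hess X (n u) j i u.
  rewrite (eq_in_pd oU j (dG i) Uu) (pd_dot oU j sZ (sni i) Uu) (pdvBc p j oU sY Uu).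
  rewrite ZE dotZl bn W (pdv_coef N0 tY j Uu) dotDl !dotZl !W; ring.
have [h00 hD] := hess_negdef LX Uu; rewrite -/n in h00 hD.
have psd (s t : R) := local_max_pd2 oU s t sNG Uu mx.
have N2 i j : pd j (pd i (- dotf Z n)) u = - pd j (pd i (dotf Z n)) u.
  have H v : U v -> pd i (- dotf Z n) v = (- pd i (dotf Z n)) v by move=> Uv; rewrite (pdN i sG Uv).
  by rewrite (eq_in_pd oU j H Uu) (pdN j (smooth_on_pd i sG) Uu).
have Cc := pdC oU 0 1 sG Uu.
have h10 : hess X (n u) 1 0 u = hess X (n u) 0 1 u by rewrite /hess (pdvC oU 1 0 sX Uu).
have tr := trY u Uu.
move: psd Cc; rewrite !N2 !G2 h10; move: h00 hD tr.
move: (hess X (n u) 0 0 u) (hess X (n u) 0 1 u) (hess X (n u) 1 1 u).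
move: (lcoef 0 X Y u) (lcoef 1 X Y u) (rcoef 0 X Y u) (rcoef 1 X Y u).
move=> l0 l1 r0 r1 a b c a0 D tr psd Cc.
have c0 : 0 < - c.
  have : 0 < a * c by apply: lt_le_trans D _; rewrite gerBl sqr_ge0.
  by rewrite oppr_gt0 nmulr_rgt0.
have D' : 0 < - c * - a - b ^+ 2 by rewrite mulrNN mulrC.
have := psd_contraction c0 D' psd.
(* In the contraction with the adjugate of the second form, the differential enters only through its
   trace, so the term in [m] alone remains. *)
set lhs := (X in X <= 0 -> _); have -> : lhs = 2 * m * (a * c - b ^+ 2).
  have r1E : r1 = - l0 by apply/eqP; rewrite -addr_eq0 addrC tr.
  rewrite /lhs.
  set g01 := - (l0 * b + r0 * c) + m * b in Cc *; set g10 := - (l1 * a + r1 * b) + m * b in Cc.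
  transitivity (- c * - (- (l0 * a + r0 * b) + m * a) + b * - g01 + b * - g10 + - a * - (- (l1 * b + r1 * c) + m * c)).
    by rewrite -Cc; ring.
  by rewrite /g01 /g10 r1E; ring.
by rewrite pmulr_lle0 // pmulr_rle0.
Qed.

End Chart.

Lemma touch x (m : R) : M x ->
  (forall y, M y -> m <= dot (eta y - p) (nu y)) -> dot (eta x - p) (nu x) = m ->
  m <= 0 /\ eta x - p = m *: (x - b0).
Proof.
move=> Mx; have [U [X [LX [u Uu <-]]]] := surfM Mx; exact: touch_chart LX Uu m.
Qed.

End Touch.

(** * The maximum principle for a component of the deformation *)

Section Barrier.
Variable eta : 'rV[R]_3 -> 'rV[R]_3.
Hypothesis deta : deformation eta.
Variable e : 'rV[R]_3.

Section Chart.
Variables (U : set 'rV[R]_2) (X : 'rV[R]_2 -> 'rV[R]_3).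
Hypotheses (LX : local_param M U X).
Let oU := local_param_open LX.
Let sX := smooth_smoothv oU (local_param_smooth LX).
Let n := nuX X.
Let sn : smoothv U n := smooth_nuX LX.
Let N0 v (Uv : U v) := chart_normal_neq0 LX Uv.
Let Y := eta \o X.
Let sY : smoothv U Y. Proof. by have [] := deta LX. Qed.
Let tY i v : U v -> dot (pdv i Y v) (chart_normal X v) = 0.
Proof. by have [_ + _] := deta LX; apply. Qed.
Let trY v : U v -> lcoef 0 X Y v + rcoef 1 X Y v = 0.
Proof. by have [_ _] := deta LX; apply. Qed.

Let f := dotf Y (cst e).
Let z := dotf X (cst e).
Let sf : smooth_on U f := smooth_dotf oU sY (smoothv_cst U e).
Let sz : smooth_on U z := smooth_dotf oU sX (smoothv_cst U e).
Let H i j := dotf (pdv i (pdv j X)) n.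
Let sH i j : smooth_on U (H i j) := smooth_dotf oU (smoothv_pdv i (smoothv_pdv j sX)) sn.
Let D1 v := dual1 (pdv 0 X v) (pdv 1 X v).
Let D2 v := dual2 (pdv 0 X v) (pdv 1 X v).
Let al := lcoef 0 X Y.
Let be := rcoef 0 X Y.
Let ga := lcoef 1 X Y.
Let sal : smooth_on U al := smooth_lcoef oU sX sY N0 0.
Let sbe : smooth_on U be := smooth_rcoef oU sX sY N0 0.
Let sga : smooth_on U ga := smooth_lcoef oU sX sY N0 1.
Let del v : U v -> rcoef 1 X Y v = (- al) v.
Proof. by move=> /trY /eqP; rewrite addrC addr_eq0 => /eqP. Qed.

Let A i j := dotf (pdv i (pdv j X)) D1.
Let B i j := dotf (pdv i (pdv j X)) D2.

Let z1E i v : U v -> pd i z v = dot (pdv i X v) e.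
Proof. exact: pd_dot_cst. Qed.

Let f0E v : U v -> pd 0 f v = (al * pd 0 z + be * pd 1 z) v.
Proof.
move=> Uv; rewrite (pd_dot_cst e 0 oU sY Uv) /dotf (pdv_coef N0 tY 0 Uv) dotDl !dotZl.
by rewrite -!z1E.
Qed.

Let f1E v : U v -> pd 1 f v = (ga * pd 0 z - al * pd 1 z) v.
Proof.
move=> Uv; rewrite (pd_dot_cst e 1 oU sY Uv) /dotf (pdv_coef N0 tY 1 Uv) dotDl !dotZl.
by rewrite del // -!z1E // -[RHS]/(ga v * pd 0 z v - al v * pd 1 z v) mulNr.
Qed.

Let hess_sym v : U v -> H 1 0 v = H 0 1 v.
Proof. by move=> Uv; rewrite /H /dotf (pdvC oU 1 0 sX Uv). Qed.

(** Differentiating the tangency of [pdv i Y] and exchanging the two derivatives of [Y] shows the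
    differential symmetric for the second form; the factor [2] comes from the zero trace. *)
Let symE v : U v -> (cst 2 * (al * H 0 1) + be * H 1 1 - ga * H 0 0) v = 0.
Proof.
move=> Uv.
have tn i w : U w -> dotf (pdv i Y) n w = cst 0 w.
  move=> Uw; rewrite /dotf /n (nuXE LX Uw) dotZr tY //.
  by rewrite mulr0.
have d i j : dot (pdv j (pdv i Y) v) (n v) + dot (pdv i Y v) (pdv j n v) = 0.
  have := eq_in_pd oU j (tn i) Uv.
  by rewrite pd_cst (pd_dot oU j (smoothv_pdv i sY) sn Uv).
have W i j : dot (pdv i X v) (pdv j n v) = - H i j v
  := nuX_weingarten LX i j Uv.
have := d 0 1; have := d 1 0; rewrite (pdvC oU 1 0 sY Uv).
rewrite (pdv_coef N0 tY 0 Uv) (pdv_coef N0 tY 1 Uv) !dotDl !dotZl !W del // hess_sym //.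
rewrite -/al -/be -/ga.
move=> e1 e2; rewrite -[LHS]/(2 * (al v * H 0 1 v) + be v * H 1 1 v - ga v * H 0 0 v).
move: e1 e2; rewrite -[(- al) v]/(- al v).
move: (dot _ _) (al v) (be v) (ga v) (H 0 0 v) (H 0 1 v) (H 1 1 v) => w a b c h0 h1 h2 e1 e2.
transitivity ((w + (c * - h0 + - a * - h1)) - (w + (a * - h1 + b * - h2))); first by ring.
by rewrite e1 e2 subrr.
Qed.

(** The two tangential components of the equality of mixed derivatives of [Y]; its normal component
    is [symE]. *)
Let compatE v : U v ->
  pd 1 al v - pd 0 ga v = ga v * A 0 0 v - 2 * al v * A 0 1 v - be v * A 1 1 v /\
  pd 1 be v + pd 0 al v = ga v * B 0 0 v - 2 * al v * B 0 1 v - be v * B 1 1 v.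
Proof.
move=> Uv.
have r1 : pd 0 (rcoef 1 X Y) v = - pd 0 al v by rewrite (eq_in_pd oU 0 del Uv) (pdN 0 sal Uv).
have E := pdvC oU 0 1 sY Uv.
rewrite (pdv2_coef oU sX sY N0 tY 0 1 Uv) (pdv2_coef oU sX sY N0 tY 1 0 Uv) in E.
rewrite r1 del // -/al -/be -/ga (pdvC oU 1 0 sX Uv) -[(- al) v]/(- al v) in E.
have [p1 p2 p3 p4] := dual_pairing (N0 Uv); rewrite -/(D1 v) -/(D2 v) in p1 p2 p3 p4.
have := congr1 (fun w => dot w (D1 v)) E; have := congr1 (fun w => dot w (D2 v)) E.
rewrite !dotDl !dotZl p1 p2 p3 p4 !mulr0 !mulr1.
rewrite -!/(dotf (pdv _ (pdv _ X)) D1 v) -!/(dotf (pdv _ (pdv _ X)) D2 v).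
rewrite -/(A 0 0 v) -/(A 0 1 v) -/(A 1 1 v) -/(B 0 0 v) -/(B 0 1 v) -/(B 1 1 v).
move: (pd 1 al v) (pd 0 ga v) (pd 1 be v) (pd 0 al v) (al v) (be v) (ga v).
move: (A 0 0 v) (A 0 1 v) (A 1 1 v) (B 0 0 v) (B 0 1 v) (B 1 1 v).
by move=> *; split; lra.
Qed.

Let gap k v := barrier_gap k (pd 0 z v) (pd 1 z v) (pd 0 (pd 0 z) v) (pd 0 (pd 1 z) v)
  (pd 1 (pd 1 z) v) (H 0 0 v) (H 0 1 v) (H 1 1 v) (pd 0 (H 0 0) v) (pd 0 (H 0 1) v)
  (pd 0 (H 1 1) v) (pd 1 (H 0 0) v) (pd 1 (H 0 1) v) (pd 1 (H 1 1) v)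
  (A 0 0 v) (A 0 1 v) (A 1 1 v) (B 0 0 v) (B 0 1 v) (B 1 1 v).

Lemma continuous_gap k u : U u -> {for u, continuous (gap k)}.
Proof.
move=> Uu; have sc g : smooth_on U g -> {for u, continuous g}.
  by move=> sg; exact: smooth_on_continuous sg Uu.
have sp i g : smooth_on U g -> smooth_on U (pd i g) by exact: smooth_on_pd.
have sA i j : smooth_on U (A i j).
  exact: (smooth_dotf oU (smoothv_pdv i (smoothv_pdv j sX)) (smooth_dual1 oU sX N0)).
have sB i j : smooth_on U (B i j).
  exact: (smooth_dotf oU (smoothv_pdv i (smoothv_pdv j sX)) (smooth_dual2 oU sX N0)).
by apply: continuous_barrier_gap; apply: sc;
  do ?[exact: sz|exact: sH|exact: sA|exact: sB|apply: (sp)].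
Qed.

(** At a maximum of the sum, the gradient of [f] is a multiple of that of [z], so
    [elliptic_combination] applies. The contracted Hessian of the sum times the negative [char_form]
    is then a positive multiple of [gap k], whereas the contraction is nonnegative at a maximum. One
    [k0] serves all nearby points and all larger [k], ready for a compactness argument. *)
Lemma barrier_chart u : U u -> (dot (pdv 0 X u) e != 0) || (dot (pdv 1 X u) e != 0) ->
  exists k0, \forall v \near u, forall k eps, k0 <= k -> 0 < eps ->
   ~ (forall y, M y -> dot (eta y) e + eps * expR (k * dot y e) <=
        dot (eta (X v)) e + eps * expR (k * dot (X v) e)).
Proof.
move=> Uu ze.
have Dneg v : U v -> (dot (pdv 0 X v) e != 0) || (dot (pdv 1 X v) e != 0) ->
    char_form (pd 0 z v) (pd 1 z v) (H 0 0 v) (H 0 1 v) (H 1 1 v) < 0.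
  move=> Uv; rewrite -!z1E // => zn.
  have [h00 hD] : H 0 0 v < 0 /\ 0 < H 0 0 v * H 1 1 v - H 0 1 v ^+ 2
    := hess_negdef LX Uv.
  have := neg_def2 (s := pd 1 z v) (t := - pd 0 z v) h00 hD.
  rewrite oppr_eq0 orbC => /(_ zn); rewrite /char_form.
  by apply: le_lt_trans; rewrite le_eqVlt; apply/orP; left; apply/eqP; ring.
have Du := Dneg u Uu ze; set D := char_form _ _ _ _ _ in Du.
have DD : 0 < D * D by rewrite nmulr_rgt0.
(* [gap] is affine in [k] with slope [D * D] at [u]; this [k0] brings it to at least [1] there. *)
pose k0 : R := `|(1 - gap 0 u) / (D * D)| + 1.
have k00 : 0 < k0 by rewrite ltr_wpDl.
have gapE k v : gap k v = k * (char_form (pd 0 z v) (pd 1 z v) (H 0 0 v) (H 0 1 v) (H 1 1 v)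
    * char_form (pd 0 z v) (pd 1 z v) (H 0 0 v) (H 0 1 v) (H 1 1 v)) + gap 0 v.
  by rewrite /gap /barrier_gap mul0r add0r !addrA.
have gu : 0 < gap k0 u.
  rewrite gapE -/D; have : (1 - gap 0 u) <= k0 * (D * D).
    rewrite -ler_pdivrMr // /k0; apply: le_trans (ler_norm _) _.
    by rewrite lerDl.
  lra.
exists k0; have cg := continuous_gap (k := k0) Uu.
apply: filterS (filterI (openP_near oU Uu) (cvgr_gt _ cg _ gu)) => v [Uv gv] k eps kk0 eps0 mxM.
have {}gv : 0 < gap k v.
  apply: lt_le_trans gv _; rewrite (gapE k) (gapE k0) lerD2r ler_wpM2r //; exact: sqr_ge0.
have k1 : 0 < k by exact: lt_le_trans kk0.
pose E := (fun w => expR ((cst k * z) w)) : 'rV[R]_2 -> R.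
have sc (a : R) : smooth_on U (cst a : 'rV[R]_2 -> R) by exact: smooth_on_cst.
have sM := smooth_onM oU; have sD := smooth_onD oU.
have skz := sM _ _ (sc k) sz.
have sE : smooth_on U E by exact: smooth_on_expR.
have sp i g : smooth_on U g -> smooth_on U (pd i g) by exact: smooth_on_pd.
have E1 i w : U w -> pd i E w = E w * (k * pd i z w).
  move=> Uw; rewrite (pd_expR i skz Uw) (pdM i (sc k) sz Uw) pd_cst mul0r add0r.
  by [].
pose F := f + cst eps * E.
have sF : smooth_on U F := sD _ _ sf (sM _ _ (sc eps) sE).
have F1 i w : U w -> pd i F w = (pd i f + cst eps * (E * (cst k * pd i z))) w.
  move=> Uw; rewrite (pdD i sf (sM _ _ (sc eps) sE) Uw) (pdM i (sc eps) sE Uw) pd_cst.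
  by rewrite mul0r add0r E1.
have F2 i j w : U w -> pd j (pd i F) w =
    pd j (pd i f) w + eps * (E w * (k * pd j z w) * (k * pd i z w) + E w * (k * pd j (pd i z) w)).
  move=> Uw; rewrite (eq_in_pd oU j (F1 i) Uw).
  have s1 := sM _ _ (sc k) (sp i _ sz); have s2 := sM _ _ sE s1.
  rewrite (pdD j (sp i _ sf) (sM _ _ (sc eps) s2) Uw) (pdM j (sc eps) s2 Uw).
  rewrite (pdM j sE s1 Uw) (pdM j (sc k) (sp i _ sz) Uw) !pd_cst !mul0r !add0r E1 //.
have mx : \forall w \near v, F w <= F v.
  apply: filterS (openP_near oU Uv) => w Uw.
  exact: mxM (local_param_in LX Uw).
have crit i : pd i f v = - (eps * k * E v) * pd i z v.
  have := local_max_pd oU i sF Uv mx; rewrite F1 // => /eqP.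
  rewrite -[X in X == 0]/(pd i f v + eps * (E v * (k * pd i z v))) addr_eq0 => /eqP ->; ring.
have psd (s t : R) := local_max_pd2 oU s t sF Uv mx.
have [h00 hD] : H 0 0 v < 0 /\ 0 < H 0 0 v * H 1 1 v - H 0 1 v ^+ 2
  := hess_negdef LX Uv.
have zC := pdC oU 0 1 sz Uv; have fC := pdC oU 0 1 sf Uv.
have e00 : pd 0 (pd 0 f) v = pd 0 al v * pd 0 z v + al v * pd 0 (pd 0 z) v
    + pd 0 be v * pd 1 z v + be v * pd 0 (pd 1 z) v.
  rewrite (eq_in_pd oU 0 f0E Uv) (pdD 0 (sM _ _ sal (sp 0 _ sz)) (sM _ _ sbe (sp 1 _ sz)) Uv).
  by rewrite (pdM 0 sal (sp 0 _ sz) Uv) (pdM 0 sbe (sp 1 _ sz) Uv) !addrA.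
have e01 : pd 1 (pd 0 f) v = pd 1 al v * pd 0 z v + al v * pd 0 (pd 1 z) v
    + pd 1 be v * pd 1 z v + be v * pd 1 (pd 1 z) v.
  rewrite (eq_in_pd oU 1 f0E Uv) (pdD 1 (sM _ _ sal (sp 0 _ sz)) (sM _ _ sbe (sp 1 _ sz)) Uv).
  by rewrite (pdM 1 sal (sp 0 _ sz) Uv) (pdM 1 sbe (sp 1 _ sz) Uv) zC !addrA.
have e11 : pd 1 (pd 1 f) v = pd 1 ga v * pd 0 z v + ga v * pd 0 (pd 1 z) v
    - pd 1 al v * pd 1 z v - al v * pd 1 (pd 1 z) v.
  rewrite (eq_in_pd oU 1 f1E Uv) (pdB oU 1 (sM _ _ sga (sp 0 _ sz)) (sM _ _ sal (sp 1 _ sz)) Uv).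
  by rewrite (pdM 1 sga (sp 0 _ sz) Uv) (pdM 1 sal (sp 1 _ sz) Uv) zC opprD !addrA.
have dS i : 2 * (pd i al v * H 0 1 v + al v * pd i (H 0 1) v) +
    (pd i be v * H 1 1 v + be v * pd i (H 1 1) v) - (pd i ga v * H 0 0 v + ga v * pd i (H 0 0) v) = 0.
  have := eq_in_pd oU i (symE : forall w, U w -> _ w = cst 0 w) Uv; rewrite pd_cst.
  have s1 := sM _ _ sal (sH 0 1); have s2 := sM _ _ sbe (sH 1 1); have s3 := sM _ _ sga (sH 0 0).
  rewrite (pdB oU i (sD _ _ (sM _ _ (sc 2) s1) s2) s3 Uv) (pdD i (sM _ _ (sc 2) s1) s2 Uv).
  rewrite (pdM i (sc 2) s1 Uv) pd_cst mul0r add0r.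
  by rewrite (pdM i sal (sH 0 1) Uv) (pdM i sbe (sH 1 1) Uv) (pdM i sga (sH 0 0) Uv).
have [k1E k2E] := compatE Uv.
have s : 2 * al v * H 0 1 v + be v * H 1 1 v - ga v * H 0 0 v = 0.
  by rewrite -(symE Uv) -mulrA.
have m0 : al v * pd 0 z v + be v * pd 1 z v = - (eps * k * E v) * pd 0 z v.
  by rewrite -crit f0E.
have m1 : ga v * pd 0 z v - al v * pd 1 z v = - (eps * k * E v) * pd 1 z v.
  by rewrite -crit f1E.
have key := elliptic_combination e00 e01 e11 s (dS 0) (dS 1) k1E k2E m0 m1.
(* At a critical point of [z], [gap] would vanish. *)
have zv : (pd 0 z v != 0) || (pd 1 z v != 0).
  apply: contraT; rewrite negb_or !negbK => /andP[/eqP z0 /eqP z1].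
  by move: gv; rewrite /gap z0 z1 /barrier_gap /kappa /char_form !(mulr0, mul0r, addr0, subr0) ltxx.
have Dv := Dneg v Uv; rewrite -!z1E // in Dv; have {}Dv := Dv zv.
have c0 : 0 < - H 1 1 v.
  have : 0 < H 0 0 v * H 1 1 v by apply: lt_le_trans hD _; rewrite gerBl sqr_ge0.
  by rewrite oppr_gt0 nmulr_rgt0.
have hD' : 0 < - H 1 1 v * - H 0 0 v - H 0 1 v ^+ 2 by rewrite mulrNN mulrC.
have {psd} := psd_contraction c0 hD' psd; rewrite !F2 // fC.
have Epos : 0 < E v by exact: expR_gt0.
move: gv Dv key; rewrite /gap /barrier_gap /kappa !expr2.
rewrite -[_ - 2 * H 0 1 v * pd 0 z v * pd 1 z v + _]/(char_form (pd 0 z v) (pd 1 z v) (H 0 0 v) (H 0 1 v) (H 1 1 v)).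
set Dl := char_form _ _ _ _ _.
set zz := H 1 1 v * pd 0 (pd 0 z) v - 2 * H 0 1 v * pd 0 (pd 1 z) v + H 0 0 v * pd 1 (pd 1 z) v.
set kap := (X in - (eps * k * E v) * X).
set W := (X in X * Dl = _) => gv Dv key.
set S := (X in X <= 0 -> False).
have -> : S = - (W + eps * E v * k * (k * Dl + zz)) by rewrite /S /W /Dl /zz /char_form; ring.
rewrite oppr_le0 => h.
have : 0 < (W + eps * E v * k * (k * Dl + zz)) * Dl.
  have -> : (W + eps * E v * k * (k * Dl + zz)) * Dl =
      eps * E v * k * (k * (Dl * Dl) + zz * Dl - kap) by rewrite mulrDl key; ring.
  by do 2 apply: mulr_gt0 => //; apply: mulr_gt0.
by rewrite nmulr_lgt0 // ltNge h.
Qed.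

End Chart.

End Barrier.

Lemma continuous_dot_deformation eta e : deformation eta ->
  {within M, continuous (fun x => dot (eta x) e)}.
Proof.
move=> deta; apply: (within_continuous_charts) => U X u LX Uu.
have [sY _ _] := deta U X LX; have oU := local_param_open LX.
exact: smooth_on_continuous (smooth_dotf oU sY (smoothv_cst U e)) Uu.
Qed.

Lemma continuous_barrier eta e (k eps : R) : deformation eta ->
  {within M, continuous (fun x => dot (eta x) e + eps * expR (k * dot x e))}.
Proof.
move=> deta; apply: (within_continuous_charts) => U X u LX Uu.
have [sY _ _] := deta U X LX; have oU := local_param_open LX.
have sX := smooth_smoothv oU (local_param_smooth LX).
have sc (a : R) : smooth_on U (cst a : 'rV[R]_2 -> R) by exact: smooth_on_cst.
have sE := smooth_on_expR oU (smooth_onM oU (sc k) (smooth_dotf oU sX (smoothv_cst U e))).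
have sF := smooth_onD oU (smooth_dotf oU sY (smoothv_cst U e)) (smooth_onM oU (sc eps) sE).
exact: smooth_on_continuous sF Uu.
Qed.

(** The poles are the only critical points of [<x, e>], hence the only points that [barrier_chart]
    leaves out. *)
Lemma orth_tangent_pole U X u e : local_param M U X -> U u -> e != 0 ->
  dot (pdv 0 X u) e = 0 -> dot (pdv 1 X u) e = 0 -> exists2 l : R, l != 0 & nu (X u) = l *: e.
Proof.
move=> LX Uu e0 x0 x1; have N0 := chart_normal_neq0 LX Uu.
have := orth_cross x0 x1; rewrite -/(chart_normal X u); set N := chart_normal X u in N0 *.
move=> E; have NN0 : dot N N != 0 by rewrite dot_eq0.
have eE : e = (dot e N / dot N N) *: N by apply: (scalerI NN0); rewrite E scalerA mulrC divfK.
have [b0N nE] := outer_normal_chart LX Uu (nuP (local_param_in LX Uu)).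
have k0 : dot e N / dot N N != 0 by apply: contraNneq e0 => k0; rewrite eE k0 scale0r.
exists ((dot (X u - b0) N)^-1 / (dot e N / dot N N)).
  by rewrite mulf_neq0 // invr_eq0.
by rewrite nE {2}eE scalerA divfK.
Qed.

(* A value above those at the poles would survive, for small [eps], as a maximum
   of [<eta, e> + eps * expR (k * <x, e>)] away from the poles; [k] can be chosen
   uniformly since that part of the surface is compact. *)
Lemma max_at_poles eta e xp xm (lp lm : R) : deformation eta -> e != 0 -> M xp -> M xm ->
  0 < lp -> 0 < lm -> nu xp = lp *: e -> nu xm = - (lm *: e) ->
  forall x, M x -> dot (eta x) e <= Num.max (dot (eta xp) e) (dot (eta xm) e).
Proof.
move=> deta e0 Mp Mm lp0 lm0 nup num x1 Mx1; rewrite leNgt; apply/negP.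
pose f x := dot (eta x) e; rewrite -/(f x1) -/(f xp) -/(f xm).
set mp := Num.max _ _ => lt1.
(* A level strictly between the values at the poles and the supposed larger one: no pole lies where
   [m' <= f x]. *)
pose m' := (f x1 + mp) / 2.
have m'1 : m' < f x1 by rewrite /m'; lra.
have m'p : mp < m' by rewrite /m'; lra.
have M0 : M !=set0 by exists x1.
have compM := compact_boundary.
have cf := continuous_dot_deformation (e := e) deta.
have bad : \forall k \near +oo, M `<=` (fun x => m' <= f x -> forall eps, 0 < eps ->
    ~ (forall y, M y -> f y + eps * expR (k * dot y e) <= f x + eps * expR (k * dot x e))).
  have nc := (near_covering_withinP M).2 ((compact_near_coveringP M).1 compM).
  apply: (nc R +oo (fun k x => m' <= f x -> forall eps, 0 < eps ->
    ~ (forall y, M y -> f y + eps * expR (k * dot y e) <= f x + eps * expR (k * dot x e)))).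
  move=> x Mx; have [U [X [LX [u Uu Xu]]]] := surfM Mx.
  have [fx|fx] := ltP (f x) m'.
    have ltm : nbhs (f x) [set r | r < m'] by exact: lt_nbhsl.
    have nx := within_continuous_near cf Mx ltm.
    exists ([set x' | M x' -> f x' < m'], setT); first by split => //; exact: filterT.
    by move=> [x' k] /= [H _] Mx' mx'; have := H Mx'; rewrite ltNge mx'.
  have ze : (dot (pdv 0 X u) e != 0) || (dot (pdv 1 X u) e != 0).
    apply: contraT; rewrite negb_or !negbK => /andP[/eqP z0 /eqP z1].
    have [l l0 nl] := orth_tangent_pole LX Uu e0 z0 z1; rewrite Xu in nl.
    have [lpos|lneg|l00] := ltgtP 0 l.
    - have xE : x = xp.
        apply: (nu_parallel_inj Mx Mp (divr_gt0 lpos lp0)).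
        by rewrite nl nup scalerA divfK // gt_eqF.
      by move: fx m'p; rewrite xE /mp => fx; rewrite ltNge (le_trans fx) // le_max lexx.
    - have xE : x = xm.
        have ll : 0 < - l / lm by rewrite divr_gt0 // oppr_gt0.
        apply: (nu_parallel_inj Mx Mm ll).
        by rewrite nl num scalerN scalerA divfK ?gt_eqF // scaleNr opprK.
      by move: fx m'p; rewrite xE /mp => fx; rewrite ltNge (le_trans fx) // le_max lexx orbT.
    - by move: l0; rewrite -l00 eqxx.
  have [k0 Hk0] := barrier_chart deta LX Uu ze.
  have near_x := local_param_near LX Uu Hk0; rewrite Xu in near_x.
  exists ([set x' | M x' -> exists2 v, U v /\ (forall k eps, k0 <= k -> 0 < eps ->
    ~ (forall y, M y -> dot (eta y) e + eps * expR (k * dot y e) <=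
        dot (eta (X v)) e + eps * expR (k * dot (X v) e))) & x' = X v], [set k | k0 <= k]).
    by split; [exact: near_x|exact: (nbhs_pinfty_ge (num_real k0))].
  move=> [x' k] /= [H kk] Mx' _ eps eps0; have [v [Uv Hv] ->] := H Mx'.
  exact: Hv.
have [k Hk] : exists k, M `<=` (fun x => m' <= f x -> forall eps, 0 < eps ->
    ~ (forall y, M y -> f y + eps * expR (k * dot y e) <= f x + eps * expR (k * dot x e))).
  by apply: (@filter_ex _ (pinfty_nbhs R)) => //; exact: bad.
(* For the zero deformation, [continuous_barrier] is the continuity of the exponential alone. *)
have d0 : deformation (fun _ => 0).
  move=> U X LX; have oU := local_param_open LX.
  have E i u : pdv i ((fun _ => 0) \o X) u = 0 by exact: pdv_cst.
  split=> [|i u Uu|u Uu]; first exact: smoothv_cst.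
    by rewrite E dot0l.
  by rewrite /lcoef /rcoef !E !dot0l addr0.
have [xb] := compact_EVT_max M0 compM (continuous_barrier (e := e) (k := k) (eps := 1) d0).
rewrite inE => Mxb maxb; set B := expR (k * dot xb e).
have B0 : 0 < B by exact: expR_gt0.
have HB x : M x -> expR (k * dot x e) <= B.
  by move=> Mx; have := maxb x; rewrite inE => /(_ Mx); rewrite !dot0l !add0r !mul1r.
(* The barrier then adds at most [f x1 - m'], so a point with [f] below [m'] stays below the value
   of the sum at [x1]. *)
pose eps := (f x1 - m') / B.
have eps0 : 0 < eps by rewrite divr_gt0 // subr_gt0.
have [xs] := compact_EVT_max M0 compM (continuous_barrier (e := e) (k := k) (eps := eps) deta).
rewrite inE => Mxs maxs.
have {}maxs y : M y -> f y + eps * expR (k * dot y e) <= f xs + eps * expR (k * dot xs e).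
  by move=> My; apply: maxs; rewrite inE.
have [fxs|fxs] := ltP (f xs) m'; last exact: Hk Mxs fxs eps eps0 maxs.
have := maxs x1 Mx1; rewrite leNgt => /negP; apply.
have h1 : eps * expR (k * dot xs e) <= f x1 - m'.
  by have -> : f x1 - m' = eps * B; [rewrite divfK // gt_eqF|rewrite ler_pM2l // HB].
have h2 : 0 < eps * expR (k * dot x1 e) by rewrite mulr_gt0 // expR_gt0.
lra.
Qed.

(* [touch] at the midpoint of [p] and [q] makes both functions vanish at one
   point. *)
Lemma support_ge0_unique eta p q : M !=set0 -> deformation eta ->
  (forall x, M x -> 0 <= dot (eta x - p) (nu x)) ->
  (forall x, M x -> 0 <= dot (eta x - q) (nu x)) -> p = q.
Proof.
move=> M0 deta Hp Hq; have compM := compact_boundary.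
pose r := 2^-1 *: (p + q).
have rE x : dot (eta x - r) (nu x) = (dot (eta x - p) (nu x) + dot (eta x - q) (nu x)) / 2.
  by rewrite /r !dotE !mxE; field.
have cg : {within M, continuous (fun x => dot (eta x - r) (nu x))}.
  apply: (within_continuous_charts) => U X u LX Uu.
  have [sY _ _] := deta U X LX; have oU := local_param_open LX.
  have sn := smooth_nuX LX.
  exact: smooth_on_continuous (smooth_dotf oU (smoothvB oU sY (smoothv_cst U r)) sn) Uu.
have [x] := compact_EVT_min M0 compM cg; rewrite inE => Mx mx.
have [m0 _] := touch deta Mx
   (fun y My => mx y (mem_set My)) erefl.
have [h1 h2] := (Hp x Mx, Hq x Mx).
have gp : dot (eta x - p) (nu x) = 0 by move: m0; rewrite rE; lra.
have gq : dot (eta x - q) (nu x) = 0 by move: m0; rewrite rE; lra.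
have [_ ep] := touch deta Mx Hp gp.
have [_ eq] := touch deta Mx Hq gq.
move: ep eq; rewrite !scale0r => /eqP; rewrite subr_eq0 => /eqP <- /eqP.
by rewrite subr_eq0 => /eqP.
Qed.

(** * The support inequality at a maximal pole *)

Section Poles.
Variable eta : 'rV[R]_3 -> 'rV[R]_3.
Hypothesis deta : deformation eta.

Section Touching.
Variables (e p : 'rV[R]_3) (del t : R) (y : 'rV[R]_3).
Hypotheses (e1 : dot e e = 1) (My : M y) (t0 : 0 <= t) (del0 : 0 < del).
Hypothesis rho0 : 0 < axial_distance e (nu y).
Let h x := dot (eta x - p) (nu x) + del * (enorm (nu x) - dot (nu x) e)
   + t * axial_distance e (nu x).
Hypothesis hy : h y = 0.
Hypothesis h_ge0 : forall x, M x -> 0 <= h x.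

(* The gradient of [h] at [y] determines [eta y - p], the square roots being
   replaced by the majorants of [mean_sqrt], which touch at [y]. *)
Lemma axial_touch : 0 < dot (eta y - p) e.
Proof.
have [U [X [LX [u Uu Xu]]]] := surfM My.
have oU := local_param_open LX; have sX := smooth_smoothv oU (local_param_smooth LX).
have [sY tY _] := deta LX.
have sn := smooth_nuX LX; set n := nuX X in sn.
set rho := axial_distance e (nu y); have rho1 : 0 < rho := rho0.
pose r := enorm (nu y).
have rr : r ^+ 2 = dot (nu y) (nu y) by rewrite sqr_sqrtr // dot_ge0.
have rrho : rho ^+ 2 = dot (nu y) (nu y) - dot (nu y) e ^+ 2.
  by rewrite sqr_sqrtr // axial_ge0.
have r0 : 0 < r by rewrite sqrtr_gt0 dot_gt0 //; exact: (nu_neq0 My).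
have cr : dot (nu y) e < r.
  have : dot (nu y) e ^+ 2 < r ^+ 2 by rewrite rr -subr_gt0 -rrho exprn_gt0.
  by nra.
(* The factors with which the squared quantities enter the majorants of [mean_sqrt] touching at [r]
   and [rho]. *)
pose k1 := del / (2 * r); pose k2 := t / (2 * rho).
have k1_ge0 : 0 <= k1 by rewrite divr_ge0 // ?mulr_ge0 // ltW.
have k2_ge0 : 0 <= k2 by rewrite divr_ge0 // ?mulr_ge0 // ltW.
have sc (a : R) : smooth_on U (cst a : 'rV[R]_2 -> R) by exact: smooth_on_cst.
have sZ := smoothvB oU sY (smoothv_cst U p); set Z := eta \o X - cst p in sZ.
pose g := dotf Z n; pose a := dotf n n; pose b := dotf n (cst e).
have sg : smooth_on U g := smooth_dotf oU sZ sn.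
have sa : smooth_on U a := smooth_dotf oU sn sn.
have sb : smooth_on U b := smooth_dotf oU sn (smoothv_cst U e).
have s1 := smooth_onM oU (sc (- k1)) sa; have s2 := smooth_onM oU (sc del) sb.
have s3 := smooth_onM oU (sc (- k2)) (smooth_onB oU sa (smooth_onM oU sb sb)).
pose F := - g + cst (- k1) * a + cst del * b + cst (- k2) * (a - b * b).
have sF : smooth_on U F.
  exact: (smooth_onD oU (smooth_onD oU (smooth_onD oU (smooth_onN oU sg) s1) s2) s3).
have FE v : F v = - (dot (eta (X v) - p) (nu (X v)) + k1 * dot (nu (X v)) (nu (X v))
    - del * dot (nu (X v)) e + k2 * (dot (nu (X v)) (nu (X v)) - dot (nu (X v)) e ^+ 2)).
  rewrite -[LHS]/(- dot (eta (X v) - p) (nu (X v)) + - k1 * dot (nu (X v)) (nu (X v))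
    + del * dot (nu (X v)) e + - k2 * (dot (nu (X v)) (nu (X v)) - dot (nu (X v)) e * dot (nu (X v)) e)).
  by ring.
have k1r : k1 * r ^+ 2 = del * r / 2 by rewrite /k1; field; rewrite gt_eqF.
have k2r : k2 * rho ^+ 2 = t * rho / 2 by rewrite /k2; field; rewrite gt_eqF.
have mx : \forall v \near u, F v <= F u.
  apply: filterS (openP_near oU Uu) => v Uv.
  have Mv := local_param_in LX Uv; rewrite !FE Xu lerN2 -rrho -rr.
  have := h_ge0 Mv; move: hy; rewrite /h -/r -/rho.
  set nv := nu (X v) => e0 hv.
  have m1 : del * enorm nv <= k1 * dot nv nv + del * r / 2.
    have := mean_sqrt (dot_ge0 nv) r0; rewrite -(ler_pM2l del0) => /le_trans; apply.
    by rewrite /k1 le_eqVlt; apply/orP; left; apply/eqP; field; rewrite gt_eqF.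
  have m2 : t * axial_distance e nv <= k2 * (dot nv nv - dot nv e ^+ 2) + t * rho / 2.
    have := mean_sqrt (axial_ge0 nv e1) rho1; move=> /(ler_wpM2l t0) /le_trans; apply.
    by rewrite /k2 le_eqVlt; apply/orP; left; apply/eqP; field; rewrite gt_eqF.
  by rewrite k1r k2r; lra.
have crit i : dot (Z u + (del / r) *: n u - del *: e + (t / rho) *: (n u - b u *: e)) (pdv i n u) = 0.
  have := local_max_pd oU i sF Uu mx.
  rewrite (pdD i (smooth_onD oU (smooth_onD oU (smooth_onN oU sg) s1) s2) s3 Uu).
  rewrite (pdD i (smooth_onD oU (smooth_onN oU sg) s1) s2 Uu) (pdD i (smooth_onN oU sg) s1 Uu).
  rewrite (pdN i sg Uu) (pdM i (sc _) sa Uu) (pdM i (sc _) sb Uu).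
  rewrite (pdM i (sc _) (smooth_onB oU sa (smooth_onM oU sb sb)) Uu).
  rewrite (pdB oU i sa (smooth_onM oU sb sb) Uu) (pdM i sb sb Uu) !pd_cst !mul0r !add0r.
  rewrite /g (pd_dot oU i sZ sn Uu) (pdvBc p i oU sY Uu).
  have -> : dot (pdv i (eta \o X) u) (n u) = 0.
    by rewrite /n (nuXE LX Uu) dotZr tY // mulr0.
  rewrite /a (pd_dot oU i sn sn Uu) /b (pd_dot_cst e i oU sn Uu) -/b.
  rewrite -[dotf (pdv i n) (cst e) u]/(dot (pdv i n u) e) (dotC (pdv i n u) (n u)) (dotC _ e).
  rewrite !(dotDl, dotNl, dotZl) /k1 /k2 /cst.
  move: (dot (_ u) _) (dot p _) (dot (n u) _) (dot e _) (b u) => w0 w1 w2 w3 w4 E.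
  transitivity (- (- (0 + (w0 - w1)) + - (del / (2 * r)) * (w2 + w2) + del * w3
     + - (t / (2 * rho)) * (w2 + w2 - (w3 * w4 + w4 * w3)))).
    by field; rewrite !gt_eqF.
  by rewrite E oppr0.
have nE : n u = nu y by rewrite /n /nuX /= Xu.
have ZE : Z u = eta y - p by rewrite -Xu.
have bE : b u = dot (nu y) e by rewrite /b /dotf nE.
have := nuX_basis LX Uu _ crit.
rewrite -/n nE ZE bE => W.
(* By homogeneity of degree one in the normal, pairing this vector with [nu y] gives [h y], which is
   zero; [crit] gives the pairings with the derivatives of the normal. *)
have {}W : eta y - p + del / r *: nu y - del *: e + t / rho *: (nu y - dot (nu y) e *: e) = 0.
  apply: W; rewrite !(dotDl, dotNl, dotZl) -rr (dotC e (nu y)).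
  transitivity (h y); last exact: hy.
  rewrite /h -/r -/rho dotBl.
  have -> : t / rho * (r ^+ 2 - dot (nu y) e * dot (nu y) e) = t * rho.
    rewrite -expr2 rr -rrho; field; rewrite gt_eqF //.
  by field; rewrite gt_eqF.
(* Along [e] the axial term drops out, leaving [del * (r - dot (nu y) e) / r], which is positive off
   the axis. *)
have := congr1 (fun w => dot w e) W.
rewrite !(dotDl, dotNl, dotZl) e1 dot0l mulr1 mulr1 subrr mulr0 addr0.
have : 0 < del * (r - dot (nu y) e) / r by rewrite divr_gt0 // mulr_gt0 // subr_gt0.
have -> : del * (r - dot (nu y) e) / r = del - del / r * dot (nu y) e.
  by field; rewrite gt_eqF.
lra.
Qed.

End Touching.

End Poles.

Section PoleEstimate.
Variable eta : 'rV[R]_3 -> 'rV[R]_3.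
Hypothesis deta : deformation eta.

(* The pairing vanishes to second order at the pole, whereas the square of the
   axial distance has a nondegenerate minimum there. *)
Lemma near_pole_ge0 e x0 (l eps : R) : dot e e = 1 -> M x0 -> 0 < l -> nu x0 = l *: e -> 0 < eps ->
  \forall x \near x0, M x -> 0 <= dot (eta x - eta x0) (nu x) + eps * axial_distance e (nu x).
Proof.
move=> e1 Mx0 l0 nx0 eps0; have [U [X [LX [u Uu Xu]]]] := surfM Mx0.
have oU := local_param_open LX; have sX := smooth_smoothv oU (local_param_smooth LX).
have [sY tY _] := deta LX.
have sn := smooth_nuX LX; set n := nuX X in sn.
have sZ := smoothvB oU sY (smoothv_cst U (eta x0)); set Z := eta \o X - cst (eta x0) in sZ.
pose g := dotf Z n; pose a := dotf n n; pose b := dotf n (cst e).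
have sg : smooth_on U g := smooth_dotf oU sZ sn.
have sa : smooth_on U a := smooth_dotf oU sn sn.
have sb : smooth_on U b := smooth_dotf oU sn (smoothv_cst U e).
have sbb := smooth_onM oU sb sb.
pose rho2 := a - b * b.
have srho : smooth_on U rho2 := smooth_onB oU sa sbb.
have nu_u : n u = l *: e by rewrite /n /nuX /= Xu.
have bu : b u = l by rewrite /b /dotf nu_u dotZl e1 mulr1.
have Z0 : Z u = 0 by rewrite -[Z u]/(eta (X u) - eta x0) Xu subrr.
have g0 : g u = 0 by rewrite /g /dotf Z0 dot0l.
have dg i : pd i g u = 0.
  rewrite /g (pd_dot oU i sZ sn Uu) Z0 dot0l addr0 (pdvBc _ i oU sY Uu).
  by rewrite /n (nuXE LX Uu) dotZr tY // mulr0.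
have rho0 : rho2 u = 0.
  by rewrite -[LHS]/(dot (n u) (n u) - b u * b u) bu nu_u dotZl dotZr e1 mulr1 subrr.
have sni i := smoothv_pdv i sn.
have se := smoothv_cst U e.
have dr i v : U v -> pd i rho2 v = (dotf (pdv i n) n + dotf n (pdv i n) -
   (dotf (pdv i n) (cst e) * b + b * dotf (pdv i n) (cst e))) v.
  move=> Uv; rewrite (pdB oU i sa sbb Uv) (pdM i sb sb Uv) /a (pd_dot oU i sn sn Uv).
  by rewrite /b (pd_dot_cst e i oU sn Uv).
have dr0 i : pd i rho2 u = 0.
  rewrite dr // -[LHS]/(dot (pdv i n u) (n u) + dot (n u) (pdv i n u) -
     (dot (pdv i n u) e * b u + b u * dot (pdv i n u) e)) bu nu_u dotZl dotZr (dotC e).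
  by ring.
pose q i j := dot (pdv i n u) (pdv j n u) - dot (pdv i n u) e * dot (pdv j n u) e.
have d2r i j : pd j (pd i rho2) u = 2 * q i j.
  rewrite (eq_in_pd oU j (dr i) Uu).
  have s1 := smooth_dotf oU (sni i) sn; have s2 := smooth_dotf oU sn (sni i).
  have s3 := smooth_dotf oU (sni i) se.
  have s4 := smooth_onM oU s3 sb; have s5 := smooth_onM oU sb s3.
  rewrite (pdB oU j (smooth_onD oU s1 s2) (smooth_onD oU s4 s5) Uu).
  rewrite (pdD j s1 s2 Uu) (pdD j s4 s5 Uu) (pdM j s3 sb Uu) (pdM j sb s3 Uu).
  rewrite (pd_dot oU j (sni i) sn Uu) (pd_dot oU j sn (sni i) Uu).
  rewrite /b (pd_dot_cst e j oU sn Uu) (pd_dot_cst e j oU (sni i) Uu) -/b bu /dotf /cst nu_u.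
  rewrite !dotZl !dotZr (dotC e) (dotC (pdv j n u) (pdv i n u)) /q.
  by ring.
have [h00 hD] := hess_negdef LX Uu.
(* The parts orthogonal to [e] of the derivatives of the normal; their Gram matrix is half the
   Hessian of the squared axial distance. *)
pose F i := pdv i n u - dot (pdv i n u) e *: e.
have qF i j : q i j = dot (F i) (F j).
  by rewrite /F /q !(dotBl, dotBr, dotZl, dotZr) e1 (dotC e); ring.
have Xe i : dot (pdv i X u) e = 0.
  have := nuX_tangent LX i Uu; rewrite /dotf -/n nu_u dotZr => /eqP.
  by rewrite mulf_eq0 gt_eqF //= => /eqP.
have XF i j : dot (pdv i X u) (F j) = - hess X (n u) i j u.
  by rewrite /F dotBr dotZr Xe mulr0 subr0 (nuX_weingarten LX i j Uu).
(* Up to sign, the pairings of the tangent basis with [F 0] and [F 1] form the second fundamental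
   form, whose determinant is nonzero. *)
have cF : cross (F 0) (F 1) != 0.
  apply/eqP => c0; have := cross_dot (pdv 0 X u) (pdv 1 X u) (F 0) (F 1).
  rewrite c0 dot0r !XF (_ : hess X (n u) 1 0 u = hess X (n u) 0 1 u).
    by move=> /esym; rewrite !mulrNN -expr2 => E; move: hD; rewrite -/n E ltxx.
  by rewrite /hess (pdvC oU 1 0 sX Uu).
have q00 : 0 < 2 * q 0 0.
  rewrite mulr_gt0 // qF; apply: dot_gt0; apply: contraNneq cF => ->.
  by apply/eqP; apply: row3P; rewrite !crossE !mxE; ring.
have qD : 0 < 2 * q 0 0 * (2 * q 1 1) - (2 * q 0 1) ^+ 2.
  rewrite (_ : _ - _ = 4 * dot (cross (F 0) (F 1)) (cross (F 0) (F 1))).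
    by rewrite mulr_gt0 // dot_gt0.
  by rewrite dot_cross !qF; ring.
have [k k0 [K1 K2]] := large_multiple_posdef (pd 0 (pd 0 g) u) (pd 0 (pd 1 g) u) (pd 1 (pd 1 g) u) q00 qD.
pose Psi := - (g + cst k * rho2).
have skr := smooth_onM oU (smooth_on_cst U k) srho.
have sgk := smooth_onD oU sg skr.
have sPsi : smooth_on U Psi := smooth_onN oU sgk.
have dPsi i v : U v -> pd i Psi v = (- (pd i g + cst k * pd i rho2)) v.
  move=> Uv; rewrite (pdN i sgk Uv) (pdD i sg skr Uv) (pdM i (smooth_on_cst U k) srho Uv).
  by rewrite pd_cst mul0r add0r.
have d2Psi i j : pd j (pd i Psi) u = - (pd j (pd i g) u + k * (2 * q i j)).
  rewrite (eq_in_pd oU j (dPsi i) Uu).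
  have s1 := smooth_on_pd i sg; have s2 := smooth_on_pd i srho.
  have s3 := smooth_onM oU (smooth_on_cst U k) s2.
  rewrite (pdN j (smooth_onD oU s1 s3) Uu) (pdD j s1 s3 Uu) (pdM j (smooth_on_cst U k) s2 Uu).
  by rewrite pd_cst mul0r add0r d2r.
have dPsi0 i : pd i Psi u = 0.
  by rewrite dPsi // -[LHS]/(- (pd i g u + k * pd i rho2 u)) dg dr0 mulr0 addr0 oppr0.
have := strict_local_max oU sPsi Uu (dPsi0 0) (dPsi0 1).
rewrite !d2Psi oppr_lt0 mulrNN sqrrN.
have q10 : q 1 0 = q 0 1 by rewrite /q (dotC (pdv 1 n u)) mulrC.
rewrite q10 => /(_ K1 K2) smax.
have crho := smooth_on_continuous srho Uu.
(* Where the axial distance is at most [eps / k], [k] times its square is at most [eps] times the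
   distance itself. *)
have rho_small : \forall v \near u, rho2 v < (eps / k) ^+ 2.
  by apply: (cvgr_lt _ crho); rewrite rho0 exprn_gt0 // divr_gt0.
have nsm : \forall v \near u, (v != u -> Psi v < Psi u) /\ rho2 v < (eps / k) ^+ 2.
  by near=> v; split; near: v.
have near_x := local_param_near LX Uu nsm; rewrite Xu in near_x.
apply: filterS near_x => x Hx Mx; have [v [Uv [smv rv]] xv] := Hx Mx.
have gE : dot (eta x - eta x0) (nu x) = g v by rewrite xv.
have rE : axial_distance e (nu x) = Num.sqrt (rho2 v).
  by rewrite /axial_distance xv expr2.
have rho2_ge0 : 0 <= rho2 v.
  rewrite -[rho2 v]/(dot (n v) (n v) - dot (n v) e * dot (n v) e) -expr2.
  exact: axial_ge0.
have Psiu : Psi u = 0 by rewrite -[LHS]/(- (g u + k * rho2 u)) g0 rho0 mulr0 addr0 oppr0.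
have : Psi v <= 0.
  by have [->|vu] := eqVneq v u; [rewrite Psiu|rewrite -Psiu ltW // smv].
rewrite -[Psi v]/(- (g v + k * rho2 v)) oppr_le0 gE rE => H; apply: le_trans H _.
rewrite lerD2l -{1}[rho2 v](sqr_sqrtr rho2_ge0) expr2 mulrA ler_wpM2r ?sqrtr_ge0 //.
have : Num.sqrt (rho2 v) <= eps / k.
  have ek : 0 <= eps / k by rewrite divr_ge0 // ltW.
  by rewrite -[leRHS](ger0_norm ek) -sqrtr_sqr ler_wsqrtr // ltW.
by rewrite ler_pdivlMr // mulrC.
Unshelve. all: by end_near. Qed.

End PoleEstimate.

Section MaxPole.
Variable eta : 'rV[R]_3 -> 'rV[R]_3.
Hypothesis deta : deformation eta.

Lemma continuous_nu_fun (f : 'rV[R]_3 -> R) :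
  (forall n, {for n, continuous f}) -> {within M, continuous (fun x => f (nu x))}.
Proof.
move=> cf; apply: (within_continuous_charts) => U X u LX Uu.
have cn := smoothv_continuous (smooth_nuX LX) Uu.
exact: (@continuous_comp _ _ _ (nuX X) f u cn (cf _)).
Qed.

Lemma continuous_dot_l (n w : 'rV[R]_3) : {for n, continuous (fun n => dot n w)}.
Proof.
have c1 : {for n, continuous (fun n : 'rV[R]_3 => n)} by exact: cvg_id.
have c2 : {for n, continuous (fun _ : 'rV[R]_3 => w)} by exact: cst_continuous.
exact: (continuous_dot c1 c2).
Qed.

Lemma continuous_dot_sqr (n : 'rV[R]_3) : {for n, continuous (fun n => dot n n)}.
Proof.
have c1 : {for n, continuous (fun n : 'rV[R]_3 => n)} by exact: cvg_id.
exact: (continuous_dot c1 c1).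
Qed.

Lemma continuous_axial e n : {for n, continuous (axial_distance e)}.
Proof.
have c : {for n, continuous (fun n => dot n n - dot n e * dot n e)}.
  apply: continuousB; first exact: continuous_dot_sqr.
  by apply: continuousM; exact: continuous_dot_l.
rewrite (_ : axial_distance e = (fun n => Num.sqrt (dot n n - dot n e * dot n e))); last first.
  by apply/funext => w; rewrite /axial_distance expr2.
exact: (@continuous_comp _ _ _ (fun n : 'rV[R]_3 => dot n n - dot n e * dot n e) Num.sqrt n c (@sqrt_continuous R _)).
Qed.

Lemma continuous_enorm_gap e n : {for n, continuous (fun n => enorm n - dot n e)}.
Proof.
apply: continuousB; last exact: continuous_dot_l.
exact: (@continuous_comp _ _ _ (fun n : 'rV[R]_3 => dot n n) Num.sqrt n (@continuous_dot_sqr n) (@sqrt_continuous R _)).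
Qed.

Lemma continuous_pairing p : {within M, continuous (fun x => dot (eta x - p) (nu x))}.
Proof.
apply: (within_continuous_charts) => U X u LX Uu.
have [sY _ _] := deta LX; have oU := local_param_open LX.
have sn := smooth_nuX LX.
exact: smooth_on_continuous (smooth_dotf oU (smoothvB oU sY (smoothv_cst U p)) sn) Uu.
Qed.

Section Support.
Variables (e xN xS : 'rV[R]_3) (lN lS : R).
Hypotheses (e1 : dot e e = 1) (MN : M xN) (MS : M xS) (lN0 : 0 < lN) (lS0 : 0 < lS).
Hypotheses (nN : nu xN = lN *: e) (nS : nu xS = - (lS *: e)).
Hypothesis fmax : forall x, M x -> dot (eta x) e <= dot (eta xN) e.

Lemma axial_pole x : M x -> ~ 0 < axial_distance e (nu x) -> x = xN \/ x = xS.
Proof.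
move=> Mx; rewrite sqrtr_gt0 => /negP; rewrite -leNgt => h.
pose c := dot (nu x) e.
have nE : nu x = c *: e.
  apply/eqP; rewrite -subr_eq0 -dot_eq0 eq_le dot_ge0 andbT; apply: le_trans h.
  by rewrite !(dotBl, dotBr, dotZl, dotZr) e1 (dotC e) -/c; lra.
have [c0|c0|c0] := ltgtP 0 c.
- left; apply: (nu_parallel_inj Mx MN (divr_gt0 c0 lN0)).
  by rewrite nN scalerA divfK ?gt_eqF.
- right; have cl : 0 < - c / lS by rewrite divr_gt0 // oppr_gt0.
  apply: (nu_parallel_inj Mx MS cl).
  by rewrite nS scalerN scalerA divfK ?gt_eqF // scaleNr opprK.
- have := nu_neq0 Mx; rewrite nE -c0 scale0r.
  by rewrite eqxx.
Qed.

(* If the pairing were negative somewhere, adding [del * gap] and the least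
   multiple of the axial distance that makes the sum nonnegative would give, away
   from the poles, a touching point to which [axial_touch] applies. *)
Lemma max_pole_support x : M x -> 0 <= dot (eta x - eta xN) (nu x).
Proof.
have half_le (a b : R) : 0 < a -> a <= b -> a / 2 <= b by lra.
have ge0_trans (a b c : R) : 0 <= a + b -> b <= c -> 0 <= a + c by lra.
have quotient (a b c : R) : - a <= b * c -> 0 <= a + b * c by lra.
move=> Mx0; rewrite leNgt; apply/negP => neg.
pose G x := dot (eta x - eta xN) (nu x); pose gap x := enorm (nu x) - dot (nu x) e.
have gap_ge0 z : 0 <= gap z by rewrite subr_ge0; exact: enorm_ge.
(* Small enough for [h x] to stay negative; the [1] keeps the denominator positive. *)
pose del := - G x / (2 * (gap x + 1)).
have gx1 : 0 < gap x + 1 by rewrite ltr_wpDl.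
have del0 : 0 < del by rewrite divr_gt0 ?oppr_gt0 // mulr_gt0.
have delx : del * gap x < - G x.
  have -> : - G x = del * (2 * (gap x + 1)) by rewrite divfK // gt_eqF // mulr_gt0.
  by rewrite ltr_pM2l //; have := gap_ge0 x; lra.
pose h z := G z + del * gap z; pose ax z := axial_distance e (nu z).
have ax_ge0 z : 0 <= ax z by exact: sqrtr_ge0.
have GN : G xN = 0 by rewrite /G subrr dot0l.
have GS : 0 <= G xS.
  rewrite /G nS dotNr dotZr oppr_ge0 pmulr_rle0 // dotBl subr_le0; exact: fmax.
have hS : 0 < h xS.
  apply: ltr_wpDl => //; apply: mulr_gt0 => //; rewrite /gap nS.
  by rewrite dotNl dotZl e1 mulr1 opprK; apply: ltr_wpDl lS0; exact: sqrtr_ge0.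
have hx : h x < 0 by rewrite /h; lra.
have axx : 0 < ax x.
  apply: contrapT => K; have [xE|xE] := axial_pole Mx0 K; move: hx.
    by rewrite xE /h GN add0r ltNge mulr_ge0 // ltW.
  by rewrite xE ltNge ltW.
(* The multiple of the axial distance that brings [h] to zero at [z]; its maximum will serve as [t]
   in [axial_touch]. *)
pose q z := - h z / ax z; have qx : 0 < q x by rewrite divr_gt0 // oppr_gt0.
have ch : {within M, continuous h}.
  have cG : {within M, continuous G} by exact: continuous_pairing.
  have cgap : {within M, continuous gap} := continuous_nu_fun (@continuous_enorm_gap e).
  move=> z; rewrite /h; apply: continuousD; first exact: cG.
  by apply: continuousM; [exact: cst_continuous|exact: cgap].
have cax : {within M, continuous ax} := continuous_nu_fun (@continuous_axial e).
have qx2 : 0 < q x / 2 by rewrite divr_gt0.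
have nearN := near_pole_ge0 deta e1 MN lN0 nN qx2.
have nearS := within_continuous_near ch MS (lt_nbhsr hS).
move: nearN nearS; set A := (fun z => M z -> _); set B := (fun z => M z -> _) => nearN nearS.
(* Off the poles [q] is continuous. The removed neighborhoods do no harm: the multiple [q x / 2]
   suffices near [xN], and [h] is positive near [xS]. *)
pose M' := M `&` ~` (A° `|` B°).
have compM' : compact M'.
  apply: compact_closedI; first exact: compact_boundary.
  by apply: open_closedC; apply: openU; exact: open_interior.
have HA z : M z -> A z -> 0 <= h z + q x / 2 * ax z.
  move=> Mz /(_ Mz) Hz; apply: le_trans Hz _; rewrite lerD2r /h lerDl.
  by rewrite mulr_ge0 // ltW.
have HB z : M z -> B z -> 0 < h z by move=> Mz; apply.
have qxE : h x = - (q x * ax x) by rewrite /q divfK ?opprK // gt_eqF.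
have M'x : M' x.
  split=> // -[/interior_subset|/interior_subset].
    move=> /(HA _ Mx0); rewrite qxE; have := mulr_gt0 qx axx; lra.
  by move=> /(HB _ Mx0); rewrite ltNge ltW.
have ax0 z : M' z -> 0 < ax z.
  move=> [Mz nz]; apply: contrapT => K; apply: nz.
  by have [->|->] := axial_pole Mz K; [left; exact: nearN|right; exact: nearS].
have cq : {within M', continuous q}.
  have sub : M' `<=` M by move=> z [].
  have ch' := (subspace_continuousP _ _).1 (continuous_subspaceW sub ch).
  have cax' := (subspace_continuousP _ _).1 (continuous_subspaceW sub cax).
  apply/subspace_continuousP => z M'z; apply: cvgM; first exact: cvgN (ch' z M'z).
  by apply: cvgV (cax' z M'z); rewrite gt_eqF // ax0.
have [y] := compact_EVT_max (ex_intro _ x M'x) compM' cq; rewrite inE => M'y qmax.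
have [My _] := M'y; have axy := ax0 y M'y.
have qxy : q x <= q y by apply: qmax; rewrite inE.
have qy0 : 0 <= q y by apply: le_trans qxy; exact: ltW.
have hy : G y + del * gap y + q y * ax y = 0.
  by rewrite -/(h y) /q divfK ?gt_eqF // subrr.
have h_ge0 z : M z -> 0 <= G z + del * gap z + q y * ax z.
  move=> Mz; rewrite -/(h z); have azz := ax_ge0 z.
  have q2 : q x / 2 * ax z <= q y * ax z by rewrite ler_wpM2r // half_le.
  have [[Az|Bz]|nz] := pselect ((A° `|` B°) z).
  - exact: ge0_trans (HA z Mz (interior_subset Az)) q2.
  - by apply: addr_ge0; [exact: ltW (HB z Mz (interior_subset Bz))|exact: mulr_ge0].
  - have M'z : M' z by [].
    have := qmax z; rewrite inE => /(_ M'z); by rewrite ler_pdivrMr ?ax0 // => /quotient.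
have := axial_touch deta e1 My qy0 del0 axy hy h_ge0.
by rewrite dotBl subr_gt0 ltNge fmax.
Qed.

End Support.

End MaxPole.

(** * Constancy of the deformation *)

Lemma isogauss_deformation eta : smooth_along M eta -> isogauss M eta -> deformation eta.
Proof.
move=> sm iso U X LX; split=> [|i u Uu|u Uu].
- exact: (smooth_smoothv (local_param_open LX) (sm U X LX)).
- exact: (pdv_deformation_tangent sm iso LX i Uu).
- by apply: (trace_deformation sm iso LX Uu); rewrite gt_eqF // K_pos //; exact: local_param_in LX Uu.
Qed.

(** The greater of the two polar values of [<eta, e>] decides. If it is taken at [y], the argument
    is applied to [- eta] and [- e], for which [y] is the maximal pole, and this reverses the
    sign. *)
Lemma pole_dichotomy eta x y (l : R) : deformation eta -> M x -> M y -> 0 < l ->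
  nu y = - (l *: nu x) ->
  (forall z, M z -> 0 <= dot (eta z - eta x) (nu z)) \/
  (forall z, M z -> dot (eta z - eta y) (nu z) <= 0).
Proof.
move=> deta Mx My l0 nuy; have n0 := nu_neq0 Mx;
pose r := Num.sqrt (dot (nu x) (nu x)); have r0 : 0 < r by rewrite sqrtr_gt0 dot_gt0.
pose e := r^-1 *: nu x.
have e1 : dot e e = 1.
  by rewrite /e dotZl dotZr mulrA -invfM -expr2 sqr_sqrtr ?dot_ge0 // mulVf // dot_eq0.
have nx : nu x = r *: e by rewrite /e scalerA divff ?scale1r // gt_eqF.
have ny : nu y = - ((l * r) *: e) by rewrite nuy nx scalerA.
have lr0 : 0 < l * r by exact: mulr_gt0.
have e0 : e != 0 by rewrite -dot_eq0 e1 oner_eq0.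
have mx := max_at_poles deta e0 Mx My r0 lr0 nx ny.
have [h|h] := leP (dot (eta y) e) (dot (eta x) e); [left|right] => z Mz.
  have f_max w : M w -> dot (eta w) e <= dot (eta x) e.
    by move=> Mw; rewrite (le_trans (mx w Mw)) // ge_max lexx.
  exact: (max_pole_support deta e1 Mx My r0 lr0 nx ny f_max Mz).
have f_max w : M w -> dot (- eta w) (- e) <= dot (- eta y) (- e).
  by move=> Mw; rewrite !dotNl !dotNr !opprK (le_trans (mx w Mw)) // ge_max lexx ltW.
have ne1 : dot (- e) (- e) = 1 by rewrite dotNl dotNr opprK.
have ny' : nu y = (l * r) *: - e by rewrite scalerN.
have nx' : nu x = - (r *: - e) by rewrite scalerN opprK.
have := max_pole_support (deformationN deta) ne1 My Mx lr0 r0 ny' nx' f_max Mz.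
by rewrite -opprD dotNl oppr_ge0.
Qed.

Lemma antipode x : M x -> exists2 y, M y & exists2 l, 0 < l & nu y = - (l *: nu x).
Proof.
move=> Mx; have n0 : - nu x != 0 by rewrite oppr_eq0; exact: (nu_neq0 Mx).
have [y My [l l0 E]] := exists_normal_direction n0.
by exists y => //; exists l => //; rewrite E scalerN.
Qed.

Lemma deformation_constant eta : deformation eta -> exists a, forall x, M x -> eta x = a.
Proof.
move=> deta.
have [[x0 Mx0]|nM] := pselect (M !=set0); last first.
  by exists 0 => x Mx; case: nM; exists x.
have M0 : M !=set0 by exists x0.
pose Pos p := forall z, M z -> 0 <= dot (eta z - p) (nu z).
pose Neg p := forall z, M z -> dot (eta z - p) (nu z) <= 0.
have Pos_uniq p q : Pos p -> Pos q -> p = q.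
  exact: (support_ge0_unique M0 deta).
have NegE p z : dot (- eta z - (- p)) (nu z) = - dot (eta z - p) (nu z).
  by rewrite -opprD dotNl.
have Neg_uniq p q : Neg p -> Neg q -> p = q.
  move=> Hp Hq; apply: oppr_inj.
  apply: (support_ge0_unique M0 (deformationN deta)) => z Mz.
    by rewrite NegE oppr_ge0; exact: Hp.
  by rewrite NegE oppr_ge0; exact: Hq.
have dich x : M x -> Pos (eta x) \/ exists y, [/\ M y, (exists2 l, 0 < l & nu y = - (l *: nu x)) & Neg (eta y)].
  move=> Mx; have [y My [l l0 ny]] := antipode Mx.
  have [H|H] := pole_dichotomy deta Mx My l0 ny; [by left|right].
  by exists y; split => //; exists l.
have [[p Pp]|noPos] := pselect (exists p, Pos p); last first.
  (* The dichotomy at the antipode of [z] yields [Neg] at the antipode of that point, which is [z]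
     again. *)
  exists (eta x0) => x Mx; have neg z : M z -> Neg (eta z).
    move=> Mz; have [y My [l l0 ny]] := antipode Mz.
    have [H|[w [Mw [k k0 nw] H]]] := dich y My; first by case: noPos; exists (eta y).
    suff -> : z = w by [].
    apply: (nu_parallel_inj Mz Mw (l := (k * l)^-1)).
      by rewrite invr_gt0 mulr_gt0.
    rewrite nw ny !scalerN opprK !scalerA -mulrA mulVf ?scale1r //.
    by rewrite gt_eqF // mulr_gt0.
  exact: Neg_uniq (neg x Mx) (neg x0 Mx0).
have [[q Nq]|noNeg] := pselect (exists q, Neg q); last first.
  exists p => x Mx; have [H|[y [_ _ H]]] := dich x Mx; first exact: Pos_uniq.
  by case: noNeg; exists (eta y).
(* Where the normal points along [p - q], the two inequalities give [dot (p - q) (p - q) <= 0]. *)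
have pq : p = q.
  apply/eqP; rewrite -subr_eq0; apply: contraT => pq0.
  have [x Mx [l l0 nx]] := exists_normal_direction pq0.
  have := Nq x Mx; have := Pp x Mx; rewrite nx !dotZr.
  rewrite pmulr_rge0 // pmulr_rle0 // => h1 h2.
  have := dot_gt0 pq0; rewrite !dotBl in h1 h2 *; lra.
(* The pairing vanishes identically, so every point is a minimum and [touch] applies with
   [m = 0]. *)
exists p => x Mx; have G0 : dot (eta x - p) (nu x) = 0.
  by apply/eqP; rewrite eq_le Pp // pq Nq.
have [_] := touch deta Mx Pp G0.
by rewrite scale0r => /eqP; rewrite subr_eq0 => /eqP.
Qed.

End ConvexSurface.

Theorem theorem2p4 (R : realType) (M : set 'rV[R]_3)
  (M_convex : closed_convex_surface M)
  (K_pos : forall x : 'rV[R]_3, M x -> 0 < gauss_curvature M x) :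
  gauss_infinitesimally_rigid M.
Proof.
have [surfM [C [convC compC [b0 b0C] MC]]] := M_convex => eta sm iso.
have deta := isogauss_deformation K_pos sm iso.
exact: (deformation_constant surfM convC compC b0C MC K_pos deta).
Qed.
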